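(* Let $n\ge1$, $f\in C^*_\delta(\mathbb{H}_n)$, $\delta>2n$, and let $$g(\zeta,\tau)=(2\pi)^{-2n}(\overset{*}{R}_H\tilde\psi)(\zeta,\tau),\qquad \tilde\psi(z,t)=\sqrt{1+|z|^2/4}\;(R_H f)(z,t).$$ Then $$f(\xi+i\eta,\tau)=(-\Delta)^n g(\xi+i\eta,\tau),\qquad \xi,\eta\in\mathbb{R}^n,\ \tau\in\mathbb{R},$$ where $$\Delta=\sum_{k=1}^n\frac{\partial^2}{\partial\xi_k^2}+\sum_{k=1}^n\frac{\partial^2}{\partial\eta_k^2}+\frac{\partial^2}{\partial\tau^2}.$$
   Context: $\mathbb{H}_n=\mathbb{C}^n\times\mathbb{R}$ (Heisenberg group); function spaces on it are identified with those on $\mathbb{R}^{2n+1}$. The Heisenberg Radon transform and its dual are $$(R_H f)(z,t)=\int_{\mathbb{C}^n}f\big(\zeta,\,t-\tfrac12\operatorname{Im}(z\cdot\bar\zeta)\big)\,d\zeta,$$ $$(\overset{*}{R}_H\varphi)(\zeta,\tau)=\int_{\mathbb{C}^n}\varphi\big(z,\,\tau-\tfrac12\operatorname{Im}(\zeta\cdot\bar z)\big)\,\frac{2\,dz}{(4+|z|^2)^{n+1/2}},$$ with $z\cdot\bar\zeta=\sum_j z_j\bar\zeta_j$. For $\delta>0$, $C_\delta(\mathbb{R}^m)=\{f\in C(\mathbb{R}^m): f(x)=O(|x|^{-\delta})\text{ as }|x|\to\infty\}$. For $\lambda\in(0,1)$, $\mathrm{Lip}^{loc}_\lambda(\mathbb{R}^m)$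 is the space of functions $f$ such that for each bounded domain $\Omega\subset\mathbb{R}^m$ there is a constant $A>0$ with $|f(x)-f(y)|\le A|x-y|^\lambda$ for all $x,y\in\bar\Omega$. $C^*_\delta(\mathbb{R}^m)=\{f: f\in C_\delta(\mathbb{R}^m)\cap \mathrm{Lip}^{loc}_\lambda(\mathbb{R}^m)\text{ for some }\lambda\in(0,1)\}$, and $C^*_\delta(\mathbb{H}_n)$ is $C^*_\delta(\mathbb{R}^{2n+1})$ under the identification $(\xi+i\eta,\tau)\leftrightarrow(\xi,\eta,\tau)$. *)

(* Defs.v *)
From HB Require Import structures.
From mathcomp Require Import all_boot all_order all_algebra.
From mathcomp Require Import all_classical all_reals all_analysis.
From mathcomp Require Import complex.
Set Implicit Arguments.
Unset Strict Implicit.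
Unset Printing Implicit Defensive.
Import Order.TTheory GRing.Theory Num.Theory.
Import numFieldNormedType.Exports.
Local Open Scope classical_set_scope.
Local Open Scope ring_scope.
Local Open Scope complex_scope.

(* Lebesgue measure on the Borel sets of R^m, R^m being the m-tuples of reals
   with the product sigma-algebra: the m-fold product of lebesgue_measure,
   built by transporting the product on R^m * R along (x, a) |-> a :: x.
   leb_box checks it on boxes. *)
Section lebesgue_Rm.
Context {R : realType}.
Local Notation Rb := (measurableTypeR R).

Definition tcons m (p : m.-tuple Rb * Rb) : m.+1.-tuple Rb :=
  [the m.+1.-tuple Rb of p.2 :: p.1].

Lemma measurable_tcons m : measurable_fun [set: m.-tuple Rb * Rb] (@tcons m).
Proof. exact: measurable_cons. Qed.

Section leb_cons.
Context m (mu : {measure set (m.-tuple Rb) -> \bar R}).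

Definition leb_cons := pushforward (mu \x @lebesgue_measure R)%E (@tcons m).

Let pf := measure_function_pushforward__canonical__measure_function_Measure
  (mu \x @lebesgue_measure R)%E (@measurable_tcons m).

Let leb_cons0 : leb_cons set0 = 0%E.
Proof. exact: (@measure0 _ _ _ pf). Qed.

Let leb_cons_ge0 A : (0 <= leb_cons A)%E.
Proof. exact: (@measure_ge0 _ _ _ pf). Qed.

Let leb_cons_sigma_additive : semi_sigma_additive leb_cons.
Proof. exact: (@measure_semi_sigma_additive _ _ _ pf). Qed.

HB.instance Definition _ := isMeasure.Build _ _ _ leb_cons
  leb_cons0 leb_cons_ge0 leb_cons_sigma_additive.
End leb_cons.

Fixpoint leb m : {measure set (m.-tuple Rb) -> \bar R} :=
  if m is m'.+1 then leb_cons (leb m') else dirac [tuple].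

Definition box m (a b : 'I_m -> R) : set (m.-tuple Rb) :=
  [set x | forall i, a i < tnth x i <= b i].

Lemma measurable_box m (a b : 'I_m -> R) : measurable (box a b).
Proof.
rewrite (_ : box a b = \bigcap_(i in [set: 'I_m])
   ((fun x : m.-tuple Rb => tnth x i) @^-1` `]a i, b i])).
  apply: fin_bigcap_measurable; first exact: finite_finset.
  move=> i _; rewrite -[X in measurable X]setTI.
  by apply: measurable_tnth => //; exact: measurable_itv.
apply/seteqP; split=> x /= bx i; first by move=> _ /=; rewrite in_itv /= bx.
by have /(_ I) := bx i; rewrite /= in_itv.
Qed.

Lemma leb_box m (a b : 'I_m -> R) : (forall i, a i <= b i) ->
  leb m (box a b) = (\prod_(i < m) (b i - a i))%:E.
Proof.
elim: m a b => [|m IH] a b ab /=.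
  by rewrite /dirac big_ord0 indicE mem_set// => -[].
rewrite /leb_cons /pushforward.
rewrite (_ : _ @^-1` _ =
    box (a \o lift ord0) (b \o lift ord0) `*` `]a ord0, b ord0]).
  rewrite product_measure1E//; last exact: measurable_box.
  rewrite IH; last by move=> i /=.
  rewrite [X in (_ * X)%E](_ : _ = (b ord0 - a ord0)%:E).
    by rewrite big_ord_recl muleC -EFinM.
  rewrite [LHS](lebesgue_measure_itv `]a ord0, b ord0]) /= lte_fin.
  have := ab ord0; rewrite le_eqVlt => /orP[/eqP ->|->].
    by rewrite ltxx subrr.
  by rewrite -EFinB.
apply/seteqP; split=> -[x r] /=.
  move=> bx; split.
    by move=> i; have := bx (lift ord0 i); rewrite tnthS.
  by have := bx ord0; rewrite in_itv /= tnth0.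
move=> [bx rx] i; case: (unliftP ord0 i) => [j ->|->].
  by rewrite tnthS; exact: bx.
by move: rx; rewrite in_itv /= tnth0.
Qed.
End lebesgue_Rm.

Section function_spaces.
Context {R : realType}.
Implicit Type m : nat.

(* Euclidean norm; the library norm on 'rV is the sup norm *)
Definition enorm m (x : 'rV[R]_m) : R := Num.sqrt (\sum_(i < m) x 0 i ^+ 2).

Definition C_ (delta : R) m (f : 'rV[R]_m -> R[i]) : Prop :=
  continuous (f : 'rV[R]_m -> R[i]^o) /\
  exists A : R, exists2 M : R, 0 < M &
    forall x, M < enorm x -> Normc.normc (f x) <= A * enorm x `^ (- delta).

Definition Lip_loc (lambda : R) m (f : 'rV[R]_m -> R[i]) : Prop :=
  forall Omega : set 'rV[R]_m,
    open Omega -> connected Omega -> bounded_set Omega ->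
    exists2 A : R, 0 < A &
      forall x y, closure Omega x -> closure Omega y ->
        Normc.normc (f x - f y) <= A * enorm (x - y) `^ lambda.

Definition Cstar (delta : R) m (f : 'rV[R]_m -> R[i]) : Prop :=
  exists lambda : R, [/\ 0 < lambda, lambda < 1, C_ delta f & Lip_loc lambda f].

End function_spaces.

Section heisenberg.
Context {R : realType}.
Implicit Type n : nat.

Definition heis n : Type := ('rV[R[i]]_n * R)%type.

Definition cplx n (xi eta : 'rV[R]_n) : 'rV[R[i]]_n :=
  \row_j (xi 0 j +i* eta 0 j).

(* (xi, eta, tau) |-> (xi + i eta, tau) *)
Definition heis_of n (v : 'rV[R]_(n + n + 1)) : heis n :=
  (cplx (lsubmx (lsubmx v)) (rsubmx (lsubmx v)), rsubmx v 0 0).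

Definition Cstar_heis (delta : R) n (f : heis n -> R[i]) : Prop :=
  Cstar delta (f \o @heis_of n).

Definition hdot n (z w : 'rV[R[i]]_n) : R[i] := \sum_j z 0 j * conjc (w 0 j).

Definition cnorm n (z : 'rV[R[i]]_n) : R :=
  Num.sqrt (\sum_j Normc.normc (z 0 j) ^+ 2).

(* d zeta on C^n is Lebesgue measure on R^(2n), the first n coordinates being
   the real parts *)
Definition cplx_of_tuple n (x : (n + n).-tuple (measurableTypeR R)) :
    'rV[R[i]]_n :=
  \row_j (tnth x (lshift n j) +i* tnth x (rshift n j)).

Definition Cint n (u : 'rV[R[i]]_n -> R[i]) : R[i] :=
  (\int[leb (n + n)]_x complex.Re (u (cplx_of_tuple x))) +i*
  (\int[leb (n + n)]_x complex.Im (u (cplx_of_tuple x))).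

Definition Cintegrable n (u : 'rV[R[i]]_n -> R[i]) : Prop :=
  (leb (n + n)).-integrable setT
    (fun x => (complex.Re (u (cplx_of_tuple x)))%:E) /\
  (leb (n + n)).-integrable setT
    (fun x => (complex.Im (u (cplx_of_tuple x)))%:E).

Definition RH_integrand n (f : heis n -> R[i]) (z : 'rV[R[i]]_n) (t : R)
    (zeta : 'rV[R[i]]_n) : R[i] :=
  f (zeta, t - 2^-1 * complex.Im (hdot z zeta)).

Definition RH n (f : heis n -> R[i]) (p : heis n) : R[i] :=
  Cint (RH_integrand f p.1 p.2).

Definition RHdual_integrand n (phi : heis n -> R[i]) (zeta : 'rV[R[i]]_n)
    (tau : R) (z : 'rV[R[i]]_n) : R[i] :=
  phi (z, tau - 2^-1 * complex.Im (hdot zeta z)) *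
  (2 / (4 + cnorm z ^+ 2) `^ (n%:R + 2^-1))%:C.

Definition RHdual n (phi : heis n -> R[i]) (p : heis n) : R[i] :=
  Cint (RHdual_integrand phi p.1 p.2).

End heisenberg.

Section laplacian.
Context {R : realType}.

(* derivatives of complex-valued functions of real variables, taken on real and
   imaginary parts *)
Definition pderivable m (u : 'rV[R]_m -> R[i]) (j : 'I_m) (x : 'rV[R]_m) :=
  derivable (fun y => complex.Re (u y)) x (delta_mx 0 j) /\
  derivable (fun y => complex.Im (u y)) x (delta_mx 0 j).

Definition partial m (j : 'I_m) (u : 'rV[R]_m -> R[i]) (x : 'rV[R]_m) : R[i] :=
  'D_(delta_mx 0 j) (fun y => complex.Re (u y)) x +i*
  'D_(delta_mx 0 j) (fun y => complex.Im (u y)) x.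

Definition partial2 m (j : 'I_m) (u : 'rV[R]_m -> R[i]) : 'rV[R]_m -> R[i] :=
  partial j (partial j u).

Definition laplacian n (u : 'rV[R]_(n + n + 1) -> R[i])
    (v : 'rV[R]_(n + n + 1)) : R[i] :=
  \sum_(k < n) partial2 (lshift 1 (lshift n k)) u v +
  \sum_(k < n) partial2 (lshift 1 (rshift n k)) u v +
  partial2 (rshift (n + n) ord0) u v.

(* every derivative entering laplacian u exists, so that laplacian u involves
   no default value of 'D *)
Definition has_laplacian n (u : 'rV[R]_(n + n + 1) -> R[i]) : Prop :=
  forall j v, pderivable u j v /\ pderivable (partial j u) j v.

Definition neg_laplacian n (u : 'rV[R]_(n + n + 1) -> R[i])
    (v : 'rV[R]_(n + n + 1)) : R[i] := - laplacian u v.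

End laplacian.

(* Main.v *)
(* In real coordinates the integrand of [RH f] at a point [x] of [C^n], viewed
   from [x0], depends on the variable [w] of the dual transform only through
   an affine function of slope [|x - x0| / 2]. Exchanging the integrals, the
   integral over [w] is that of a ridge function against a power of
   [4 + |w|^2]; it is evaluated one coordinate at a time by Cauchy integrals,
   and [g] turns out to be a constant
   multiple of the convolution of [f] with [|x|^-1] on [R^(2n+1)], the Euclidean
   norm appearing although the group law is twisted. Each of the first [n - 1]
   Laplacians falls on the kernel, turning [|x|^(-2k-1)] into a multiple of
   [|x|^(-2k-3)], all the derivatives involved being locally integrable;
   differentiation is justified by the kernels [(|x|^2 + e)^-p] as [e] tends
   to [0]. The last step starts from a multiple of
   the Newtonian kernel, whose second derivatives are not integrable. There
   [(|x|^2 + e)^-p - (|x|^2 + 1)^-p] is used: its second derivatives have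
   integral zero, so [f (x - y)] may be replaced by [f (x - y) - f x], and the
   Hoelder condition makes the limit converge. *)
Require Import Defs.
From HB Require Import structures.
From mathcomp Require Import all_boot all_order all_algebra.
From mathcomp Require Import all_classical all_reals all_analysis.
From mathcomp Require Import complex.
From mathcomp Require Import measurable_realfun ring lra.
Set Implicit Arguments.
Unset Strict Implicit.
Unset Printing Implicit Defensive.
Import Order.TTheory GRing.Theory Num.Theory.
Import numFieldNormedType.Exports.
Local Open Scope classical_set_scope.
Local Open Scope ring_scope.

(** * Integration on tuples *)

Section lebesgue_tuples.
Context {R : realType}.
Local Notation Rb := (measurableTypeR R).
Local Notation lam := (@lebesgue_measure R).

(** The two twists of the group law combine into a linear form in [w] with coefficient vector
    [i (x - x0) / 2]. Multiplication by [i] is an isometry, so only the Euclidean length of [x - x0]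
    survives. The factor [sqrt(1 + |w|^2 / 4)] turns the dual weight into [(4 + |w|^2)^(-n)], for
    which integrating out [2n - 1] of the [2n] coordinates leaves [(4 + s^2 / L)^(-1/2)]. With the
    Jacobian [L^(-1/2)] and [4 L = |x - x0|^2] this is an inverse distance. That weight is not
    integrable on R^(2n) (the divergence is logarithmic), and [delta > 2n] does not make [f]
    integrable. So the integrals are exchanged by Tonelli for nonnegative functions, then for
    positive and negative parts, finiteness being read off from the potential; and kernels must
    decay at least like [|x|^(-1)]. Gamma functions are avoided: the one-variable Cauchy integrals
    stay symbolic, and only products of two of them half a step apart are evaluated. The final
    constant is checked by induction on [n], each step inserting one such pair in each of two
    products. *)

Definition lebm m : set (m.-tuple Rb) -> \bar R := leb m.

HB.instance Definition _ m := Measure.on (@lebm m).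

(** Growing cubes exhaust the space. [lebm] is a name for [leb] that can carry this instance, which
    the Tonelli theorems on products of tuples require. *)
Lemma lebm_sigma_finite m : sigma_finite [set: m.-tuple Rb] (@lebm m).
Proof.
exists (fun k : nat => box (fun _ : 'I_m => - k.+1%:R : R) (fun _ => k.+1%:R)).
  apply/seteqP; split=> // x _.
  exists (\sum_(i < m) Num.truncn `|tnth x i|)%N => //= i.
  have h : `|tnth x i| < (\sum_(i < m) Num.truncn `|tnth x i|)%N.+1%:R.
    apply: (lt_le_trans (truncnS_gt `|tnth x i|)).
    by rewrite ler_nat ltnS (bigD1 i)//= leq_addr.
  by move: h; rewrite ltr_norml => /andP[-> /ltW ->].
move=> k; split; first exact: measurable_box.
by rewrite /lebm leb_box ?ltry// => i; rewrite (@le_trans _ _ 0)// oppr_le0.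
Qed.

HB.instance Definition _ m :=
  Measure_isSigmaFinite.Build _ _ _ (@lebm m) (@lebm_sigma_finite m).

Local Open Scope ereal_scope.

Lemma ge0_integralTZl d (T : measurableType d) (mu : {measure set T -> \bar R})
    (f : T -> \bar R) (k : R) :
  (0 <= k)%R -> (forall x, 0 <= f x) -> measurable_fun setT f ->
  \int[mu]_x (k%:E * f x) = k%:E * \int[mu]_x f x.
Proof. by move=> k0 f0 mf; apply: ge0_integralZl_EFin => // x _; exact: f0. Qed.

Lemma integral_leb0 (f : 0.-tuple Rb -> \bar R) :
  \int[lebm (m:=0)]_x f x = f [tuple].
Proof.
rewrite [LHS](_ : _ = \int[@dirac _ _ ([tuple] : 0.-tuple Rb) R]_x f x)//.
rewrite integral_dirac//; last first.
  move=> _ Y mY; rewrite setTI.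
  have [h|h] := pselect (Y (f [tuple])).
    by rewrite (_ : _ @^-1` _ = setT)//; apply/seteqP; split=> // x _ /=; rewrite tuple0.
  by rewrite (_ : _ @^-1` _ = set0)//; apply/seteqP; split=> // x /=; rewrite tuple0.
by rewrite diracT mul1e.
Qed.

Lemma integral_lebS m (f : m.+1.-tuple Rb -> \bar R) :
  measurable_fun [set: m.+1.-tuple Rb] f -> (forall x, 0 <= f x) ->
  \int[@lebm m.+1]_x f x = \int[lam]_a \int[@lebm m]_x f (tcons (x, a)).
Proof.
move=> mf f0.
rewrite [LHS](_ : _ = \int[pushforward (@lebm m \x lam) (@tcons R m)]_x f x)//.
rewrite ge0_integral_pushforward//; last exact: measurable_tcons.
rewrite preimage_setT (fubini_tonelli2 (f \o @tcons R m))//.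
  by apply: measurableT_comp => //; exact: measurable_tcons.
by move=> x /=.
Qed.

Lemma measurable_tconsr m (f : m.+1.-tuple Rb -> \bar R) a :
  measurable_fun [set: m.+1.-tuple Rb] f -> measurable_fun [set: m.-tuple Rb] (fun x => f (tcons (x, a))).
Proof.
move=> mf; apply: (measurableT_comp (f := f)) => //.
apply: (measurableT_comp (f := @tcons R m)); first exact: measurable_tcons.
exact: measurable_fun_pair.
Qed.

Lemma measurable_integral_lebS m (f : m.+1.-tuple Rb -> \bar R) :
  measurable_fun [set: m.+1.-tuple Rb] f -> (forall x, 0 <= f x) ->
  measurable_fun setT (fun a => \int[@lebm m]_x f (tcons (x, a))).
Proof.
move=> mf f0; apply: (measurable_fun_fubini_tonelli_G (f \o @tcons R m)) => //.
  by apply: measurableT_comp => //; exact: measurable_tcons.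
by move=> x /=.
Qed.

(** The pushforward of Lebesgue measure under [x |-> a x + b], scaled by [|a|], agrees with Lebesgue
    measure on half-open intervals, hence everywhere. *)
Lemma integral_affine (f : R -> \bar R) (a b : R) : a != 0%R ->
  measurable_fun setT f -> (forall x, 0 <= f x) ->
  \int[lam]_x f (a * x + b)%R = `|a|^-1%:E * \int[lam]_x f x.
Proof.
move=> a0 mf f0.
pose phi := (fun x : R => a * x + b)%R : Rb -> Rb.
have mphi : measurable_fun setT phi.
  apply: measurable_funD => //; exact: mulrl_measurable.
rewrite -[LHS]/(\int[lam]_(x in phi @^-1` setT) (f \o phi) x).
rewrite -ge0_integral_pushforward//.
have a1 : (0 <= `|a|^-1)%R by rewrite invr_ge0.
rewrite -[RHS](ge0_integral_mscale lam measurableT (NngNum a1))//.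
apply: eq_measure_integral => A mA _.
have ai : (0 < `|a|)%R by rewrite normr_gt0.
suff : forall A, measurable A -> lam A =
    mscale (NngNum (normr_ge0 a))
     (measure_function_pushforward__canonical__measure_function_Measure lam mphi) A.
  move=> /(_ A mA) h.
  change (pushforward lam phi A = (`|a|^-1)%:E * lam A); rewrite h.
  change (pushforward lam phi A = (`|a|^-1)%:E * (`|a|%:E * pushforward lam phi A)).
  by rewrite muleA -EFinM mulVf ?gt_eqF// mul1e.
apply: lebesgue_measure_unique => _ [[u v] _ <-] /=.
rewrite /mscale /= /pushforward.
(* For [a < 0] the map reverses order, so the preimage is closed on the left instead of the
   right. *)
have -> : phi @^-1` `]u, v]%classic =
   (if (0 < a)%R then `](u - b) / a, (v - b) / a]%classic
   else `[(v - b) / a, (u - b) / a[%classic)%R.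
  case: ifPn => ha.
    apply/seteqP; split=> x /=; rewrite !in_itv /= /phi ltr_pdivrMr// ler_pdivlMr//
     ltrBlDr lerBrDr mulrC//.
  have {}ha : (a < 0)%R by rewrite lt_neqAle a0 leNgt.
  apply/seteqP; split=> x /=; rewrite !in_itv /= /phi ltr_ndivlMr// ler_ndivrMr//
     ltrBlDr lerBrDr mulrC andbC//.
rewrite lebesgue_measure_itv /= lte_fin.
case: (ltP 0%R a) => ha.
  rewrite (lebesgue_measure_itv `](u - b) / a, (v - b) / a]%R) /= lte_fin.
  rewrite ltr_pM2r ?invr_gt0// ltrD2r; case: ifPn => // h; last by rewrite mule0.
  rewrite -EFinM; congr EFin; rewrite gtr0_norm//; by field.
have {}ha : (a < 0)%R by rewrite lt_neqAle a0.
rewrite (lebesgue_measure_itv `[(v - b) / a, (u - b) / a[%R) /= lte_fin.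
rewrite ltr_nM2r ?invr_lt0// ltrD2r; case: ifPn => // h; last by rewrite mule0.
rewrite -EFinM; congr EFin; rewrite ltr0_norm//; by field.
Qed.

Lemma integral_leb_reflect m (f : m.-tuple Rb -> \bar R) (a : 'I_m -> R) :
  measurable_fun [set: m.-tuple Rb] f -> (forall x, 0 <= f x) ->
  \int[@lebm m]_x f [tuple (a i - tnth x i)%R | i < m] = \int[@lebm m]_x f x.
Proof.
elim: m f a => [|m IH] f a mf f0; first by rewrite !integral_leb0 tuple0.
have mr k (b : 'I_k -> R) : measurable_fun [set: k.-tuple Rb]
    (fun x : k.-tuple Rb => [tuple (b i - tnth x i)%R | i < k] : k.-tuple Rb).
  apply/measurable_fun_tnthP => i /=.
  rewrite (_ : _ \o _ = (fun x => b i - tnth x i)%R).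
    apply: measurable_funB => //; exact: measurable_tnth.
  by apply/funext => x /=; rewrite tnth_mktuple.
have mfr : measurable_fun [set: m.+1.-tuple Rb]
    (fun x : m.+1.-tuple Rb => f [tuple (a i - tnth x i)%R | i < m.+1]).
  by apply: (measurableT_comp (f := f)) => //; exact: mr.
rewrite !integral_lebS//.
have E x (r : R) : [tuple (a i - tnth (tcons (x, r)) i)%R | i < m.+1] =
    tcons ([tuple (a (lift ord0 i) - tnth x i)%R | i < m], a ord0 - r)%R.
  apply: eq_from_tnth => i; rewrite tnth_mktuple.
  case: (unliftP ord0 i) => [j ->|->]; first by rewrite !tnthS tnth_mktuple.
  by rewrite !tnth0.
under eq_integral do under eq_integral do rewrite E.
transitivity (\int[lam]_r \int[@lebm m]_x f (tcons (x, a ord0 - r)%R)).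
  apply: eq_integral => r _.
  by rewrite (IH (fun x => f (tcons (x, a ord0 - r)%R)))//; exact: measurable_tconsr.
have := @integral_affine (fun r => \int[@lebm m]_x f (tcons (x, r))) (- 1)%R (a ord0).
rewrite normrN normr1 invr1 mul1e => <-.
- by apply: eq_integral => r _; rewrite mulN1r addrC.
- by rewrite oppr_eq0 oner_neq0.
- exact: measurable_integral_lebS.
- by move=> r; apply: integral_ge0.
Qed.

Fixpoint tprod m (phi : R -> \bar R) : m.-tuple Rb -> \bar R :=
  match m with
  | 0 => fun=> 1
  | m'.+1 => fun x => phi (tnth x ord0) * tprod phi [tuple of behead x]
  end.

Lemma tprod_ge0 m phi (x : m.-tuple Rb) : (forall r, 0 <= phi r) -> 0 <= tprod phi x.
Proof. by move=> p0; elim: m x => //= m IH x; rewrite mule_ge0. Qed.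

Lemma measurable_tprod m phi : (forall r, 0 <= phi r) ->
  measurable_fun setT phi -> measurable_fun [set: m.-tuple Rb] (@tprod m phi).
Proof.
move=> p0 mp; elim: m => [|m IH] /=; first exact: measurable_cst.
apply: emeasurable_funM.
  by apply: measurableT_comp => //; exact: measurable_tnth.
by apply: measurableT_comp => //; exact: measurable_behead.
Qed.

Lemma integral_tprod_lty m phi : (forall r, 0 <= phi r) ->
  measurable_fun setT phi -> \int[lam]_r phi r < +oo ->
  \int[@lebm m]_x tprod phi x < +oo.
Proof.
move=> p0 mp plty; elim: m => [|m IH]; first by rewrite integral_leb0 /= ltry.
rewrite integral_lebS//; last 2 first.
  exact: measurable_tprod.
  by move=> x; exact: tprod_ge0.
under eq_integral => r _.
  rewrite (_ : \int[_]_x _ = phi r * \int[@lebm m]_x tprod phi x); last first.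
    rewrite -ge0_integralZl//; last 2 first.
    - exact: measurable_tprod.
    - by move=> *; exact: tprod_ge0.
    apply: eq_integral => x _ /=; rewrite tnth0; congr (_ * tprod _ _).
    exact/val_inj.
  over.
rewrite ge0_integralZr//; last by apply: integral_ge0 => x _; exact: tprod_ge0.
by apply: lte_mul_pinfty => //; [exact: integral_ge0|rewrite ge0_fin_numE// integral_ge0].
Qed.
End lebesgue_tuples.

(** * One-dimensional Cauchy integrals *)

Section cauchy_integrals.
Context {R : realType}.
Local Notation Rb := (measurableTypeR R).
Local Notation lam := (@lebesgue_measure R).

Lemma powR_continuous_at (a p : R) : 0 < a -> {for a, continuous (fun x : R => x `^ p)}.
Proof.
move=> a0; apply: differentiable_continuous; apply/derivable1_diffP.
by apply: derivable_powR; rewrite in_itv /= a0.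
Qed.

Lemma continuous_powR (T : topologicalType) (f : T -> R) (p : R) :
  continuous f -> (forall x, 0 < f x) -> continuous (fun x => f x `^ p).
Proof.
move=> cf f0 x; apply: (@continuous_comp _ _ _ f (fun y => y `^ p)); first exact: cf.
exact: powR_continuous_at.
Qed.

Lemma powR_cvg0y (p : R) : 0 < p -> (x `^ (- p) @[x --> +oo] --> (0 : R)).
Proof.
move=> p0; apply/cvgrPdist_le => e e0; near=> x.
have x0 : 0 < x by near: x; exact: nbhs_pinfty_gt.
rewrite sub0r normrN ger0_norm ?powR_ge0//.
have : e `^ (- p^-1) <= x by near: x; apply: nbhs_pinfty_ge; exact: num_real.
move=> h; rewrite powRN -[leRHS]invrK lef_pV2 ?posrE ?powR_gt0// ?invr_gt0//.
have := ge0_ler_powR (ltW p0) _ _ h; rewrite !nnegrE => /(_ (powR_ge0 _ _) (ltW x0)).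
by rewrite -powRrM mulNr mulVf ?gt_eqF// powR_inv1// ltW.
Unshelve. all: end_near. Qed.

Lemma integral_even_halfline (f : R -> R) : (forall x, 0 <= f x) ->
  continuous f -> (forall x, f (- x) = f x) ->
  (\int[lam]_x (f x)%:E = 2%:E * \int[lam]_(x in `[0%R, +oo[) (f x)%:E)%E.
Proof.
move=> f0 cf fe; rewrite ge0_symfun_integralT//; last by move=> x /=; rewrite fe.
by congr (_ * _)%E; rewrite set_itvcy.
Qed.

Lemma one_sqr_gt0 (x : R) : 0 < 1 + x ^+ 2.
Proof. by rewrite ltr_pwDl// sqr_ge0. Qed.
Hint Resolve one_sqr_gt0 : core.

Lemma continuous_one_sqr : continuous (fun x : R => 1 + x ^+ 2).
Proof. exact: continuous_oneDsqr. Qed.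

(** This is [sqrt(pi) Gamma(q - 1/2) / Gamma(q)]. It stays an integral: the value at [1] and the
    products in [cauchy_const_pair] are all that the final constant uses. *)
Definition cauchy_const (q : R) : R := \int[lam]_x ((1 + x ^+ 2) `^ (- q)).

Lemma integral_cauchy1 : (\int[lam]_x ((1 + x ^+ 2) `^ (- 1))%:E = pi%:E)%E.
Proof.
rewrite integral_even_halfline.
- under eq_integral do rewrite powR_inv1 ?ltW//.
  rewrite integral0y_oneDsqr -EFinM; congr EFin; by field.
- by move=> x; rewrite powR_ge0.
- by apply: continuous_powR => //; exact: continuous_one_sqr.
- by move=> x; rewrite sqrrN.
Qed.

Lemma measurable_cauchy p (A k b : R) : measurable_fun setT
  (fun x : R => (A + k * (x - b) ^+ 2) `^ p).
Proof.
apply: (measurableT_comp (measurable_powR p)).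
apply: measurable_funD => //; apply: measurable_funM => //.
by apply: (measurable_funX 2); exact: measurable_funB.
Qed.

Lemma measurable_cauchy1 p : measurable_fun setT
  (fun x : R => (1 + x ^+ 2) `^ p).
Proof.
apply: (measurableT_comp (measurable_powR p)); apply: measurable_funD => //.
Qed.

Lemma integral_cauchyE (q : R) : 1 <= q ->
  (\int[lam]_x ((1 + x ^+ 2) `^ (- q))%:E = (cauchy_const q)%:E)%E.
Proof.
move=> q1; rewrite /cauchy_const /Rintegral fineK// ge0_fin_numE; last first.
  by apply: integral_ge0 => x _; rewrite lee_fin powR_ge0.
apply: (@le_lt_trans _ _ (\int[lam]_x ((1 + x ^+ 2) `^ (- 1))%:E)%E).
  apply: ge0_le_integral => //=.
  - by move=> x _; rewrite lee_fin powR_ge0.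
  - by apply/measurable_EFinP; exact: measurable_cauchy1.
  - by apply/measurable_EFinP; exact: measurable_cauchy1.
  - by move=> x _; rewrite lee_fin ler_powR ?lerN2// lerDl sqr_ge0.
by rewrite integral_cauchy1 ltry.
Qed.

Lemma cauchy_const1 : cauchy_const 1 = pi.
Proof. by apply: EFin_inj; rewrite -integral_cauchyE// integral_cauchy1. Qed.

Lemma integral_cauchy (q A k b : R) : 1 <= q -> 0 < A -> 0 < k ->
  (\int[lam]_x ((A + k * (x - b) ^+ 2) `^ (- q))%:E =
   (k `^ (- 2^-1) * A `^ (2^-1 - q) * cauchy_const q)%:E)%E.
Proof.
move=> q1 A0 k0.
pose a := Num.sqrt (k / A).
have a0 : 0 < a by rewrite sqrtr_gt0 divr_gt0.
have aa : a ^+ 2 = k / A by rewrite sqr_sqrtr// ltW// divr_gt0.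
have E x : (A + k * (x - b) ^+ 2) = A * (1 + (a * x + (- a * b)) ^+ 2).
  by rewrite mulNr -mulrBr exprMn aa; field; rewrite gt_eqF.
under eq_integral => x _ do rewrite E powRM ?ltW// EFinM.
rewrite ge0_integralZl_EFin//; last 3 first.
- by move=> x _; rewrite lee_fin powR_ge0.
- apply/measurable_EFinP; apply: (measurableT_comp (measurable_powR _)).
  apply: measurable_funD => //; apply: (measurable_funX 2).
  by apply: measurable_funD => //; exact: mulrl_measurable.
- exact: powR_ge0.
rewrite (integral_affine (f := fun x => ((1 + x ^+ 2) `^ (- q))%:E)).
- rewrite integral_cauchyE// -!EFinM gtr0_norm//; congr EFin.
  rewrite mulrA; congr (_ * _).
  rewrite /a sqrtrM ?ltW// sqrtrV ?ltW// -!powR12_sqrt ?ltW// invfM invrK.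
  rewrite -powRN powRD; last by rewrite (gt_eqF A0) implybT.
  by ring.
- by rewrite gt_eqF.
- by apply/measurable_EFinP; exact: measurable_cauchy1.
- by move=> x; rewrite lee_fin powR_ge0.
Qed.

(** The factor [|y|] is the Jacobian of the substitution in [cauchy_const_pair]; it makes the
    integrand elementary on each half-line. *)
Lemma integral_radial (s B : R) : 1 < s -> 0 < B ->
  (\int[lam]_y (`|y| * (1 + B * y ^+ 2) `^ (- s))%:E = ((s - 1)^-1 / B)%:E)%E.
Proof.
move=> s1 B0.
have pos y : 0 < 1 + B * y ^+ 2 by rewrite ltr_pwDl// mulr_ge0 ?sqr_ge0// ltW.
have c1 : continuous (fun y : R => 1 + B * y ^+ 2).
  move=> y; apply: cvgD; first exact: cvg_cst.
  by apply: cvgM; [exact: cvg_cst|exact: exprn_continuous].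
rewrite integral_even_halfline; last 3 first.
- by move=> y; rewrite mulr_ge0// powR_ge0.
- move=> y; apply: cvgM; first exact: norm_continuous.
  exact: (continuous_powR (p := - s) c1 pos).
- by move=> y; rewrite normrN sqrrN.
pose F y : R := - (2 * B * (s - 1))^-1 * (1 + B * y ^+ 2) `^ (1 - s).
have s10 : 2 * B * (s - 1) != 0 by rewrite !mulf_neq0 ?gt_eqF// subr_gt0.
have dF (y : R) : is_derive y (1:R) F (y * (1 + B * y ^+ 2) `^ (- s)).
  have H1 : is_derive (1 + B * y ^+ 2) (1:R) (fun x : R => x `^ (1 - s))
     ((1 - s) * (1 + B * y ^+ 2) `^ (1 - s - 1)) by exact: is_derive1_powR.
  have H2 : is_derive y (1:R) (fun x : R => 1 + B * x ^+ 2) (2 * B * y).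
    apply: is_derive_eq; rewrite /GRing.scale /=; ring.
  have H3 := @is_derive1_comp R (fun x : R => x `^ (1 - s)) (fun x : R => 1 + B * x ^+ 2) y _ _ H1 H2.
  have H4 : is_derive y (1:R) F _ := is_deriveZ (- (2 * B * (s - 1))^-1) H3.
  apply: (is_derive_eq H4); rewrite /GRing.scale /=.
  rewrite (_ : 1 - s - 1 = - s); last by ring.
  by field; rewrite subr_eq0 !gt_eqF.
transitivity (2%:E * (0%:E - (F 0)%:E))%E; last first.
  rewrite /F expr0n/= mulr0 addr0 powR1 mulr1 -EFinD -EFinM; congr EFin.
  by field; rewrite gt_eqF//= gt_eqF// subr_gt0.
congr (_ * _)%E.
under eq_integral => y.
  rewrite inE /= in_itv /= andbT => y0.
  rewrite ger0_norm//.
  over.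
apply: (@ge0_continuous_FTC2y _ (fun y : R => y * (1 + B * y ^+ 2) `^ (- s)) F 0 0).
- by move=> y y0; rewrite mulr_ge0// powR_ge0.
- apply: continuous_subspaceT => y; apply: cvgM; first exact: cvg_id.
  exact: (continuous_powR (p := - s) c1 pos).
- rewrite -(mulr0 (- (2 * B * (s - 1))^-1)); apply: cvgM; first exact: cvg_cst.
  rewrite (_ : 1 - s = - (s - 1)); last by ring.
  apply: (@cvg_comp _ _ _ (fun y : R => 1 + B * y ^+ 2) (fun x : R => x `^ (- (s - 1))) _ (+oo : set_system R)); last first.
    by apply: powR_cvg0y; rewrite subr_gt0.
  apply/cvgryPge => M; near=> y.
  have y1 : 1 <= y by near: y; apply: nbhs_pinfty_ge; exact: num_real.
  have yM : M / B <= y by near: y; apply: nbhs_pinfty_ge; exact: num_real.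
  rewrite (@le_trans _ _ (B * y))//; first by rewrite mulrC -ler_pdivrMr.
  rewrite (@le_trans _ _ (B * y ^+ 2))// ?lerDr//.
  by rewrite ler_pM2l// expr2 ler_peMr// (le_trans ler01).
- by move=> y _; have [] := dF y.
- apply: cvg_at_right_filter.
  by apply: differentiable_continuous; apply/derivable1_diffP; have [] := dF 0.
- by move=> y _; rewrite derive1E; have [_ ->] := dF y.
Unshelve. all: end_near. Qed.

(** Two evaluations of the double integral of [(1 + x^2 + y^2)^(-s)] with [s = q + 1/2]. Integrating
    in [y] first gives the product on the left. The substitution [x = y t], for [y != 0], gives
    [|y| (1 + (1 + t^2) y^2)^(-s)], which is elementary in [y] and leaves
    [(1 + t^2)^(-1) / (s - 1)], an arctangent integral. *)
Lemma cauchy_const_pair (q : R) : 1 <= q ->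
  cauchy_const q * cauchy_const (q + 2^-1) = 2 * pi / (2 * q - 1).
Proof.
move=> q1; apply: EFin_inj.
pose s := q + 2^-1.
have s1 : 1 < s by rewrite /s; lra.
pose f (z : Rb * Rb) : \bar R := ((1 + z.1 ^+ 2 + z.2 ^+ 2) `^ (- s))%:E.
have mf : measurable_fun setT f.
  apply/measurable_EFinP; apply: (measurableT_comp (measurable_powR _)).
  by apply: measurable_funD; [apply: measurable_funD => //|]; apply: (measurable_funX 2).
have f0 z : (0 <= f z)%E by rewrite lee_fin powR_ge0.
transitivity (\int[lam]_x \int[lam]_y f (x, y))%E.
  transitivity (\int[lam]_x (((1 + x ^+ 2) `^ (- q))%:E * (cauchy_const s)%:E))%E.
    rewrite ge0_integralZr//=.
    - by rewrite integral_cauchyE.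
    - by apply/measurable_EFinP; exact: measurable_cauchy1.
    - by move=> x _; rewrite lee_fin powR_ge0.
    - by rewrite lee_fin; apply: Rintegral_ge0 => x _; rewrite powR_ge0.
  apply: eq_integral => x _.
  have := @integral_cauchy s (1 + x ^+ 2) 1 0 (ltW s1) (one_sqr_gt0 x) ltr01.
  under eq_integral do rewrite subr0 mul1r.
  rewrite /f /= => ->; rewrite powR1 mul1r (_ : 2^-1 - s = - q) ?EFinM//.
  by rewrite /s; ring.
rewrite (fubini_tonelli f)//.
pose g (z : Rb * Rb) : \bar R := (`|z.1| * (1 + (1 + z.2 ^+ 2) * z.1 ^+ 2) `^ (- s))%:E.
have mg : measurable_fun setT g.
  apply/measurable_EFinP; apply: measurable_funM.
    by apply: measurableT_comp => //; exact: normr_measurable.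
  apply: (measurableT_comp (measurable_powR _)).
  apply: measurable_funD => //; apply: measurable_funM; last exact: (measurable_funX 2).
  by apply: measurable_funD => //; exact: (measurable_funX 2).
have g0 z : (0 <= g z)%E by rewrite lee_fin mulr_ge0// powR_ge0.
transitivity (\int[lam]_y \int[lam]_t g (y, t))%E.
  apply: ge0_ae_eq_integral => //.
  - exact: (measurable_fun_fubini_tonelli_G f).
  - exact: (measurable_fun_fubini_tonelli_F g).
  - by move=> y _; apply: integral_ge0.
  - by move=> y _; apply: integral_ge0.
  exists [set 0]; split => //; first exact: lebesgue_measure_set1.
  move=> y /=; apply: contra_notP => /eqP y0 _.
  have := @integral_affine R (fun x => f (x, y)) y 0 y0.
  rewrite /f /= => H.
  transitivity (`|y|%:E * \int[lam]_t ((1 + (y * t + 0) ^+ 2 + y ^+ 2) `^ (- s))%:E)%E.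
    rewrite H; last 2 first.
    + apply/measurable_EFinP; apply: (measurableT_comp (measurable_powR _)).
      by apply: measurable_funD => //; apply: measurable_funD => //; exact: (measurable_funX 2).
    + by move=> x; rewrite lee_fin powR_ge0.
    by rewrite muleA -EFinM divff ?mul1e// normr_eq0.
  rewrite -(ge0_integralTZl _ (normr_ge0 y)).
  + apply: eq_integral => t _; rewrite /g /= -EFinM; congr (_ * _ `^ _)%:E.
    by ring.
  + by move=> x; rewrite lee_fin powR_ge0.
  + apply/measurable_EFinP; apply: (measurableT_comp (measurable_powR _)).
    apply: measurable_funD => //; apply: measurable_funD => //; apply: (measurable_funX 2).
    by apply: measurable_funD => //; exact: mulrl_measurable.
rewrite (fubini_tonelli g)//.
transitivity (\int[lam]_t ((s - 1)^-1%:E * ((1 + t ^+ 2) `^ (- 1))%:E))%E.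
  apply: eq_integral => t _; rewrite /g /= integral_radial// -EFinM.
  by rewrite powR_inv1// ltW.
rewrite ge0_integralZl_EFin//.
- rewrite integral_cauchy1 -EFinM /s; congr EFin; field.
  by rewrite gt_eqF//; lra.
- by move=> t _; rewrite lee_fin powR_ge0.
- by apply/measurable_EFinP; exact: measurable_cauchy1.
- by rewrite invr_ge0; lra.
Qed.

End cauchy_integrals.

(** * Radial and ridge integrals on R^m against powers of [A + |x|^2] *)

Section radial_integrals.
Context {R : realType}.
Local Notation Rb := (measurableTypeR R).
Local Notation lam := (@lebesgue_measure R).

Definition tsq m (x : m.-tuple Rb) : R := \sum_(i < m) tnth x i ^+ 2.

Lemma tsq_ge0 m (x : m.-tuple Rb) : 0 <= tsq x.
Proof. by apply: sumr_ge0 => i _; exact: sqr_ge0. Qed.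

Lemma tsq_cons m (x : m.-tuple Rb) a : tsq (tcons (x, a)) = a ^+ 2 + tsq x.
Proof.
rewrite /tsq big_ord_recl tnth0; congr (_ + _).
by apply: eq_bigr => i _; rewrite tnthS.
Qed.

Lemma measurable_tsq m : measurable_fun [set: m.-tuple Rb] (@tsq m).
Proof.
apply: measurable_sum => i; apply: (measurable_funX 2); exact: measurable_tnth.
Qed.

Lemma measurable_tsq_powR m A p : measurable_fun [set: m.-tuple Rb]
  (fun x => (A + tsq x) `^ p).
Proof.
apply: (measurableT_comp (measurable_powR _)); apply: measurable_funD => //.
exact: measurable_tsq.
Qed.

(** The constant produced by integrating [m] coordinates out of [(A + |x|^2)^(-p)]: each integration
    lowers the exponent by [1/2]. The condition [m + 1 <= 2 p] of [integral_tsq_powR] keeps all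
    these arguments at least [1]. *)
Definition cauchy_prod m (p : R) : R := \prod_(i < m) cauchy_const (p - i%:R / 2).

Lemma cauchy_const_ge0 q : 0 <= @cauchy_const R q.
Proof. by apply: Rintegral_ge0 => x _; rewrite powR_ge0. Qed.

Lemma cauchy_prod_ge0 m p : 0 <= cauchy_prod m p.
Proof. by apply: prodr_ge0 => i _; exact: cauchy_const_ge0. Qed.

Lemma integral_tsq_powR m (p A : R) : 0 < A -> m%:R + 1 <= 2 * p ->
  (\int[@lebm R m]_x ((A + tsq x) `^ (- p))%:E =
   (A `^ (m%:R / 2 - p) * cauchy_prod m p)%:E)%E.
Proof.
elim: m A => [|m IH] A A0 mp.
  by rewrite integral_leb0 /tsq big_ord0 /cauchy_prod big_ord0 mul0r sub0r addr0 mulr1.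
rewrite integral_lebS; last 2 first.
- by apply/measurable_EFinP; exact: measurable_tsq_powR.
- by move=> x; rewrite lee_fin powR_ge0.
have Aa (a : R) : 0 < A + a ^+ 2 by rewrite ltr_pwDl// sqr_ge0.
rewrite -natr1 in mp.
have mp1 : m%:R + 1 <= 2 * p by lra.
under eq_integral => a _.
  under eq_integral do rewrite tsq_cons addrA.
  rewrite (IH _ (Aa a) mp1) EFinM.
  over.
rewrite ge0_integralZr//=; last 3 first.
- apply/measurable_EFinP; apply: (measurableT_comp (measurable_powR _)).
  by apply: measurable_funD => //; exact: (measurable_funX 2).
- by move=> x _; rewrite lee_fin powR_ge0.
- by rewrite lee_fin cauchy_prod_ge0.
have q1 : 1 <= p - m%:R / 2 by lra.
have := @integral_cauchy R (p - m%:R / 2) A 1 0 q1 A0 ltr01.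
under eq_integral do rewrite subr0 mul1r opprB.
move=> ->; rewrite powR1 mul1r -EFinM /cauchy_prod big_ord_recr /=; congr EFin.
rewrite -mulrA (mulrC (cauchy_const _)); congr (_ `^ _ * _).
by rewrite -natr1; ring.
Qed.

Definition tdot m (l : 'I_m -> R) (x : m.-tuple Rb) : R := \sum_(i < m) l i * tnth x i.

Lemma tdot_cons m (l : 'I_m.+1 -> R) x a :
  tdot l (tcons (x, a)) = l ord0 * a + tdot (l \o lift ord0) x.
Proof.
rewrite /tdot big_ord_recl tnth0; congr (_ + _).
by apply: eq_bigr => i _; rewrite tnthS.
Qed.

Lemma measurable_tdot m l : measurable_fun [set: m.-tuple Rb] (@tdot m l).
Proof.
apply: measurable_sum => i; apply: measurable_funM => //; exact: measurable_tnth.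
Qed.

Definition lsq m (l : 'I_m -> R) : R := \sum_(i < m) l i ^+ 2.

Lemma lsq_ge0 m (l : 'I_m -> R) : 0 <= lsq l.
Proof. by apply: sumr_ge0 => i _; exact: sqr_ge0. Qed.

Lemma measurable_ridge (H : R -> R) q A c d : measurable_fun setT H ->
  measurable_fun setT (fun s : R => (H s * (A + (s - d) ^+ 2 / c) `^ q)%:E).
Proof.
move=> mH; apply/measurable_EFinP; apply: measurable_funM => //.
apply: (measurableT_comp (measurable_powR _)); apply: measurable_funD => //.
by apply: measurable_funM => //; apply: (measurable_funX 2); exact: measurable_funB.
Qed.

Lemma measurable_ridge0 (H : R -> R) q A c : measurable_fun setT H ->
  measurable_fun setT (fun s : R => (H s * (A + s ^+ 2 / c) `^ q)%:E).
Proof.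
move=> mH; rewrite (_ : (fun _ => _) = fun s : R => (H s * (A + (s - 0) ^+ 2 / c) `^ q)%:E).
  exact: measurable_ridge.
by apply/funext => s; rewrite subr0.
Qed.

Lemma lsqS m (l : 'I_m.+1 -> R) : lsq l = l ord0 ^+ 2 + lsq (l \o lift ord0).
Proof. by rewrite /lsq big_ord_recl. Qed.

Lemma integral_lebS_ridge m (l : 'I_m.+1 -> R) (p A : R) (H : R -> R) :
  measurable_fun setT H -> (forall s, 0 <= H s) ->
  (\int[@lebm R m.+1]_w (H (tdot l w) * (A + tsq w) `^ (- p))%:E =
   \int[lam]_a \int[@lebm R m]_w
     (H (l ord0 * a + tdot (l \o lift ord0) w) * (A + a ^+ 2 + tsq w) `^ (- p))%:E)%E.
Proof.
move=> mH H0; rewrite integral_lebS.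
- by apply: eq_integral => a _; apply: eq_integral => w _; rewrite tdot_cons tsq_cons addrA.
- apply/measurable_EFinP; apply: measurable_funM; last exact: measurable_tsq_powR.
  by apply: (measurableT_comp mH); exact: measurable_tdot.
- by move=> x; rewrite lee_fin mulr_ge0// powR_ge0.
Qed.

(** Here [l] is parallel to the first axis, so the other coordinates integrate out independently of
    [H]. This starts the induction of [integral_ridge] and covers the case where that induction
    would divide by [L' = 0]. *)
Lemma integral_ridge_tail0 m (l : 'I_m.+1 -> R) (p A : R) (H : R -> R) :
  0 < A -> 0 < lsq l -> lsq (l \o lift ord0) = 0 -> m%:R + 1 <= 2 * p ->
  measurable_fun setT H -> (forall s, 0 <= H s) ->
  (\int[@lebm R m.+1]_w (H (tdot l w) * (A + tsq w) `^ (- p))%:E =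
   (cauchy_prod m p * lsq l `^ (- 2^-1))%:E *
     \int[lam]_s (H s * (A + s ^+ 2 / lsq l) `^ (m%:R / 2 - p))%:E)%E.
Proof.
move=> A0 l0 l'0 mp mH H0.
rewrite integral_lebS_ridge//.
have Aa (a : R) : 0 < A + a ^+ 2 by rewrite ltr_pwDl// sqr_ge0.
have d0 w : tdot (l \o lift ord0) w = 0.
  rewrite /tdot big1// => i _; suff -> : (l \o lift ord0) i = 0 by rewrite mul0r.
  apply/eqP; rewrite -sqrf_eq0; move/eqP : l'0.
  by rewrite psumr_eq0 => [/allP/(_ i)|j _]; [rewrite mem_index_enum; apply|exact: sqr_ge0].
have lE : lsq l = l ord0 ^+ 2 by rewrite lsqS l'0 addr0.
have l00 : l ord0 != 0 by rewrite -sqrf_eq0 -lE gt_eqF.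
transitivity (\int[lam]_a ((cauchy_prod m p)%:E *
   (H (l ord0 * a + 0)%R * (A + (l ord0 * a + 0) ^+ 2 / lsq l) `^ (m%:R / 2 - p))%:E))%E.
  apply: eq_integral => a _.
  under eq_integral do rewrite d0 EFinM.
  rewrite ge0_integralZl_EFin//.
  - rewrite integral_tsq_powR// -!EFinM; congr EFin.
    rewrite mulrA mulrC; congr (_ * (_ * (A + _) `^ _)).
    by rewrite addr0 exprMn lE mulrAC divff ?mul1r// -lE gt_eqF.
  - by move=> w _; rewrite lee_fin powR_ge0.
  - by apply/measurable_EFinP; exact: measurable_tsq_powR.
rewrite (ge0_integralTZl _ (cauchy_prod_ge0 m p)).
- rewrite (integral_affine (f := fun s : R => (H s * (A + s ^+ 2 / lsq l) `^ (m%:R / 2 - p))%:E))//.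
  + rewrite muleA -EFinM; congr (_%:E * _)%E.
    by rewrite lE powRN powR12_sqrt ?sqr_ge0// sqrtr_sqr.
  + exact: measurable_ridge0.
  + by move=> s; rewrite lee_fin mulr_ge0// powR_ge0.
- by move=> s; rewrite lee_fin mulr_ge0// powR_ge0.
- apply: (measurableT_comp (f := fun s : R => (H s * (A + s ^+ 2 / lsq l) `^ (m%:R / 2 - p))%:E)).
    exact: measurable_ridge0.
  by apply: measurable_funD => //; exact: mulrl_measurable.
Qed.

(* Completing the square in [a]: [A + a^2 + (s - a l0)^2 / L'] equals
   [(A + s^2 / L) + (L / L') (a - s l0 / L)^2] where [L = l0^2 + L']. *)
Lemma integral_ridge m (l : 'I_m.+1 -> R) (p A : R) (H : R -> R) :
  0 < A -> 0 < lsq l -> m%:R + 1 <= 2 * p ->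
  measurable_fun setT H -> (forall s, 0 <= H s) ->
  (\int[@lebm R m.+1]_w (H (tdot l w) * (A + tsq w) `^ (- p))%:E =
   (cauchy_prod m p * lsq l `^ (- 2^-1))%:E *
     \int[lam]_s (H s * (A + s ^+ 2 / lsq l) `^ (m%:R / 2 - p))%:E)%E.
Proof.
elim: m l A H => [|m IH] l A H A0 l0 mp mH H0.
  apply: integral_ridge_tail0 => //.
  by rewrite /lsq big_ord0.
have [l'0|l'0] := eqVneq (lsq (l \o lift ord0)) 0.
  exact: integral_ridge_tail0.
have {}l'0 : 0 < lsq (l \o lift ord0) by rewrite lt_neqAle eq_sym l'0 lsq_ge0.
rewrite -natr1 in mp.
have mp' : m%:R + 1 <= 2 * p by lra.
set L := lsq l; set L' := lsq (l \o lift ord0); set c := l ord0.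
have LE : L = c ^+ 2 + L' by rewrite /L lsqS.
pose q := p - m%:R / 2.
have q1 : 1 <= q by rewrite /q; lra.
have Aa (a : R) : 0 < A + a ^+ 2 by rewrite ltr_pwDl// sqr_ge0.
rewrite integral_lebS_ridge//.
pose f (z : Rb * Rb) : \bar R := (H z.2 * (A + z.1 ^+ 2 + (z.2 - c * z.1) ^+ 2 / L') `^ (- q))%:E.
have mf : measurable_fun setT f.
  apply/measurable_EFinP; apply: measurable_funM.
    by apply: (measurableT_comp mH).
  apply: (measurableT_comp (measurable_powR _)).
  apply: measurable_funD; first by apply: measurable_funD => //; exact: (measurable_funX 2).
  apply: measurable_funM => //; apply: (measurable_funX 2); apply: measurable_funB => //.
  by apply: measurable_funM.
have f0 z : (0 <= f z)%E by rewrite lee_fin mulr_ge0// powR_ge0.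
transitivity (\int[lam]_a ((cauchy_prod m p * L' `^ (- 2^-1))%:E * \int[lam]_s f (a, s)))%E.
  apply: eq_integral => a _.
  have mHa : measurable_fun setT (fun s => H (c * a + s)).
    by apply: (measurableT_comp mH); exact: measurable_funD.
  rewrite (IH (l \o lift ord0) (A + a ^+ 2) (fun s => H (c * a + s)) (Aa a) l'0 mp' mHa (fun s => H0 _)).
  apply: (f_equal (mule _)).
  (* Translating [s] by [c a] frees the argument of [H] from [a], so that after Tonelli the integral
     in [a] is a pure Cauchy integral. *)
  have := @integral_affine R (fun s => f (a, s)) 1 (c * a) (oner_neq0 _).
  rewrite normr1 invr1 mul1e => <-; last by move=> s; exact: f0.
  - apply: eq_integral => s _; rewrite /f /= mul1r addrK (addrC s); congr (_ * _ `^ _)%:E.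
    by rewrite /q; ring.
  - by apply: measurableT_comp mf _; exact: measurable_fun_pair.
rewrite ge0_integralZl_EFin//; last 3 first.
- by move=> a _; apply: integral_ge0.
- exact: (measurable_fun_fubini_tonelli_F f).
- by rewrite mulr_ge0 ?cauchy_prod_ge0 ?powR_ge0.
rewrite (fubini_tonelli f)//.
have AL (s : R) : 0 < A + s ^+ 2 / L by rewrite ltr_pwDl// mulr_ge0 ?sqr_ge0// invr_ge0 ltW.
transitivity ((cauchy_prod m p * L' `^ (- 2^-1))%:E * \int[lam]_s
   (((L / L') `^ (- 2^-1) * cauchy_const q)%:E *
   (H s * (A + s ^+ 2 / L) `^ (m.+1%:R / 2 - p))%:E))%E.
  congr (_ * _)%E; apply: eq_integral => s _.
  have := @integral_cauchy R q (A + s ^+ 2 / L) (L / L') (s * c / L) q1 (AL s) (divr_gt0 l0 l'0).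
  rewrite /f /= => E.
  transitivity ((H s)%:E * \int[lam]_a ((A + s ^+ 2 / L + L / L' * (a - s * c / L) ^+ 2) `^ (- q))%:E)%E.
    rewrite -(ge0_integralTZl _ (H0 s)).
    - apply: eq_integral => a _; rewrite -EFinM; congr (_ * _ `^ _)%:E.
      rewrite LE; field; rewrite -LE !gt_eqF//.
    - by move=> a; rewrite lee_fin powR_ge0.
    - by apply/measurable_EFinP; exact: measurable_cauchy.
  rewrite E -!EFinM; congr EFin.
  rewrite (_ : 2^-1 - q = m.+1%:R / 2 - p); last by rewrite /q -natr1; ring.
  ring.
rewrite ge0_integralZl_EFin//.
- rewrite muleA -EFinM; congr (_%:E * _)%E.
  rewrite /cauchy_prod big_ord_recr /= -/q powRM ?invr_ge0 ?ltW//.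
  have E1 : L' `^ (- 2^-1) * (L'^-1) `^ (- 2^-1) = 1.
    by rewrite -powRM ?invr_ge0 ?ltW// divff ?gt_eqF// powR1.
  by rewrite -[RHS]mulr1 -[X in _ = _ * X]E1; ring.
- by move=> s _; rewrite lee_fin mulr_ge0// powR_ge0.
- exact: measurable_ridge0.
- by rewrite mulr_ge0 ?cauchy_const_ge0 ?powR_ge0.
Qed.

End radial_integrals.

(** * Integrability of powers of the norm on R^m *)

Section weights.
Context {R : realType}.
Local Notation Rb := (measurableTypeR R).
Local Notation lam := (@lebesgue_measure R).

(* As [wt c] decreases, [wt c (|x|^2) ^ m] is at most the product over the
   coordinates of the [wt c (x_i^2)], which reduces the integrability of powers
   of [|x|] on [R^m] to one variable. *)
Definition wt (c q : R) : R := Num.min (q `^ ((c - 1) / 2)) (q `^ (- (c + 1) / 2)).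

Lemma wt_ge0 c q : 0 <= wt c q.
Proof. by rewrite le_min !powR_ge0. Qed.

Lemma powR_antitone (a p q : R) : 0 < p -> p <= q -> a <= 0 -> q `^ a <= p `^ a.
Proof.
move=> p0 pq a0; rewrite -(opprK a) !(powRN _ (- a)) lef_pV2 ?posrE ?powR_gt0//.
  apply: ge0_ler_powR => //; rewrite ?oppr_ge0 ?nnegrE//; first exact: ltW.
  exact: ltW (lt_le_trans p0 pq).
exact: lt_le_trans pq.
Qed.

Lemma wt_antitone c p q : 0 < c -> c < 1 -> 0 < p -> p <= q -> wt c q <= wt c p.
Proof.
move=> c0 c1 p0 pq; rewrite /wt le_min !ge_min.
by rewrite !(powR_antitone p0 pq) ?orbT//; lra.
Qed.

Lemma measurable_wt c : measurable_fun setT (wt c).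
Proof. by apply: measurable_minr; exact: measurable_powR. Qed.

(** With [q = |x|^2] on R^k, [wt c q ^+ k] is [|x|^(-k(1-c))] near the origin and [|x|^(-k(1+c))] at
    infinity: on either side of the threshold [|x|^(-k)], with a slack governed by [c]. Any power
    strictly on the integrable side is thus dominated for small [c]. *)
Lemma wt_ge_small (c q r : R) k : 0 < c -> 0 < q <= 1 ->
  r <= k%:R * (1 - c) / 2 -> q `^ (- r) <= wt c q ^+ k.
Proof.
move=> c0 q01 rk; have /andP[q0 q1] := q01.
have -> : wt c q = q `^ ((c - 1) / 2) by rewrite /wt min_l// ger_powR//; lra.
rewrite -powR_mulrn ?powR_ge0// -powRrM ger_powR//; lra.
Qed.

Lemma wt_ge_large (c q r : R) k : 0 < c -> 1 <= q ->
  k%:R * (1 + c) / 2 <= r -> q `^ (- r) <= wt c q ^+ k.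
Proof.
move=> c0 q1 rk.
have -> : wt c q = q `^ (- (c + 1) / 2) by rewrite /wt min_r// ler_powR//; lra.
rewrite -powR_mulrn ?powR_ge0// -powRrM ler_powR//; lra.
Qed.

(* Has the primitive [- c^-1 (1 + r^c)^-1] on [r > 0]. *)
Definition rwt (c r : R) : R := `|r| `^ (c - 1) * (1 + `|r| `^ c) `^ (- 2).

Lemma rwt_ge0 c r : 0 <= rwt c r. Proof. by rewrite mulr_ge0 ?powR_ge0. Qed.

Lemma measurable_rwt c : measurable_fun setT (rwt c).
Proof.
apply: measurable_funM.
  by apply: (measurableT_comp (measurable_powR _)); exact: normr_measurable.
apply: (measurableT_comp (measurable_powR _)); apply: measurable_funD => //.
by apply: (measurableT_comp (measurable_powR _)); exact: normr_measurable.
Qed.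

(** [1 + |r|^c] is at most [2] if [|r| <= 1] and at most [2 |r|^c] otherwise; squaring gives the
    [4]. *)
Lemma wt_le_rwt c r : 0 < c -> c < 1 -> r != 0 -> wt c (r ^+ 2) <= 4 * rwt c r.
Proof.
move=> c0 c1 r0; have n0 : 0 < `|r| by rewrite normr_gt0.
have E a : (r ^+ 2) `^ (a / 2) = `|r| `^ a.
  by rewrite -(real_normK (num_real r)) -powR_mulrn// -powRrM mulrCA divff ?mulr1.
rewrite /wt !E /rwt.
have pc := powR_gt0 c n0.
have p1c : 1 `^ c = 1 :> R by rewrite powR1.
have p1 : 0 < 1 + `|r| `^ c by lra.
have [h|h] := leP `|r| 1; rewrite ge_min; apply/orP; [left|right].
  rewrite mulrCA -[leLHS]mulr1 ler_wpM2l ?powR_ge0// powRN powR_mulrn ?(ltW p1)//.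
  rewrite ler_pdivlMr ?exprn_gt0// mul1r.
  have : `|r| `^ c <= 1.
    rewrite -p1c; apply: ge0_ler_powR => //; rewrite ?nnegrE//; exact: ltW.
  nra.
rewrite (_ : - (c + 1) = (c - 1) + - (2 * c)); last by ring.
rewrite (@powRD _ _ (c - 1) (- (2 * c))) ?(gt_eqF n0) ?implybT// mulrCA ler_pM2l ?powR_gt0//.
have -> : `|r| `^ (- (2 * c)) = (`|r| `^ c ^+ 2)^-1.
  by rewrite powRN mulrC powRrM powR_mulrn ?powR_ge0.
rewrite powRN powR_mulrn ?(ltW p1)//.
rewrite ler_pdivlMr ?exprn_gt0// mulrC ler_pdivrMr ?exprn_gt0//.
have : 1 <= `|r| `^ c.
  rewrite -p1c; apply: ge0_ler_powR => //; rewrite ?nnegrE//; exact: ltW.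
nra.
Qed.

(** The integrand blows up at [0] because [c < 1], hence the cut at [e]. The bound does not depend
    on [e], so monotone convergence applies afterwards. *)
Lemma integral_rwt_halfline c (e : R) : 0 < c -> c < 1 -> 0 < e ->
  (\int[lam]_(r in `[e, +oo[) (rwt c r)%:E <= (c^-1)%:E)%E.
Proof.
move=> c0 c1 e0.
pose F r := - c^-1 * (1 + r `^ c) `^ (- 1).
have p1 (r : R) : 0 < 1 + r `^ c by rewrite ltr_pwDl// powR_ge0.
have dF (r : R) : 0 < r -> is_derive r (1:R) F (r `^ (c - 1) * (1 + r `^ c) `^ (- 2)).
  move=> r0.
  have H1 : is_derive (1 + r `^ c) (1:R) (fun x : R => x `^ (- 1))
     (- 1 * (1 + r `^ c) `^ (- 1 - 1)) by exact: is_derive1_powR.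
  have H0 : is_derive r (1:R) (fun x : R => x `^ c) (c * r `^ (c - 1)) by exact: is_derive1_powR.
  have H2 : is_derive r (1:R) (fun x : R => 1 + x `^ c) (c * r `^ (c - 1)).
    by have := is_deriveD (is_derive_cst (1 : R) r (1 : R)) H0; rewrite add0r.
  have H3 := @is_derive1_comp R (fun x : R => x `^ (- 1)) (fun x : R => 1 + x `^ c) r _ _ H1 H2.
  have H4 : is_derive r (1:R) F _ := is_deriveZ (- c^-1) H3.
  apply: (is_derive_eq H4); rewrite /GRing.scale /=.
  rewrite (_ : - 1 - 1 = - 2 :> R); last by ring.
  by field; rewrite gt_eqF.
rewrite (_ : \int[_]_(r in _) _ = \int[lam]_(r in `[e, +oo[) (r `^ (c - 1) * (1 + r `^ c) `^ (- 2))%:E)%E; last first.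
  apply: eq_integral => r; rewrite inE /= in_itv /= andbT => er.
  by rewrite /rwt ger0_norm// (le_trans (ltW e0)).
rewrite (@ge0_continuous_FTC2y _ _ F e 0).
- rewrite sub0e -EFinN lee_fin /F mulNr opprK.
  rewrite ler_piMr ?invr_ge0 ?(ltW c0)// powR_inv1 ?(ltW (p1 e))// invf_le1//.
  by rewrite lerDl powR_ge0.
- by move=> x ex; rewrite mulr_ge0 ?powR_ge0.
- apply: continuous_in_subspaceT => r; rewrite inE /= in_itv /= andbT => er.
  have r0 := lt_le_trans e0 er.
  apply: cvgM; first exact: powR_continuous_at.
  apply: (@continuous_comp _ _ _ (fun r => 1 + r `^ c) (fun x => x `^ (- 2))).
    by apply: cvgD; [exact: cvg_cst|exact: powR_continuous_at].
  exact: powR_continuous_at.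
- rewrite -(mulr0 (- c^-1)); apply: cvgM; first exact: cvg_cst.
  apply: (@cvg_comp _ _ _ (fun r : R => 1 + r `^ c) (fun x : R => x `^ (- 1)) _ (+oo : set_system R)); last first.
    exact: powR_cvg0y.
  apply/cvgryPge => M; near=> r.
  have r0 : 0 < r by near: r; apply: nbhs_pinfty_gt; exact: num_real.
  have : `|M| `^ c^-1 <= r by near: r; apply: nbhs_pinfty_ge; exact: num_real.
  move=> h; rewrite (@le_trans _ _ `|M|) ?ler_norm//.
  have := @ge0_ler_powR R c (ltW c0) _ _ _ _ h; rewrite !nnegrE => /(_ (powR_ge0 _ _) (ltW r0)).
  rewrite -powRrM mulVf ?gt_eqF// powRr1// => /le_trans; apply.
  by rewrite lerDr.
- by move=> r er; have [] := dF r (lt_trans e0 er).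
- apply: cvg_at_right_filter.
  by apply: differentiable_continuous; apply/derivable1_diffP; have [] := dF e e0.
- by move=> r; rewrite in_itv /= andbT => er; rewrite derive1E; have [_ ->] := dF r (lt_trans e0 er).
Unshelve. all: end_near. Qed.

Lemma integral_rwt_lty c : 0 < c -> c < 1 -> (\int[lam]_r (rwt c r)%:E < +oo)%E.
Proof.
move=> c0 c1.
have mr D : measurable_fun D (EFin \o rwt c).
  by apply: measurable_funTS; apply/measurable_EFinP; exact: measurable_rwt.
have r0 x : (0 <= (rwt c x)%:E)%E by rewrite lee_fin rwt_ge0.
have H : (\int[lam]_(r in `]0%R, +oo[) (rwt c r)%:E <= (c^-1)%:E)%E.
  pose A (k : nat) : set Rb := `[k.+1%:R^-1, +oo[%classic.
  have AE : \bigcup_k A k = `]0%R, +oo[%classic.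
    apply/seteqP; split => [x [k _]|x]; rewrite /A /= !in_itv /= !andbT.
      by move=> h; rewrite (lt_le_trans _ h)// invr_gt0.
    move=> x0; exists (Num.truncn x^-1) => //=; rewrite in_itv /= andbT.
    by rewrite -[leRHS]invrK lef_pV2 ?posrE ?invr_gt0// ltW// truncnS_gt.
  rewrite -AE.
  have := @ge0_nondecreasing_set_cvg_integral _ Rb R A (EFin \o rwt c) lam.
  have ndA : nondecreasing_seq A.
    move=> i j ij; apply/subsetPset => x; rewrite /A /= !in_itv /= !andbT.
    by apply: le_trans; rewrite lef_pV2 ?posrE// ler_nat ltnS.
  have mA i : measurable (A i) by exact: measurable_itv.
  move=> /(_ ndA mA (fun i => mr _) (fun i x _ => r0 x)).
  move=> /cvg_lim <-//; apply: lime_le => //.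
    apply: ereal_nondecreasing_is_cvgn; apply: ge0_nondecreasing_set_nondecreasing_integral => //.
  - by move=> i; exact: mr.
  - by move=> i x _; exact: r0.
  by apply: nearW => k; apply: integral_rwt_halfline.
have H0 : (\int[lam]_(r in `[0%R, +oo[) (rwt c r)%:E <= (c^-1)%:E)%E.
  by rewrite -integral_itv_obnd_cbnd//; exact: mr.
have HN : (\int[lam]_(r in `]-oo, 0%R]) (rwt c r)%:E <= (c^-1)%:E)%E.
  rewrite (_ : \int[_]_(r in _) _ = \int[lam]_(r in `[0%R, +oo[) (rwt c r)%:E)%E//.
  transitivity (\int[lam]_(r in `]-oo, 0%R]) (rwt c (- r)%R)%:E)%E; last first.
    exact/esym/(@ge0_integration_by_substitution0 R (EFin \o rwt c) (mr _) r0).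
  by apply: eq_integral => x _; rewrite /= /rwt normrN.
rewrite (_ : setT = `]-oo, 0%R] `|` `]0%R, +oo[); last first.
  by rewrite -setCitvl setUv.
rewrite ge0_integral_setU//=.
- apply: (@le_lt_trans _ _ ((c^-1)%:E + (c^-1)%:E)%E); first exact: leeD.
  by rewrite -EFinD ltry.
- exact: mr.
- by rewrite -setCitvl; exact/disj_setPCl.
Qed.

(* The value [+oo] at [0] makes the product bound [wt_le_tprod] hold at every
   point, including those with a vanishing coordinate. *)
Definition ewt (c r : R) : \bar R := if r == 0 then +oo%E else (wt c (r ^+ 2))%:E.

Lemma ewt_ge0 c r : (0 <= ewt c r)%E.
Proof. by rewrite /ewt; case: ifP => // _; rewrite lee_fin wt_ge0. Qed.

Lemma measurable_ewt c : measurable_fun setT (ewt c).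
Proof.
apply: measurable_fun_ifT => //.
  by apply: measurable_fun_eqr.
apply/measurable_EFinP; apply: (measurableT_comp (measurable_wt _)).
exact: (measurable_funX 2).
Qed.

Lemma integral_ewt_lty c : 0 < c -> c < 1 -> (\int[lam]_r ewt c r < +oo)%E.
Proof.
move=> c0 c1.
apply: (@le_lt_trans _ _ (\int[lam]_r (4 * rwt c r)%:E)%E); last first.
  under eq_integral do rewrite EFinM.
  rewrite ge0_integralZl_EFin//.
  - by rewrite lte_mul_pinfty//; exact: integral_rwt_lty.
  - by move=> x _; rewrite lee_fin rwt_ge0.
  - by apply/measurable_EFinP; exact: measurable_rwt.
apply: ae_ge0_le_integral => //.
- by move=> x _; exact: ewt_ge0.
- exact: measurable_ewt.
- by move=> x _; rewrite lee_fin mulr_ge0 ?rwt_ge0.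
- by apply/measurable_EFinP; apply: measurable_funM => //; exact: measurable_rwt.
exists [set 0]; split => //; first exact: lebesgue_measure_set1.
move=> r /=; apply: contra_notP => /eqP r0 _.
by rewrite /ewt (negbTE r0) lee_fin wt_le_rwt.
Qed.

Lemma wt_le_tprod m c q (x : m.-tuple Rb) : 0 < c -> c < 1 -> 0 < q ->
  (forall i, tnth x i ^+ 2 <= q) -> ((wt c q ^+ m)%:E <= tprod (ewt c) x)%E.
Proof.
move=> c0 c1 q0; elim: m x => [|m IH] x xq; first by rewrite /= expr0.
rewrite exprS EFinM /=; apply: lee_pmul.
- by rewrite lee_fin wt_ge0.
- by rewrite lee_fin exprn_ge0// wt_ge0.
- rewrite /ewt; case: ifPn => [_|h]; first exact: leey.
  rewrite lee_fin wt_antitone//.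
  by rewrite lt_neqAle sqr_ge0 eq_sym sqrf_eq0 h.
- apply: IH => i; have := xq (lift ord0 i).
  by rewrite (tuple_eta x) tnthS; congr (tnth _ i ^+ 2 <= q); apply/val_inj.
Qed.

Lemma integral_wt_lty m c : 0 < c -> c < 1 ->
  (\int[@lebm R m]_x (wt c (tsq x) ^+ m)%:E < +oo)%E.
Proof.
move=> c0 c1.
apply: (@le_lt_trans _ _ (\int[@lebm R m]_x tprod (ewt c) x)%E); last first.
  apply: integral_tprod_lty; first exact: ewt_ge0.
    exact: measurable_ewt.
  exact: integral_ewt_lty.
apply: ge0_le_integral => //.
- by move=> x _; rewrite lee_fin exprn_ge0// wt_ge0.
- apply/measurable_EFinP; apply: measurable_funX.
  by apply: (measurableT_comp (measurable_wt _)); exact: measurable_tsq.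
- apply: measurable_tprod; first exact: ewt_ge0.
  exact: measurable_ewt.
move=> x _; have [x0|x0] := eqVneq (tsq x) 0.
  case: m x x0 => [|m] x x0; first by rewrite expr0.
  (* [powR] sends base [0] to [0] for every nonzero exponent, negative ones included, so
     [wt c 0 = 0]. *)
  rewrite x0 /wt !powR0 ?minxx ?expr0n/=; last 2 first.
  - lra.
  - lra.
  by apply: (@tprod_ge0 R m.+1) => r; exact: ewt_ge0.
apply: wt_le_tprod => //; first by rewrite lt_neqAle eq_sym x0 tsq_ge0.
by move=> i; rewrite /tsq (bigD1 i)//= lerDl sumr_ge0// => j _; exact: sqr_ge0.
Qed.

End weights.

(** * Row vectors and tuples *)

Section coordinates.
Context {R : realType}.
Local Notation Rb := (measurableTypeR R).

(** An open set of row vectors is a countable union of cubes with rational centres, enumerated by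
    [unpickle], and the preimage of a cube is a finite intersection of measurable sets.
    Coordinatewise measurability of [h] therefore suffices. *)
Lemma measurable_continuous_coord d (T : measurableType d) k
    (h : T -> 'rV[R]_k) (G : 'rV[R]_k -> R) :
  (forall j, measurable_fun [set: T] (fun x => h x 0 j)) ->
  continuous G -> measurable_fun [set: T] (G \o h).
Proof.
move=> mh cG.
suff H (U : set 'rV[R]_k) : open U -> measurable (h @^-1` U).
  apply: (measurability _ (RGenOpens.measurableE R)).
  move=> _ [_ [a [b ->] <-]]; rewrite setTI comp_preimage; apply: H.
  by move/continuousP : cG; apply; exact: interval_open.
move=> oU.
pose cube (q : 'rV[rat]_k) (i : nat) : set 'rV[R]_k :=
  [set y | forall j, `|ratr (q 0 j) - y 0 j| < i.+1%:R^-1].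
pose F n : set T := match @unpickle ('rV[rat]_k * nat)%type n with
  | Some qi => if `[< cube qi.1 qi.2 `<=` U >] then h @^-1` cube qi.1 qi.2 else set0
  | None => set0 end.
have -> : h @^-1` U = \bigcup_n F n.
  apply/seteqP; split=> [x /= Ux|x [n _]]; last first.
    rewrite /F; case: unpickle => // -[q i] /=.
    by case: asboolP => // cU cx; exact: cU.
  have /nbhs_ballP[e /= e0 eU] : nbhs (h x) U by exact: open_nbhs_nbhs.
  pose i := Num.truncn (2 / e).
  have i0 : 0 < (i.+1%:R^-1 : R) by rewrite invr_gt0.
  (* A cube containing [h x] is not centred there, so its points are within twice its radius of
     [h x]. *)
  have ie : 2 * i.+1%:R^-1 < e.
    by rewrite ltr_pdivrMr// mulrC -ltr_pdivrMr// truncnS_gt.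
  have /choice[q qP] : forall j, exists q : rat, `|ratr q - h x 0 j| < i.+1%:R^-1.
    move=> j; have /rat_in_itvoo[q] : h x 0 j - i.+1%:R^-1 < h x 0 j + i.+1%:R^-1.
      by rewrite ltrD2l gtrN.
    rewrite in_itv /= => /andP[q1 q2]; exists q.
    by rewrite ltr_distl q1 q2.
  exists (pickle (\row_j q j, i)) => //; rewrite /F pickleK /=.
  have cx : cube (\row_j q j) i (h x) by move=> j; rewrite mxE.
  case: asboolP => //; case=> y cy; apply: eU; split => // a j; rewrite !ord1 /ball /=.
  apply: le_lt_trans ie; rewrite mulr_natl mulr2n.
  rewrite -(subrK (ratr (q j)) (h x 0 j)) -addrA (le_trans (ler_normD _ _))// lerD//.
    by rewrite distrC ltW.
  by have := cy j; rewrite mxE => /ltW.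
apply: bigcupT_measurable => n; rewrite /F; case: unpickle => // -[q i] /=.
case: asboolP => // _.
rewrite (_ : _ @^-1` _ = \bigcap_(j in [set: 'I_k])
   (fun x => `|ratr (q 0 j) - h x 0 j|) @^-1` `]-oo, (i.+1%:R^-1 : R)[%classic).
  apply: fin_bigcap_measurable => // j _; rewrite -[X in measurable X]setTI.
  apply: (measurableT_comp (@normr_measurable R setT)) => //.
  exact: measurable_funB.
apply/seteqP; split=> x H j; first by move=> _; rewrite /= in_itv; exact: H.
by have := H j I; rewrite /= in_itv.
Qed.

(* [tcons] puts the new coordinate first, [heis_of] reads [tau] last. *)
Definition sg m (j : 'I_(m + 1)) : 'I_m.+1 :=
  match fintype.split j with inl i => lift ord0 i | inr _ => ord0 end.

Definition vec m (x : m.+1.-tuple Rb) : 'rV[R]_(m + 1) := \row_j tnth x (sg j).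

Definition unvec m (v : 'rV[R]_(m + 1)) : m.+1.-tuple Rb :=
  [tuple (match unlift ord0 i with
          | Some j => v 0 (lshift 1 j) | None => v 0 (rshift m ord0) end) | i < m.+1].

Lemma unvecK m : cancel (@unvec m) (@vec m).
Proof.
move=> v; apply/rowP => j; rewrite mxE tnth_mktuple /sg.
case: (fintype.split_ordP j) => i ->; first by rewrite liftK.
by rewrite unlift_none (ord1 i).
Qed.

Lemma vec_lshift m (x : m.+1.-tuple Rb) i : vec x 0 (lshift 1 i) = tnth x (lift ord0 i).
Proof. by rewrite mxE /sg; case: split_ordP => [j /lshift_inj ->|j /eqP]; rewrite ?eq_lrshift. Qed.

Lemma vec_rshift m (x : m.+1.-tuple Rb) i : vec x 0 (rshift m i) = tnth x ord0.
Proof. by rewrite mxE /sg; case: split_ordP => [j /eqP|//]; rewrite eq_rlshift. Qed.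

Lemma measurable_vec m j : measurable_fun [set: m.+1.-tuple Rb] (fun x => vec x 0 j).
Proof.
rewrite (_ : (fun _ => _) = fun x : m.+1.-tuple Rb => tnth x (sg j)).
  exact: measurable_tnth.
by apply/funext => x; rewrite mxE.
Qed.

Lemma measurable_continuous_vec m (G : 'rV[R]_(m + 1) -> R) : continuous G ->
  measurable_fun [set: m.+1.-tuple Rb] (fun x => G (vec x)).
Proof. by move=> cG; apply: measurable_continuous_coord => // j; exact: measurable_vec. Qed.

Definition qn d (x : 'rV[R]_d) : R := \sum_j x 0 j ^+ 2.

Lemma qn_ge0 d (x : 'rV[R]_d) : 0 <= qn x.
Proof. by apply: sumr_ge0 => j _; exact: sqr_ge0. Qed.

Lemma qn_vec m (x : m.+1.-tuple Rb) : qn (vec x) = tsq x.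
Proof.
rewrite /qn big_split_ord /= big_ord1 vec_rshift /tsq big_ord_recl addrC.
by congr (_ + _); apply: eq_bigr => i _; rewrite vec_lshift.
Qed.

Lemma sqr_le_qn d (x : 'rV[R]_d) j : x 0 j ^+ 2 <= qn x.
Proof. by rewrite /qn (bigD1 j)//= lerDl sumr_ge0// => i _; exact: sqr_ge0. Qed.

Lemma qn_continuous d : continuous (@qn d).
Proof.
apply: continuous_big => [|j _ x]; first exact: add_continuous.
apply: (@continuous_comp _ _ _ (fun x : 'rV[R]_d => x 0 j) (fun y => y ^+ 2)).
  exact: coord_continuous.
exact: exprn_continuous.
Qed.

Lemma qnN d (x : 'rV[R]_d) : qn (- x) = qn x.
Proof. by apply: eq_bigr => j _; rewrite mxE sqrrN. Qed.

Lemma qnD_le d (x y : 'rV[R]_d) : qn (x + y) <= 2 * qn x + 2 * qn y.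
Proof.
rewrite /qn !mulr_sumr -big_split /=; apply: ler_sum => j _; rewrite mxE.
have := sqr_ge0 (x 0 j - y 0 j); rewrite -subr_ge0; nra.
Qed.

Lemma reflect_vec m (a : 'rV[R]_(m + 1)) (x : m.+1.-tuple Rb) :
  a - vec x = vec [tuple tnth (unvec a) i - tnth x i | i < m.+1].
Proof.
apply/rowP => j; rewrite !mxE tnth_mktuple; congr (_ - _).
by rewrite -{1}(unvecK a) mxE.
Qed.

Lemma measurable_reflect m (a : 'I_m -> R) : measurable_fun [set: m.-tuple Rb]
  (fun x : m.-tuple Rb => [tuple a i - tnth x i | i < m] : m.-tuple Rb).
Proof.
apply/measurable_fun_tnthP => i /=.
rewrite (_ : _ \o _ = (fun x => a i - tnth x i)).
  apply: measurable_funB => //; exact: measurable_tnth.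
by apply/funext => x /=; rewrite tnth_mktuple.
Qed.

Lemma measurable_vec_reflect m d (T : measurableType d) (G : 'rV[R]_(m + 1) -> T) a :
  measurable_fun [set: m.+1.-tuple Rb] (fun x => G (vec x)) ->
  measurable_fun [set: m.+1.-tuple Rb] (fun x => G (a - vec x)).
Proof.
move=> mG; rewrite (_ : (fun _ => _) = (fun x => G (vec x)) \o
   (fun x : m.+1.-tuple Rb => [tuple tnth (unvec a) i - tnth x i | i < m.+1])).
  apply: measurableT_comp => //; exact: measurable_reflect.
by apply/funext => x; rewrite reflect_vec.
Qed.

Local Open Scope ereal_scope.

Lemma ge0_integral_vec_reflect m (G : 'rV[R]_(m + 1) -> \bar R) a :
  measurable_fun [set: m.+1.-tuple Rb] (fun x => G (vec x)) -> (forall v, 0 <= G v) ->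
  \int[@lebm R m.+1]_x G (a - vec x)%R = \int[@lebm R m.+1]_x G (vec x).
Proof.
move=> mG G0.
rewrite -(@integral_leb_reflect R m.+1 (fun x => G (vec x)) (tnth (unvec a)))//.
by apply: eq_integral => x _; rewrite reflect_vec.
Qed.

Lemma integral_vec_reflect m (G : 'rV[R]_(m + 1) -> \bar R) a :
  measurable_fun [set: m.+1.-tuple Rb] (fun x => G (vec x)) ->
  \int[@lebm R m.+1]_x G (a - vec x)%R = \int[@lebm R m.+1]_x G (vec x).
Proof.
move=> mG; rewrite integralE [RHS]integralE; congr (_ - _).
  under eq_integral do rewrite funeposE.
  under [RHS]eq_integral do rewrite funeposE.
  apply: (ge0_integral_vec_reflect (G := fun v => maxe (G v) 0)).
    by apply: measurable_maxe.
  by move=> v; rewrite le_max lexx orbT.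
under eq_integral do rewrite funenegE.
under [RHS]eq_integral do rewrite funenegE.
apply: (ge0_integral_vec_reflect (G := fun v => maxe (- G v) 0)).
  by apply: measurable_maxe => //; exact: measurableT_comp.
by move=> v; rewrite le_max lexx orbT.
Qed.

Lemma integrable_vec_reflect m (G : 'rV[R]_(m + 1) -> \bar R) a :
  (@lebm R m.+1).-integrable setT (fun x => G (vec x)) ->
  (@lebm R m.+1).-integrable setT (fun x => G (a - vec x)%R).
Proof.
move=> /integrableP[mG iG]; apply/integrableP; split.
  exact: measurable_vec_reflect.
rewrite (ge0_integral_vec_reflect (G := fun v => `|G v|))//.
exact: measurableT_comp.
Qed.

Lemma negligible_coord m (c : R) :
  (@lebm R m.+1).-negligible [set x | tnth x ord0 = c].
Proof.
pose A : set (m.+1.-tuple Rb) := [set x | tnth x ord0 = c].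
have mA : measurable A.
  rewrite -[A]setTI; apply: (@measurable_tnth _ Rb m.+1 ord0 measurableT [set c]).
  exact: measurable_set1.
exists A; split => //.
rewrite -[A]setIT -integral_indic// integral_lebS//; last first.
  by apply/measurable_EFinP; exact: measurable_indic.
transitivity (\int[@lebesgue_measure R]_a (cst 0 a : \bar R)); last by rewrite integral_cst// mul0e.
apply: ge0_ae_eq_integral => //.
- apply: (@measurable_integral_lebS R m (fun x => (\1_A x)%:E)).
    by apply/measurable_EFinP; exact: measurable_indic.
  by move=> x; rewrite lee_fin.
- by move=> a _; apply: integral_ge0 => x _; rewrite lee_fin.
exists [set c]; split => //; first exact: lebesgue_measure_set1.
move=> a /=; apply: contra_notP => /eqP a0 _.
apply: integral0_eq => x _; rewrite indicE memNset//= /A /= tnth0; exact/eqP.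
Qed.

Lemma negligible_tsq0 m : (@lebm R m.+1).-negligible [set x | tsq x = 0%R].
Proof.
apply: negligibleS (@negligible_coord m 0%R) => x /= /eqP.
rewrite /tsq psumr_eq0; last by move=> i _; exact: sqr_ge0.
by move=> /allP/(_ ord0); rewrite mem_index_enum /= sqrf_eq0 => /(_ isT)/eqP.
Qed.
End coordinates.

(** * Derivatives of limits of integrals *)

Section derivative_limits.
Context {R : realType}.

Lemma mean_value_at0 (h S : R -> R) (u : R) : u != 0 -> `|u| < 1 ->
  (forall t, `|t| < 1 -> is_derive t (1 : R) h (S t)) ->
  exists2 c, `|c| <= `|u| & h u - h 0 = S c * u.
Proof.
move=> u0 u1 dh.
have cont (a b : R) : -1 < a -> b < 1 -> {within `[a, b], continuous h}.
  move=> a1 b1; apply: derivable_within_continuous => t; rewrite in_itv /= => /andP[ta tb].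
  have /dh [] // : `|t| < 1 by rewrite ltr_norml (lt_le_trans a1 ta) (le_lt_trans tb b1).
move: u1; rewrite ltr_norml => /andP[uN1 u1].
have [u_gt0|u_le0] := ltP 0 u.
  have [|//|c] := @MVT R h S 0 u u_gt0.
    move=> t; rewrite in_itv /= => /andP[t0 tu]; apply: dh.
    by rewrite ger0_norm ?ltW//; exact: lt_trans tu u1.
    by apply: cont => //; rewrite ltrN10.
  rewrite in_itv /= => /andP[c0 cu]; rewrite subr0 => E; exists c => //.
  by rewrite !ger0_norm ?ltW.
have u_lt0 : u < 0 by rewrite lt_neqAle u0.
have [|//|c] := @MVT R h S u 0 u_lt0.
  move=> t; rewrite in_itv /= => /andP[tu t0]; apply: dh.
  by rewrite ltr_norml (lt_trans uN1 tu) (lt_trans t0 ltr01).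
  by apply: cont.
rewrite in_itv /= => /andP[cu c0]; rewrite sub0r => E; exists c.
  by rewrite (ler0_norm (ltW c0)) (ler0_norm (ltW u_lt0)) lerN2 ltW.
by rewrite -opprB E mulrN opprK.
Qed.

(** By the mean value theorem the difference quotient of [h N] at [u] is some [S N c] with
    [|c| <= |u|]. For small [u] it lies within [eta + e N] of [S0 0], and [N] is sent to infinity
    with [u] fixed. *)
Lemma is_derive_limit (h S : nat -> R -> R) (h0 S0 : R -> R) (e : nat -> R) :
  (forall N t, `|t| < 1 -> is_derive t (1 : R) (h N) (S N t)) ->
  (forall t, `|t| < 1 -> h N t @[N --> \oo] --> h0 t) ->
  (forall N t, `|t| < 1 -> `|S N t - S0 t| <= e N) ->
  e N @[N --> \oo] --> (0 : R) ->
  {for 0, continuous S0} ->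
  is_derive (0 : R) (1 : R) h0 (S0 0).
Proof.
move=> dh hh0 SS0 e0 cS.
suff H : (fun u : R => u^-1 *: ((h0 \o shift 0) (u *: (1 : R)) - h0 0)) @ 0^' --> S0 0.
  by apply: DeriveDef; [apply/cvg_ex; exists (S0 0)|exact: cvg_lim].
apply/cvgrPdist_le => eta eta0.
have /cvgrPdist_le/(_ _ eta0)[r /= r0 rP] := cS.
near=> u.
have u0 : u != 0 by near: u; exact: nbhs_dnbhs_neq.
have u1 : `|u| < 1.
  by near: u; apply: dnbhs0_lt.
have ur : `|u| < r by near: u; apply: dnbhs0_lt.
rewrite /shift /= addr0 [u *: 1]mulr1.
have L : `|S0 0 - u^-1 * (h N u - h N 0)| @[N --> \oo] --> `|S0 0 - u^-1 * (h0 u - h0 0)|.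
  apply: cvg_norm; apply: cvgB; first exact: cvg_cst.
  apply: cvgM; first exact: cvg_cst.
  by apply: cvgB; apply: hh0 => //; rewrite normr0.
have L2 : eta + e N @[N --> \oo] --> eta.
  by rewrite -[X in _ --> X]addr0; apply: cvgD => //; exact: cvg_cst.
apply: (ler_cvg_to L L2); apply: nearW => N /=.
have [c cu ->] := mean_value_at0 u0 u1 (dh N).
rewrite mulrCA mulVf// mulr1.
have c1 : `|c| < 1 by exact: le_lt_trans u1.
rewrite -(subrK (S0 c) (S0 0)) -addrA (le_trans (ler_normD _ _))// lerD//.
  by apply: rP; rewrite /= sub0r normrN (le_lt_trans cu).
by rewrite distrC; exact: SS0.
Unshelve. all: end_near. Qed.

(** The derivatives of [h N] differ from their limit by at most the integral of [W |k_N - k|]. This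
    is independent of [t] and tends to [0] by dominated convergence, which is the uniformity asked
    by [is_derive_limit]. [Phi] has only to be continuous in [t]: the derivatives have already been
    moved onto the kernels [k_]. *)
Lemma is_derive_integral_limit d (X : measurableType d) (mu : {measure set X -> \bar R})
    (Phi : R -> X -> R) (k_ : nat -> X -> R) (k W kb : X -> R)
    (h : nat -> R -> R) (h0 : R -> R) :
  (forall t, `|t| < 1 -> measurable_fun setT (Phi t)) ->
  (forall N, measurable_fun setT (k_ N)) -> measurable_fun setT k ->
  measurable_fun setT W ->
  (forall t y, `|t| < 1 -> `|Phi t y| <= W y) ->
  {ae mu, forall y, forall N, `|k_ N y| <= kb y} ->
  {ae mu, forall y, k_ N y @[N --> \oo] --> k y} ->
  mu.-integrable setT (fun y => (W y * kb y)%:E) ->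
  (forall t y, `|t| < 1 -> {for t, continuous (Phi ^~ y)}) ->
  (forall N t, `|t| < 1 -> is_derive t (1 : R) (h N) (\int[mu]_y (Phi t y * k_ N y))) ->
  (forall t, `|t| < 1 -> h N t @[N --> \oo] --> h0 t) ->
  is_derive (0 : R) (1 : R) h0 (\int[mu]_y (Phi 0 y * k y)).
Proof.
move=> mPhi mk_ mk mW PhiW kkb kk iWk cPhi dh hh0.
have W0 y : 0 <= W y by apply: le_trans (PhiW 0 y _); rewrite ?normr0.
have kb0 : {ae mu, forall y, 0 <= kb y}.
  by apply: filterS kkb => y /(_ 0%N); apply: le_trans.
have kkb' : {ae mu, forall y, `|k y| <= kb y}.
  apply: filterS2 kkb kk => y H1 H2.
  have L : `|k_ N y| @[N --> \oo] --> `|k y| by apply: cvg_norm.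
  apply: (ler_cvg_to L (cvg_cst (kb y))); apply: nearW => N; exact: H1.
have ikS (g : X -> R) t : `|t| < 1 -> measurable_fun setT g ->
    {ae mu, forall y, `|g y| <= kb y} -> mu.-integrable setT (fun y => (Phi t y * g y)%:E).
  move=> t1 mg gb; apply/integrableP; split.
    by apply/measurable_EFinP; apply: measurable_funM => //; exact: mPhi.
  move/integrableP : iWk => [mWk]; apply: le_lt_trans.
  apply: ae_ge0_le_integral => //.
  - apply: measurableT_comp => //; apply/measurable_EFinP; apply: measurable_funM => //; exact: mPhi.
  - exact: measurableT_comp.
  apply: filterS2 gb kb0 => y gy ky _; rewrite lee_fin !normrM.
  by apply: ler_pM => //; [rewrite (ger0_norm (W0 y)); exact: PhiW|rewrite (ger0_norm ky)].
pose dk N y := W y * (k_ N y - k y).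
have idk N : mu.-integrable setT (fun y => (dk N y)%:E).
  apply/integrableP; split.
    by apply/measurable_EFinP; apply: measurable_funM => //; exact: measurable_funB.
  have := integrableP _ _ _ (integrableZl measurableT 2 iWk) => -[mWk]; apply: le_lt_trans.
  apply: ae_ge0_le_integral => //.
  - apply: measurableT_comp => //; apply/measurable_EFinP; apply: measurable_funM => //; exact: measurable_funB.
  - exact: measurableT_comp.
  apply: filterS2 kkb kkb' => y H1 H2 _.
  change ((`|W y * (k_ N y - k y)|)%:E <= (`|2 * (W y * kb y)|)%:E)%E.
  rewrite lee_fin normrM (ger0_norm (W0 y)).
  rewrite [leRHS]ger0_norm; last by rewrite !mulr_ge0// (le_trans _ H2).
  rewrite mulrCA ler_wpM2l// mulr_natl mulr2n (le_trans (ler_normB _ _))// lerD//.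
pose e N := \int[mu]_y `|dk N y|.
have iB N t : `|t| < 1 ->
    mu.-integrable setT (EFin \o (fun x => Phi t x * k_ N x - Phi t x * k x)).
  move=> t1; have I1 := ikS k t t1 mk kkb'.
  have I2 : mu.-integrable setT (fun y => (Phi t y * k_ N y)%:E).
    by apply: (ikS (k_ N)) => //; apply: filterS kkb.
  exact: (integrableB measurableT I2 I1).
have dct := @dominated_convergence _ _ _ mu setT measurableT
  (fun N y => (W y * k_ N y)%:E) (fun y => (W y * k y)%:E) (fun y => (W y * kb y)%:E).
have e0 : e N @[N --> \oo] --> (0 : R).
  have [] := dct.
  - by move=> N; apply/measurable_EFinP; exact: measurable_funM.
  - by apply/measurable_EFinP; exact: measurable_funM.
  - apply: filterS kk => y H _; apply: cvg_EFin; first exact: nearW.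
    by apply: cvgM => //; exact: cvg_cst.
  - exact: iWk.
  - apply: filterS kkb => y H N _; rewrite lee_fin normrM (ger0_norm (W0 y)).
    by rewrite ler_wpM2l.
  move=> _ /= /fine_cvg H _; apply: cvg_trans H; rewrite /e /Rintegral.
  apply: near_eq_cvg; apply: nearW => N /=; congr fine.
  by apply: eq_integral => y _; rewrite /dk mulrBr.
apply: (is_derive_limit (S0 := fun t => \int[mu]_y (Phi t y * k y)) dh hh0 _ e0).
- move=> N t t1; rewrite -RintegralB//; last 2 first.
  + by apply: ikS => //; apply: filterS kkb.
  + exact: ikS.
  rewrite /e (le_trans (le_normr_Rintegral _ _))//.
    exact: iB.
  apply: le_Rintegral => //.
  + exact: (integrable_abse (iB N t t1)).
  + exact: (integrable_abse (idk N)).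
  + by move=> y _; rewrite -mulrBr !normrM ler_wpM2r// (ger0_norm (W0 y)) PhiW.
have := @continuity_under_integral _ _ _ mu (fun t y => Phi t y * k y) setT measurableT (-1) 1.
move=> /(_ _ _ (fun y => W y * kb y)); apply => //.
- by move=> t; rewrite /= in_itv /= -ltr_norml => t1; apply: ikS.
- apply: aeW => y _ t; rewrite inE /= in_itv /= -ltr_norml => t1.
  by apply: cvgM; [exact: cPhi|exact: cvg_cst].
- move=> t; rewrite /= in_itv /= -ltr_norml => t1.
  apply: filterS kkb' => y H _; rewrite normrM; apply: ler_pM => //; exact: PhiW.
- by rewrite inE /= in_itv /= ltrN10 ltr01.
Qed.
End derivative_limits.

(** * Regularised Riesz kernels *)

Section kernels.
Context {R : realType}.
Local Notation Rb := (measurableTypeR R).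

(** A partial derivative in the form of a one-variable derivative at [0], as the mean value theorem
    and differentiation under the integral require; [dirder_derive] converts it back. *)
Definition dirder d (f : 'rV[R]_d -> R) j (x : 'rV[R]_d) (l : R) :=
  is_derive (0 : R) (1 : R) (fun t => f (x + t *: delta_mx 0 j)) l.

Lemma dirder_line d (f f' : 'rV[R]_d -> R) j x t :
  dirder f j (x + t *: delta_mx 0 j) (f' (x + t *: delta_mx 0 j)) ->
  is_derive t (1 : R) (fun s => f (x + s *: delta_mx 0 j)) (f' (x + t *: delta_mx 0 j)).
Proof.
move=> H; have H1 : is_derive t (1 : R) (fun s : R => s - t) 1.
  by have := is_deriveB (is_derive_id t (1 : R)) (is_derive_cst t t (1 : R)); rewrite subr0.
rewrite /dirder in H; rewrite -[X in is_derive X](subrr t) in H.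
have := @is_derive1_comp R _ (fun s : R => s - t) t _ _ H H1; rewrite mulr1.
congr (is_derive _ _ _ _); apply/funext => s /=.
by rewrite -addrA -scalerDl (addrC t) subrK.
Qed.

Lemma dirder_derive d (f : 'rV[R]_d -> R) j x l :
  dirder f j x l -> is_derive x (delta_mx 0 j : 'rV[R]_d) f l.
Proof.
have E : (fun h : R => h^-1 *: (((fun t => f (x + t *: delta_mx 0 j)) \o shift 0) (h *: (1 : R)) -
     (fun t => f (x + t *: delta_mx 0 j)) 0)) =
   (fun h : R => h^-1 *: ((f \o shift x) (h *: delta_mx 0 j) - f x)).
  apply/funext => h /=; rewrite /shift /= addr0 scale0r addr0 [h *: 1]mulr1.
  by rewrite [x + _]addrC.
move=> [dv <-]; apply: DeriveDef; first by move: dv; rewrite /derivable E.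
by rewrite /derive E.
Qed.

Lemma qn_line d (x : 'rV[R]_d) j t :
  qn (x + t *: delta_mx 0 j) = qn x + (2 * x 0 j * t + t ^+ 2).
Proof.
rewrite /qn (bigD1 j)//= [in RHS](bigD1 j)//= !mxE !eqxx mulr1.
rewrite (eq_bigr (fun i => x 0 i ^+ 2)); first by ring.
by move=> i ij; rewrite !mxE (negbTE ij) andbF mulr0 addr0.
Qed.

(* [e > 0] regularises the singularity at the origin; [kn1] and [kn2] are the
   first two derivatives along the coordinate [j], up to [e = 0]. *)
Definition kn d (e p : R) (x : 'rV[R]_d) : R := (qn x + e) `^ (- p).

Definition kn1 d (e p : R) j (x : 'rV[R]_d) : R := - (2 * p) * x 0 j * kn e (p + 1) x.

Definition kn2 d (e p : R) j (x : 'rV[R]_d) : R :=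
  - (2 * p) * kn e (p + 1) x + 4 * p * (p + 1) * x 0 j ^+ 2 * kn e (p + 2) x.

Lemma kn_ge0 d e p (x : 'rV[R]_d) : 0 <= kn e p x. Proof. exact: powR_ge0. Qed.

Lemma qnD_gt0 d e (x : 'rV[R]_d) : 0 < e -> 0 < qn x + e.
Proof. by move=> e0; rewrite ltr_wpDl// qn_ge0. Qed.

Lemma dirder_kn d (e p : R) j (x : 'rV[R]_d) : 0 < e -> dirder (kn e p) j x (kn1 e p j x).
Proof.
move=> e0; rewrite /dirder.
have x0 : 0 < qn x + (2 * x 0 j * 0 + 0 ^+ 2) + e by rewrite mulr0 expr0n /= !addr0 qnD_gt0.
have H1 := is_derive1_powR (- p) x0.
have H2 : is_derive (0 : R) (1 : R) (fun t : R => qn x + (2 * x 0 j * t + t ^+ 2) + e) (2 * x 0 j).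
  by apply: is_derive_eq; rewrite /GRing.scale /=; ring.
have := @is_derive1_comp R (fun y : R => y `^ (- p)) (fun t : R => qn x + (2 * x 0 j * t + t ^+ 2) + e) 0 _ _ H1 H2.
rewrite mulr0 expr0n /= !addr0 => H.
rewrite (_ : (fun t => _) = (fun y : R => y `^ (- p)) \o (fun t : R => qn x + (2 * x 0 j * t + t ^+ 2) + e)).
  apply: (is_derive_eq H); rewrite /kn1 /kn (_ : - p - 1 = - (p + 1)); last by ring.
  by ring.
by apply/funext => t; rewrite /kn qn_line.
Qed.

Lemma dirder_kn1 d (e p : R) j (x : 'rV[R]_d) : 0 < e -> dirder (kn1 e p j) j x (kn2 e p j x).
Proof.
move=> e0; have H := dirder_kn (p + 1) j x e0.
rewrite /dirder in H *.
have H1 : is_derive (0 : R) (1 : R) (fun t : R => - (2 * p) * (x 0 j + t)) (- (2 * p)).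
  by apply: is_derive_eq; rewrite /GRing.scale /=; ring.
have H2 := is_deriveM H1 H.
rewrite (_ : (fun t => _) = (fun t : R => - (2 * p) * (x 0 j + t)) * (fun t => kn e (p + 1) (x + t *: delta_mx 0 j))).
  apply: (is_derive_eq H2); rewrite scale0r !addr0 /GRing.scale /= /kn2 /kn1.
  by rewrite (_ : p + 1 + 1 = p + 2); [ring|ring].
by apply/funext => t; rewrite /kn1 !mxE !eqxx mulr1.
Qed.

Lemma kn_le0 d e p (x : 'rV[R]_d) : 0 < qn x -> 0 <= e -> 0 <= p -> kn e p x <= kn 0 p x.
Proof. by move=> x0 e0 p0; rewrite /kn powR_antitone ?addr0// ?lerDl// oppr_le0. Qed.

Lemma kn_half d e p (x : 'rV[R]_d) : 0 < qn x + e ->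
  (qn x + e) `^ (2^-1) * kn e p x = kn e (p - 2^-1) x.
Proof.
move=> x0; rewrite /kn -powRD; last by rewrite (gt_eqF x0) implybT.
by congr (_ `^ _); ring.
Qed.

Lemma kn_one d e p (x : 'rV[R]_d) : 0 < qn x + e ->
  (qn x + e) * kn e p x = kn e (p - 1) x.
Proof.
move=> x0; rewrite /kn -[X in X * _]powRr1 ?ltW// -powRD; last by rewrite (gt_eqF x0) implybT.
by congr (_ `^ _); ring.
Qed.

Lemma coord_le_qn d e (x : 'rV[R]_d) j : 0 <= e -> `|x 0 j| <= (qn x + e) `^ (2^-1).
Proof.
move=> e0; rewrite powR12_sqrt ?addr_ge0 ?qn_ge0// -sqrtr_sqr ler_wsqrtr//.
by rewrite (le_trans (sqr_le_qn x j))// lerDl.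
Qed.

Lemma coord_kn_le d e p (x : 'rV[R]_d) j : 0 <= e -> 0 < qn x + e ->
  `|x 0 j| * kn e p x <= kn e (p - 2^-1) x.
Proof. by move=> e0 x0; rewrite -kn_half// ler_wpM2r ?kn_ge0// coord_le_qn. Qed.

Lemma sqr_coord_kn_le d e p (x : 'rV[R]_d) j : 0 <= e -> 0 < qn x + e ->
  x 0 j ^+ 2 * kn e p x <= kn e (p - 1) x.
Proof.
move=> e0 x0; rewrite -kn_one// ler_wpM2r ?kn_ge0//.
by rewrite (le_trans (sqr_le_qn x j))// lerDl.
Qed.

Lemma norm_kn1_le d e p j (x : 'rV[R]_d) : 0 <= e -> 0 < qn x + e -> 0 <= p ->
  `|kn1 e p j x| <= 2 * p * kn e (p + 2^-1) x.
Proof.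
move=> e0 x0 p0; have p2 : 0 <= 2 * p by rewrite mulr_ge0.
rewrite /kn1 2!normrM normrN (ger0_norm p2) (ger0_norm (kn_ge0 _ _ _)) -mulrA.
apply: ler_wpM2l => //; apply: le_trans (coord_kn_le _ _ e0 x0) _.
by rewrite (_ : p + 1 - 2^-1 = p + 2^-1)//; field.
Qed.

Lemma norm_kn2_le d e p j (x : 'rV[R]_d) : 0 <= e -> 0 < qn x + e -> 0 <= p ->
  `|kn2 e p j x| <= (2 * p + 4 * p * (p + 1)) * kn e (p + 1) x.
Proof.
move=> e0 x0 p0; have p2 : 0 <= 2 * p by rewrite mulr_ge0.
have p4 : 0 <= 4 * p * (p + 1) by rewrite !mulr_ge0 ?addr_ge0.
rewrite /kn2; apply: le_trans (ler_normD _ _) _; rewrite [leRHS]mulrDl; apply: lerD.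
  by rewrite normrM normrN (ger0_norm (kn_ge0 _ _ _)) (ger0_norm p2).
rewrite -mulrA normrM (ger0_norm p4); apply: ler_wpM2l => //.
rewrite ger0_norm; last by rewrite mulr_ge0 ?sqr_ge0 ?kn_ge0.
apply: le_trans (sqr_coord_kn_le _ _ e0 x0) _.
by rewrite (_ : p + 2 - 1 = p + 1)//; ring.
Qed.

(** Subtracting the kernel at [e = 1] gains a factor [|x|^(-2)] at infinity, because the two bases
    differ by [1 - e], which is bounded. *)
Lemma kn_sub_le d e q (x : 'rV[R]_d) : 0 <= e -> e <= 1 -> 0 < qn x + e -> 0 <= q ->
  `|kn e q x - kn 1 q x| <= q * kn e (q + 1) x.
Proof.
move=> e0 e1 x0 q0.
have x1 : 0 < qn x + 1 by exact: qnD_gt0.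
have le1 : kn 1 q x <= kn e q x by rewrite /kn powR_antitone ?oppr_le0// lerD2l.
rewrite ger0_norm ?subr_ge0//.
pose r := (qn x + 1) / (qn x + e).
have r0 : 0 < r by rewrite divr_gt0.
have -> : kn 1 q x = kn e q x * r `^ (- q).
  by rewrite /kn -powRM ?ltW// /r mulrC divfK// gt_eqF.
have -> : kn e q x = (qn x + e) * kn e (q + 1) x by rewrite kn_one// addrK.
(* [r^(-q) = exp(- q ln r) >= 1 - q ln r >= 1 - q (r - 1)]. *)
have : 1 - q * (r - 1) <= r `^ (- q).
  rewrite /powR (gt_eqF r0); apply: le_trans (expR_ge1Dx _).
  rewrite mulNr lerD2l lerN2 ler_wpM2l//.
  have /le_ln1Dx : -1 < r - 1 by lra.
  by rewrite addrC subrK.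
move=> H; have K0 := kn_ge0 e (q + 1) x.
have rE : (qn x + e) * (r - 1) = 1 - e by rewrite /r; field; rewrite gt_eqF.
clearbody r.
apply: (@le_trans _ _ ((qn x + e) * kn e (q + 1) x * (q * (r - 1)))).
  rewrite -[X in X - _]mulr1 -mulrBr ler_wpM2l ?mulr_ge0 ?(ltW x0)//; lra.
have -> : (qn x + e) * kn e (q + 1) x * (q * (r - 1)) =
    q * kn e (q + 1) x * ((qn x + e) * (r - 1)) by ring.
rewrite rE.
by rewrite ler_piMr ?mulr_ge0// lerBlDr lerDl.
Qed.

Lemma norm_kn1B_le d e p j (x : 'rV[R]_d) :
  0 <= e -> e <= 1 -> 0 < qn x + e -> 0 <= p ->
  `|kn1 e p j x - kn1 1 p j x| <= 2 * p * (p + 1) * kn e (p + 1 + 2^-1) x.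
Proof.
move=> e0 e1 x0 p0; have p2 : 0 <= 2 * p by rewrite mulr_ge0.
rewrite /kn1 -mulrBr 2!normrM normrN (ger0_norm p2) -2!(mulrA (2 * p)).
apply: ler_wpM2l => //.
have p1 : 0 <= p + 1 by rewrite addr_ge0.
apply: (@le_trans _ _ (`|x 0 j| * ((p + 1) * kn e (p + 1 + 1) x))).
  by rewrite ler_wpM2l// kn_sub_le.
rewrite mulrCA ler_wpM2l//; apply: le_trans (coord_kn_le _ _ e0 x0) _.
by rewrite (_ : p + 1 + 1 - 2^-1 = p + 1 + 2^-1)//; field.
Qed.

Lemma norm_kn2B_le d e p j (x : 'rV[R]_d) :
  0 <= e -> e <= 1 -> 0 < qn x + e -> 0 <= p ->
  `|kn2 e p j x - kn2 1 p j x| <=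
    (2 * p * (p + 1) + 4 * p * (p + 1) * (p + 2)) * kn e (p + 2) x.
Proof.
move=> e0 e1 x0 p0; have p2 : 0 <= 2 * p by rewrite mulr_ge0.
have p1 : 0 <= p + 1 by rewrite addr_ge0.
have p22 : 0 <= p + 2 by rewrite addr_ge0.
have p4 : 0 <= 4 * p * (p + 1) by rewrite !mulr_ge0.
rewrite (_ : _ - _ = - (2 * p) * (kn e (p + 1) x - kn 1 (p + 1) x) +
  4 * p * (p + 1) * (x 0 j ^+ 2 * (kn e (p + 2) x - kn 1 (p + 2) x))); last by rewrite /kn2; ring.
apply: le_trans (ler_normD _ _) _; rewrite [leRHS]mulrDl; apply: lerD.
  rewrite normrM normrN (ger0_norm p2) -[leRHS]mulrA; apply: ler_wpM2l => //.
  by have := kn_sub_le e0 e1 x0 p1; rewrite -addrA.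
rewrite normrM (ger0_norm p4) -[leRHS]mulrA; apply: ler_wpM2l => //.
rewrite normrM (ger0_norm (sqr_ge0 _)).
apply: (@le_trans _ _ (x 0 j ^+ 2 * ((p + 2) * kn e (p + 2 + 1) x))).
  by rewrite ler_wpM2l ?sqr_ge0// kn_sub_le.
rewrite mulrCA ler_wpM2l//; apply: le_trans (sqr_coord_kn_le _ _ e0 x0) _.
by rewrite addrK.
Qed.

(** The Laplacian of the regularised kernel, by writing [|x|^2] as [(|x|^2 + e) - e]. The first
    coefficient is [2 p (2 p + 2 - d)], zero for the Newtonian exponent; the second term is absent
    at [e = 0]. *)
Lemma sum_kn2 d e p (x : 'rV[R]_d) : 0 < qn x + e ->
  \sum_j kn2 e p j x = (4 * p * (p + 1) - 2 * p * d%:R) * kn e (p + 1) x -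
    4 * p * (p + 1) * e * kn e (p + 2) x.
Proof.
move=> x0; rewrite /kn2 big_split /= sumr_const card_ord.
under eq_bigr => j _ do rewrite mulrAC.
rewrite -mulr_sumr -/(qn x) -(mulr_natr _ d).
have := kn_one (p + 2) x0; rewrite (_ : p + 2 - 1 = p + 1); last by ring.
by move=> <-; ring.
Qed.

(** The constant blows up as [e] tends to [0], so the bound serves at fixed [e]; the passage to the
    limit is dominated through [kn_le0]. *)
Lemma kn_bracket_le d e p (x : 'rV[R]_d) : 0 < e -> e <= 1 -> 0 <= p ->
  kn e p x <= e `^ (- p) * kn 1 p x.
Proof.
move=> e0 e1 p0; rewrite /kn -powRM ?(ltW e0) ?addr_ge0 ?qn_ge0//.
apply: powR_antitone; rewrite ?oppr_le0 ?mulr_gt0 ?qnD_gt0//.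
by rewrite mulrDr mulr1 lerD2r ler_piMl ?qn_ge0.
Qed.

(** Peetre's inequality [1 + |y|^2 <= 2 (1 + |x|^2) (1 + |x - y|^2)]: a translation costs a factor
    that is locally bounded in [x]. *)
Lemma kn_peetre d p (x y : 'rV[R]_d) : 0 <= p ->
  kn 1 p (x - y) <= (2 * (1 + qn x)) `^ p * kn 1 p y.
Proof.
move=> p0; have a0 : 0 < 2 * (1 + qn x) by rewrite mulr_gt0// ltr_pwDl// qn_ge0.
have y1 := @qnD_gt0 _ 1 y ltr01.
have -> : (2 * (1 + qn x)) `^ p = (2 * (1 + qn x))^-1 `^ (- p).
  by rewrite -[in RHS](powR_inv1 (ltW a0)) -powRrM mulN1r opprK.
rewrite /kn -powRM ?invr_ge0 ?(ltW a0) ?(ltW y1)//.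
apply: powR_antitone; rewrite ?oppr_le0 ?mulr_gt0 ?invr_gt0//.
rewrite mulrC ler_pdivrMr//.
have := qnD_le x (- (x - y)); rewrite opprB addrCA subrr addr0 -(qnN (y - x)) opprB.
have := qn_ge0 x; have := qn_ge0 (x - y); nra.
Qed.

Lemma kn_cvg d p (x : 'rV[R]_d) : 0 < qn x ->
  kn (N.+1%:R^-1) p x @[N --> \oo] --> kn 0 p x.
Proof.
move=> x0; apply: (@cvg_comp _ _ _ (fun N : nat => qn x + N.+1%:R^-1) (fun y => y `^ (- p)) _ (nbhs (qn x + 0))).
  by apply: cvgD; [exact: cvg_cst|exact: cvg_harmonic].
by rewrite /kn !addr0; exact: powR_continuous_at.
Qed.

Lemma kn1_cvg d p j (x : 'rV[R]_d) : 0 < qn x ->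
  kn1 (N.+1%:R^-1) p j x @[N --> \oo] --> kn1 0 p j x.
Proof. by move=> x0; apply: cvgM; [exact: cvg_cst|exact: kn_cvg]. Qed.

Lemma kn2_cvg d p j (x : 'rV[R]_d) : 0 < qn x ->
  kn2 (N.+1%:R^-1) p j x @[N --> \oo] --> kn2 0 p j x.
Proof.
by move=> x0; apply: cvgD; (apply: cvgM; [exact: cvg_cst|exact: kn_cvg]).
Qed.

Lemma measurable_kn m e p : measurable_fun [set: m.+1.-tuple Rb] (fun x => kn e p (vec x)).
Proof.
apply: (measurableT_comp (measurable_powR _)); apply: measurable_funD => //.
exact: (measurable_continuous_vec (@qn_continuous R _)).
Qed.

Lemma measurable_kn1 m e p j : measurable_fun [set: m.+1.-tuple Rb] (fun x => kn1 e p j (vec x)).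
Proof.
apply: measurable_funM; last exact: measurable_kn.
by apply: measurable_funM => //; exact: measurable_vec.
Qed.

Lemma measurable_kn2 m e p j : measurable_fun [set: m.+1.-tuple Rb] (fun x => kn2 e p j (vec x)).
Proof.
apply: measurable_funD.
  by apply: measurable_funM => //; exact: measurable_kn.
apply: measurable_funM; last exact: measurable_kn.
by apply: measurable_funM => //; apply: (measurable_funX 2); exact: measurable_vec.
Qed.

End kernels.

(** * Integrability and differentiation of convolutions *)

Section integrability.
Context {R : realType}.
Local Notation Rb := (measurableTypeR R).

Lemma ae_tsq_gt0 k : {ae @lebm R k.+1, forall y, 0 < tsq y}.
Proof.
have := @negligible_tsq0 R k; apply: negligibleS => y /=.
by apply: contra_notP => /eqP y0; rewrite lt_neqAle eq_sym y0 tsq_ge0.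
Qed.

Lemma integrable_powR_bound k (g : k.+1.-tuple Rb -> R) (r s C : R) : 0 <= C ->
  2 * r < k.+1%:R -> k.+1%:R < 2 * s ->
  measurable_fun [set: k.+1.-tuple Rb] g ->
  (forall y, 0 < tsq y -> tsq y <= 1 -> `|g y| <= C * tsq y `^ (- r)) ->
  (forall y, 1 <= tsq y -> `|g y| <= C * tsq y `^ (- s)) ->
  (@lebm R k.+1).-integrable setT (EFin \o g).
Proof.
move=> C0 rk ks mg g1 g2.
pose d : R := k.+1%:R.
have d0 : 0 < d by rewrite ltr0n.
(* The last two terms give [r <= d (1 - c) / 2] and [d (1 + c) / 2 <= s], the conditions of
   [wt_ge_small] and [wt_ge_large]; [2^-1] keeps [c] below [1]. *)
pose c := Num.min 2^-1 (Num.min (1 - 2 * r / d) (2 * s / d - 1)).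
have c0 : 0 < c.
  rewrite !lt_min invr_gt0 ltr0n /= !subr_gt0 ltr_pdivrMr// ltr_pdivlMr// !mul1r.
  by rewrite rk ks.
have c1 : c < 1 by rewrite gt_min; apply/orP; left; lra.
have cr : r <= d * (1 - c) / 2.
  have : c <= 1 - 2 * r / d by rewrite !ge_min lexx !orbT.
  rewrite lerBrDr -lerBrDl ler_pdivrMr// => h; rewrite ler_pdivlMr//; lra.
have cs : d * (1 + c) / 2 <= s.
  have : c <= 2 * s / d - 1 by rewrite !ge_min lexx !orbT.
  rewrite lerBrDr ler_pdivlMr// => h; rewrite ler_pdivrMr//; lra.
have mw : measurable_fun [set: k.+1.-tuple Rb] (fun y => C * wt c (tsq y) ^+ k.+1).
  apply: measurable_funM => //; apply: measurable_funX.
  by apply: (measurableT_comp (measurable_wt _)); exact: measurable_tsq.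
have w0 y : 0 <= C * wt c (tsq y) ^+ k.+1 by rewrite mulr_ge0// exprn_ge0// wt_ge0.
apply/integrableP; split; first exact/measurable_EFinP.
apply: (@le_lt_trans _ _ (\int[@lebm R k.+1]_y (C * wt c (tsq y) ^+ k.+1)%:E)%E); last first.
  under eq_integral do rewrite EFinM.
  rewrite ge0_integralZl_EFin//.
  - by rewrite lte_mul_pinfty//; exact: integral_wt_lty.
  - by move=> y _; rewrite lee_fin exprn_ge0// wt_ge0.
  - apply/measurable_EFinP; apply: measurable_funX.
    by apply: (measurableT_comp (measurable_wt _)); exact: measurable_tsq.
apply: ae_ge0_le_integral => //.
- by apply: measurableT_comp => //; exact/measurable_EFinP.
- by move=> y _; rewrite lee_fin.
- exact/measurable_EFinP.
apply: filterS (ae_tsq_gt0 k) => y y0 _; rewrite lee_fin.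
have [y1|/ltW y1] := leP (tsq y) 1.
  by apply: le_trans (g1 y y0 y1) _; rewrite ler_wpM2l// wt_ge_small// y0.
by apply: le_trans (g2 y y1) _; rewrite ler_wpM2l// wt_ge_large.
Qed.

Lemma integrable_decay k (g : k.+1.-tuple Rb -> R) (a r C : R) : 0 <= C -> 0 <= a -> 0 <= r ->
  2 * r < k.+1%:R -> k.+1%:R < 2 * (a + r) ->
  measurable_fun [set: k.+1.-tuple Rb] g ->
  (forall y, 0 < tsq y -> `|g y| <= C * ((tsq y + 1) `^ (- a) * tsq y `^ (- r))) ->
  (@lebm R k.+1).-integrable setT (EFin \o g).
Proof.
move=> C0 a0 r0 rk ark mg gb.
apply: (integrable_powR_bound C0 rk ark) => // [y y0 y1|y y1].
  apply: le_trans (gb y y0) _; rewrite ler_wpM2l// ler_piMl ?powR_ge0//.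
  rewrite -[leRHS](powRr0 (tsq y + 1)) ler_powR ?oppr_le0//.
  by rewrite lerDr ltW.
have y0 : 0 < tsq y by exact: lt_le_trans y1.
apply: le_trans (gb y y0) _; rewrite ler_wpM2l// opprD powRD ?(gt_eqF y0) ?implybT//.
by rewrite ler_wpM2r ?powR_ge0// powR_antitone ?oppr_le0// lerDl.
Qed.

Lemma integrable_kn m (p : R) : 0 <= p -> m.+1%:R < 2 * p ->
  (@lebm R m.+1).-integrable setT (fun y => (kn 1 p (vec y))%:E).
Proof.
move=> p0 mp; apply: (@integrable_decay m _ p 0 1) => //; rewrite ?addr0 ?mulr0//.
  exact: measurable_kn.
by move=> y y0; rewrite mul1r oppr0 powRr0 mulr1 ger0_norm ?kn_ge0// /kn qn_vec.
Qed.

Lemma integrable_kn_bound m (g : m.+1.-tuple Rb -> R) (p C : R) : 0 <= p ->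
  m.+1%:R < 2 * p -> measurable_fun [set: m.+1.-tuple Rb] g ->
  (forall y, `|g y| <= C * kn 1 p (vec y)) ->
  (@lebm R m.+1).-integrable setT (EFin \o g).
Proof.
move=> p0 mp mg gb.
apply: (@le_integrable _ _ _ _ setT measurableT _ (fun y => C%:E * (kn 1 p (vec y))%:E)%E).
- exact/measurable_EFinP.
- by move=> y _; rewrite -EFinM /= lee_fin (le_trans (gb y))// ler_norm.
- by apply: integrableZl => //; exact: integrable_kn.
Qed.

(** Moves [x] from [F], about which no differentiability is known, to the kernel, which is
    differentiated. *)
Lemma Rintegral_reflectM m (F k : 'rV[R]_(m + 1) -> R) x :
  measurable_fun [set: m.+1.-tuple Rb] (fun y => F (vec y)) ->
  measurable_fun [set: m.+1.-tuple Rb] (fun y => k (vec y)) ->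
  \int[@lebm R m.+1]_y (F (x - vec y) * k (vec y)) =
  \int[@lebm R m.+1]_y (F (vec y) * k (x - vec y)).
Proof.
move=> mF mk; congr fine.
rewrite -(integral_vec_reflect (G := fun v => (F (x - v) * k v)%:E) x).
  by apply: eq_integral => y _; rewrite opprB addrCA subrr addr0.
apply/measurable_EFinP; apply: measurable_funM => //.
exact: measurable_vec_reflect.
Qed.

Lemma qn_line_le d (x : 'rV[R]_d) j t : `|t| < 1 ->
  qn (x + t *: delta_mx 0 j) <= 2 * qn x + 2.
Proof.
move=> t1; rewrite qn_line; have := sqr_le_qn x j; have := sqr_ge0 (x 0 j - t).
have : t ^+ 2 <= 1 by rewrite -(real_normK (num_real t)) expr_le1// ltW.
nra.
Qed.

(** Differentiation under the integral for a kernel without singularity. After reflection [x] occurs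
    only in the kernel, Peetre's inequality removes it from the bounds, and the decay exponents of
    [F] and of the kernel add up. *)
Lemma dirder_conv m (F k k' : 'rV[R]_(m + 1) -> R) j (a b b' B C C' : R) :
  0 <= a -> 0 <= b -> 0 <= b' -> 0 <= B -> 0 <= C -> 0 <= C' ->
  m.+1%:R < 2 * (a + b) -> m.+1%:R < 2 * (a + b') ->
  measurable_fun [set: m.+1.-tuple Rb] (fun y => F (vec y)) ->
  measurable_fun [set: m.+1.-tuple Rb] (fun y => k (vec y)) ->
  measurable_fun [set: m.+1.-tuple Rb] (fun y => k' (vec y)) ->
  (forall x, `|F x| <= B * kn 1 a x) -> (forall x, `|k x| <= C * kn 1 b x) ->
  (forall x, `|k' x| <= C' * kn 1 b' x) -> (forall x, dirder k j x (k' x)) ->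
  forall x, dirder (fun x => \int[@lebm R m.+1]_y (F (x - vec y) * k (vec y))) j x
    (\int[@lebm R m.+1]_y (F (x - vec y) * k' (vec y))).
Proof.
move=> a0 b0 b'0 B0 C0 C'0 ab ab' mF mk mk' Fb kb kb' dk x.
pose xt t := x + t *: delta_mx 0 j : 'rV[R]_(m + 1).
pose f t (y : m.+1.-tuple Rb) := F (vec y) * k (xt t - vec y).
(* [2 |x|^2 + 2] bounds the squared norm of [x + t e_j] for all [|t| < 1], so the Peetre factor is
   uniform in [t]. *)
pose M := (2 * (1 + (2 * qn x + 2))) `^ b'.
pose G (y : m.+1.-tuple Rb) := B * C' * M * kn 1 (a + b') (vec y).
have knD q r (y : 'rV[R]_(m + 1)) : kn 1 q y * kn 1 r y = kn 1 (q + r) y.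
  by rewrite /kn opprD powRD// (gt_eqF (qnD_gt0 y ltr01)) implybT.
have bound h D q t y : 0 <= D -> 0 <= q -> (forall x, `|h x| <= D * kn 1 q x) ->
    `|F (vec y) * h (xt t - vec y)| <= B * D * (2 * (1 + qn (xt t))) `^ q * kn 1 (a + q) (vec y).
  move=> D0 q0 hb; rewrite normrM -knD.
  have -> : B * D * (2 * (1 + qn (xt t))) `^ q * (kn 1 a (vec y) * kn 1 q (vec y)) =
     (B * kn 1 a (vec y)) * (D * ((2 * (1 + qn (xt t))) `^ q * kn 1 q (vec y))) by ring.
  apply: ler_pM => //; apply: le_trans (hb _) _; rewrite ler_wpM2l//.
  exact: kn_peetre.
have dline t y : is_derive t (1 : R) (f ^~ y) (F (vec y) * k' (xt t - vec y)).
  have /dirder_line H : dirder k j ((x - vec y) + t *: delta_mx 0 j) (k' ((x - vec y) + t *: delta_mx 0 j)) by exact: dk.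
  have := is_deriveZ (F (vec y)) H.
  rewrite /f /xt addrAC; congr (is_derive _ _ _ _); apply/funext => s.
  by rewrite [LHS]/GRing.scale /= addrAC.
have d1f t y : partial1of2 f t y = F (vec y) * k' (xt t - vec y).
  by rewrite partial1of2E; have [_ ->] := dline t y.
have mxt t (h : 'rV[R]_(m + 1) -> R) : measurable_fun [set: m.+1.-tuple Rb] (fun y => h (vec y)) ->
    measurable_fun [set: m.+1.-tuple Rb] (fun y => F (vec y) * h (xt t - vec y)).
  by move=> mh; apply: measurable_funM => //; exact: measurable_vec_reflect.
have Itv (t : R) : t \in `]-1, 1[ -> `|t| < 1 by rewrite in_itv /= ltr_norml.
have intf t : `]-1, 1[%classic t ->
    (@lebm R m.+1).-integrable setT (EFin \o f t).
  move=> _; apply: (@integrable_kn_bound m _ (a + b) (B * C * (2 * (1 + qn (xt t))) `^ b)) => //.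
  - by rewrite addr_ge0.
  - exact: mxt.
  - by move=> y; exact: bound.
have intG : (@lebm R m.+1).-integrable setT (EFin \o G).
  apply: (@integrable_kn_bound m _ (a + b') (B * C' * M)) => //.
  - by rewrite addr_ge0.
  - by apply: measurable_funM => //; exact: measurable_kn.
  - by move=> y; rewrite /G ger0_norm// !mulr_ge0 ?powR_ge0 ?kn_ge0.
have G0 y : 0 <= G y by rewrite !mulr_ge0 ?powR_ge0 ?kn_ge0.
have I0 : `]-1, 1[%classic (0 : R) by rewrite /= in_itv /= ltrN10 ltr01.
have Gub t y : `]-1, 1[%classic t -> setT y -> `|partial1of2 f t y| <= G y.
  move=> /= /Itv t1 _; rewrite d1f; apply: le_trans (bound k' C' b' t y C'0 b'0 kb') _.
  rewrite ler_wpM2r ?kn_ge0// ler_wpM2l ?mulr_ge0// /M.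
  apply: ge0_ler_powR => //; rewrite ?nnegrE ?mulr_ge0 ?addr_ge0 ?mulr_ge0 ?qn_ge0//.
  by rewrite ler_wpM2l// lerD2l; exact: qn_line_le.
have derf t y : `]-1, 1[%classic t -> setT y -> derivable (f ^~ y) t 1.
  by move=> _ _; have [] := dline t y.
have L := cvg_differentiation_under_integral measurableT I0 intf derf G0 intG Gub.
rewrite /dirder.
have -> : (fun t => \int[@lebm R m.+1]_y (F (x + t *: delta_mx 0 j - vec y) * k (vec y))) =
    (fun t => \int[@lebm R m.+1]_y f t y).
  by apply/funext => t; rewrite Rintegral_reflectM.
rewrite (Rintegral_reflectM x mF mk').
have E : \int[@lebm R m.+1]_y (F (vec y) * k' (x - vec y)) = \int[@lebm R m.+1]_y partial1of2 f 0 y.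
  by apply: eq_Rintegral => y _; rewrite d1f /xt scale0r addr0.
have H : (fun u : R => u^-1 *: (((fun t => \int[@lebm R m.+1]_y f t y) \o shift 0) (u *: (1 : R)) - \int[@lebm R m.+1]_y f 0 y)) @ 0^'
   --> \int[@lebm R m.+1]_y partial1of2 f 0 y.
  apply: cvg_trans L; apply: near_eq_cvg; apply: nearW => u /=.
  by rewrite /shift /= [u *: 1]mulr1.
rewrite E; apply: DeriveDef; first by apply/cvg_ex; exists (\int[@lebm R m.+1]_y partial1of2 f 0 y).
exact: cvg_lim.
Qed.

End integrability.

(** * Potentials and their derivatives *)

Section potentials.
Context {R : realType}.
Local Notation Rb := (measurableTypeR R).

Lemma cvg_Rintegral d (X : measurableType d) (mu : {measure set X -> \bar R})
    (f_ : nat -> X -> R) (f g : X -> R) :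
  (forall N, measurable_fun setT (f_ N)) -> measurable_fun setT f ->
  {ae mu, forall y, f_ N y @[N --> \oo] --> f y} ->
  {ae mu, forall y, forall N, `|f_ N y| <= g y} ->
  mu.-integrable setT (EFin \o g) ->
  \int[mu]_y f_ N y @[N --> \oo] --> \int[mu]_y f y.
Proof.
move=> mf_ mf ff fg ig.
have [] := @dominated_convergence _ _ _ mu setT measurableT
  (fun N y => (f_ N y)%:E) (EFin \o f) (EFin \o g).
- by move=> N; exact/measurable_EFinP.
- exact/measurable_EFinP.
- by apply: filterS ff => y H _; apply: cvg_EFin => //; exact: nearW.
- exact: ig.
- by apply: filterS fg => y H N _; rewrite lee_fin.
move=> If _ H; apply: fine_cvg; rewrite /Rintegral fineK//.
exact: integrable_fin_num.
Qed.

Lemma integrable_sum_fin d (X : measurableType d) (mu : {measure set X -> \bar R})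
    k (f : 'I_k -> X -> R) :
  (forall i, mu.-integrable setT (EFin \o f i)) ->
  mu.-integrable setT (EFin \o (fun x => \sum_i f i x)).
Proof.
elim: k f => [|k IH] f If.
  rewrite (_ : EFin \o _ = cst 0%E); first exact: integrable0.
  by apply/funext => x /=; rewrite big_ord0.
rewrite (_ : EFin \o _ = (EFin \o f ord0) \+ (EFin \o (fun x => (\sum_(i < k) f (lift ord0 i) x)%R)))%E.
  by apply: integrableD => //; exact: IH.
by apply/funext => x /=; rewrite big_ord_recl EFinD.
Qed.

Lemma Rintegral_sum d (X : measurableType d) (mu : {measure set X -> \bar R})
    k (f : 'I_k -> X -> R) :
  (forall i, mu.-integrable setT (EFin \o f i)) ->
  \int[mu]_x (\sum_i f i x) = \sum_i \int[mu]_x f i x.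
Proof.
elim: k f => [|k IH] f If.
  under eq_Rintegral do rewrite big_ord0.
  by rewrite big_ord0 Rintegral_cst// mul0r.
rewrite big_ord_recl -IH// -RintegralD//.
  by apply: eq_Rintegral => x _; rewrite big_ord_recl.
exact: integrable_sum_fin.
Qed.

Variables (m : nat) (F : 'rV[R]_(m + 1) -> R) (B al : R).
Hypotheses (B0 : 0 <= B) (al_gt : m%:R < 2 * al).
Hypothesis cF : continuous F.
Hypothesis Fb : forall x, `|F x| <= B * kn 1 al x.
Local Notation mu := (@lebm R m.+1).

Definition pot (k : 'rV[R]_(m + 1) -> R) x := \int[mu]_y (F (x - vec y) * k (vec y)).

Let al0 : 0 <= al.
Proof. by have : 0 <= m%:R :> R by []; move: al_gt; lra. Qed.

Let mFx x : measurable_fun [set: m.+1.-tuple Rb] (fun y => F (x - vec y)).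
Proof. by apply: measurable_vec_reflect; exact: measurable_continuous_vec. Qed.

Let mF : measurable_fun [set: m.+1.-tuple Rb] (fun y => F (vec y)).
Proof. exact: measurable_continuous_vec. Qed.

Let Wt (x : 'rV[R]_(m + 1)) := B * (2 * (1 + qn x)) `^ al.

Let Wt_ge0 x : 0 <= Wt x. Proof. by rewrite mulr_ge0 ?powR_ge0. Qed.

Let Fx_le x v : `|F (x - v)| <= Wt x * kn 1 al v.
Proof. by apply: le_trans (Fb _) _; rewrite /Wt -mulrA ler_wpM2l// kn_peetre. Qed.

Let Wline (x : 'rV[R]_(m + 1)) := B * (2 * (1 + (2 * qn x + 2))) `^ al.

Let Fline_le x j t v : `|t| < 1 -> `|F (x + t *: delta_mx 0 j - v)| <= Wline x * kn 1 al v.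
Proof.
move=> t1; apply: le_trans (Fx_le _ _) _; rewrite /Wline /Wt.
apply: ler_wpM2r; first exact: kn_ge0.
apply: ler_wpM2l => //; apply: ge0_ler_powR => //; rewrite ?nnegrE ?mulr_ge0 ?addr_ge0 ?mulr_ge0 ?qn_ge0//.
by rewrite ler_wpM2l// lerD2l; exact: qn_line_le.
Qed.

(** [m < 2 al] falls one power short of integrability of [F] on R^(m+1); [2^-1 <= r] supplies it at
    infinity, while [2 r < m.+1] handles the singularity of [k] at the origin. *)
Lemma integrable_pot (k : 'rV[R]_(m + 1) -> R) x r C : 0 <= C -> 2^-1 <= r -> 2 * r < m.+1%:R ->
  measurable_fun [set: m.+1.-tuple Rb] (fun y => k (vec y)) ->
  (forall v, 0 < qn v -> `|k v| <= C * kn 0 r v) ->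
  mu.-integrable setT (fun y => (F (x - vec y) * k (vec y))%:E).
Proof.
move=> C0 r2 rm mk kb.
apply: (@integrable_decay _ m _ al r (Wt x * C)) => //.
- by rewrite mulr_ge0.
- lra.
- by rewrite -natr1; move: al_gt; lra.
- exact: measurable_funM.
move=> y y0; rewrite normrM -qn_vec.
have -> : Wt x * C * ((qn (vec y) + 1) `^ (- al) * qn (vec y) `^ (- r)) =
  (Wt x * kn 1 al (vec y)) * (C * kn 0 r (vec y)) by rewrite /kn addr0; ring.
by apply: ler_pM => //; apply: kb; rewrite qn_vec.
Qed.

Let eN_gt0 (N : nat) : 0 < N.+1%:R^-1 :> R. Proof. by rewrite invr_gt0. Qed.
Let eN_le1 (N : nat) : N.+1%:R^-1 <= 1 :> R. Proof. by rewrite invf_le1// ler1n. Qed.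

Let line_cont x j v t : {for t, continuous (fun t : R => F (x + t *: delta_mx 0 j - v))}.
Proof.
apply: (@continuous_comp _ _ _ (fun t : R => x + t *: delta_mx 0 j - v) F); last exact: cF.
apply: cvgB; last exact: cvg_cst.
by apply: cvgD; [exact: cvg_cst|apply: cvgZr_tmp; exact: cvg_id].
Qed.

(** [dirder_conv] applies at each [e = 1/(N+1)], with constants that may depend on [N]; what must be
    uniform in [e] is the bound by [kn e r], itself below [kn 0 r]. The family [kap] is abstract so
    that the lemma serves both the first and the second derivative. *)
Lemma dirder_pot (kap kap' : R -> 'rV[R]_(m + 1) -> R) j (r r' C C' : R) :
  0 <= C -> 0 <= C' -> 2^-1 <= r -> 2^-1 <= r' -> 2 * r < m.+1%:R -> 2 * r' < m.+1%:R ->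
  (forall e, measurable_fun [set: m.+1.-tuple Rb] (fun y => kap e (vec y))) ->
  (forall e, measurable_fun [set: m.+1.-tuple Rb] (fun y => kap' e (vec y))) ->
  (forall e v, 0 <= e -> 0 < qn v + e -> `|kap e v| <= C * kn e r v) ->
  (forall e v, 0 <= e -> 0 < qn v + e -> `|kap' e v| <= C' * kn e r' v) ->
  (forall e v, 0 < e -> dirder (kap e) j v (kap' e v)) ->
  (forall v, 0 < qn v -> kap N.+1%:R^-1 v @[N --> \oo] --> kap 0 v) ->
  (forall v, 0 < qn v -> kap' N.+1%:R^-1 v @[N --> \oo] --> kap' 0 v) ->
  forall x, dirder (pot (kap 0)) j x (pot (kap' 0) x).
Proof.
move=> C0 C'0 r2 r'2 rm r'm mkap mkap' kb kb' dk ck ck' x.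
rewrite /dirder.
have -> : pot (kap' 0) x = \int[mu]_y (F (x + 0 *: delta_mx 0 j - vec y) * kap' 0 (vec y)).
  by rewrite scale0r addr0.
have r0 : 0 <= r by lra.
have r'0 : 0 <= r' by lra.
have aer (k : R -> 'rV[R]_(m + 1) -> R) D q : 0 <= q -> 0 <= D ->
    (forall e v, 0 <= e -> 0 < qn v + e -> `|k e v| <= D * kn e q v) ->
    {ae mu, forall y, forall N, `|k N.+1%:R^-1 (vec y)| <= D * kn 0 q (vec y)}.
  move=> q0 D0 H; apply: filterS (@ae_tsq_gt0 R m) => y y0 N.
  apply: le_trans (H _ _ (ltW (eN_gt0 N)) (qnD_gt0 _ (eN_gt0 N))) _.
  by rewrite ler_wpM2l// kn_le0// ?qn_vec// ltW.
have Fline_int q D : 2^-1 <= q -> 2 * q < m.+1%:R -> 0 <= D ->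
   mu.-integrable setT (fun y => (Wline x * kn 1 al (vec y) * (D * kn 0 q (vec y)))%:E).
  move=> q2 qm D0; apply: (@integrable_decay _ m _ al q (Wline x * D)) => //.
  - by rewrite !mulr_ge0 ?powR_ge0.
  - lra.
  - by rewrite -natr1; move: al_gt; lra.
  - apply: measurable_funM; apply: measurable_funM => //; exact: measurable_kn.
  move=> y y0; rewrite ger0_norm; last by rewrite !mulr_ge0 ?powR_ge0.
  by rewrite /kn addr0 qn_vec; lra.
apply: (@is_derive_integral_limit _ _ _ mu
  (fun t y => F (x + t *: delta_mx 0 j - vec y)) (fun N y => kap' N.+1%:R^-1 (vec y))
  (fun y => kap' 0 (vec y)) (fun y => Wline x * kn 1 al (vec y))
  (fun y => C' * kn 0 r' (vec y))
  (fun N t => pot (kap N.+1%:R^-1) (x + t *: delta_mx 0 j))).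
- by move=> t _; exact: mFx.
- by move=> N; exact: mkap'.
- exact: mkap'.
- by apply: measurable_funM => //; exact: measurable_kn.
- by move=> t y t1; exact: Fline_le.
- exact: aer.
- by apply: filterS (@ae_tsq_gt0 R m) => y y0; apply: ck'; rewrite qn_vec.
- exact: Fline_int.
- by move=> t y t1; exact: line_cont.
- move=> N t t1.
  apply: (@dirder_line R _ (pot (kap N.+1%:R^-1)) (pot (kap' N.+1%:R^-1)) j x t).
  have e0 := eN_gt0 N; have e1 := eN_le1 N.
  apply: (@dirder_conv _ m F _ _ j al r r' B (C * N.+1%:R^-1 `^ (- r)) (C' * N.+1%:R^-1 `^ (- r'))) => //.
  + by rewrite mulr_ge0 ?powR_ge0.
  + by rewrite mulr_ge0 ?powR_ge0.
  + by rewrite -natr1; move: al_gt; lra.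
  + by rewrite -natr1; move: al_gt; lra.
  + move=> v; apply: le_trans (kb _ _ (ltW e0) (qnD_gt0 _ e0)) _.
    by rewrite -mulrA ler_wpM2l// kn_bracket_le.
  + move=> v; apply: le_trans (kb' _ _ (ltW e0) (qnD_gt0 _ e0)) _.
    by rewrite -mulrA ler_wpM2l// kn_bracket_le.
  + by move=> v; exact: dk.
- move=> t t1; apply: (cvg_Rintegral (g := fun y => Wline x * kn 1 al (vec y) * (C * kn 0 r (vec y)))).
  + by move=> N; exact: measurable_funM.
  + exact: measurable_funM.
  + apply: filterS (@ae_tsq_gt0 R m) => y y0; apply: cvgM; first exact: cvg_cst.
    by apply: ck; rewrite qn_vec.
  + apply: filterS (aer kap C r r0 C0 kb) => y H N; rewrite normrM; apply: ler_pM => //.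
    exact: Fline_le.
  + exact: Fline_int.
Qed.

Lemma dirder_pot_kn p j x : 2^-1 <= p -> 2 * p + 1 < m.+1%:R ->
  dirder (pot (kn 0 p)) j x (pot (kn1 0 p j) x).
Proof.
move=> p2 pm; have p0 : 0 <= p by lra.
apply: (@dirder_pot (fun e => kn e p) (fun e => kn1 e p j) j p (p + 2^-1) 1 (2 * p)); try assumption.
- exact: ler01.
- by rewrite mulr_ge0.
- lra.
- lra.
- lra.
- by move=> e; exact: measurable_kn.
- by move=> e; exact: measurable_kn1.
- by move=> e v e0 v0; rewrite mul1r ger0_norm ?kn_ge0.
- by move=> e v e0 v0; exact: norm_kn1_le.
- by move=> e v e0; exact: dirder_kn.
- by move=> v v0; exact: kn_cvg.
- by move=> v v0; exact: kn1_cvg.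
Qed.

(** [2 p + 2 < m.+1] is local integrability of the second derivatives, of size [|x|^(-2p-2)].
    Equality occurs for the Newtonian exponent [p = (m - 1) / 2], treated separately. *)
Lemma dirder_pot_kn1 p j x : 2^-1 <= p -> 2 * p + 2 < m.+1%:R ->
  dirder (pot (kn1 0 p j)) j x (pot (kn2 0 p j) x).
Proof.
move=> p2 pm; have p0 : 0 <= p by lra.
apply: (@dirder_pot (fun e => kn1 e p j) (fun e => kn2 e p j) j (p + 2^-1) (p + 1) (2 * p) (2 * p + 4 * p * (p + 1))); try assumption.
- by rewrite mulr_ge0.
- by rewrite addr_ge0 ?mulr_ge0// addr_ge0.
- lra.
- lra.
- lra.
- lra.
- by move=> e; exact: measurable_kn1.
- by move=> e; exact: measurable_kn2.
- by move=> e v e0 v0; exact: norm_kn1_le.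
- by move=> e v e0 v0; exact: norm_kn2_le.
- by move=> e v e0; exact: dirder_kn1.
- by move=> v v0; exact: kn1_cvg.
- by move=> v v0; exact: kn2_cvg.
Qed.

Lemma sum_pot_kn2 p x : 2^-1 <= p -> 2 * p + 2 < m.+1%:R ->
  \sum_j pot (kn2 0 p j) x =
  (4 * p * (p + 1) - 2 * p * m.+1%:R) * pot (kn 0 (p + 1)) x.
Proof.
move=> p2 pm; have p0 : 0 <= p by lra.
rewrite -Rintegral_sum; last first.
  move=> j; apply: (@integrable_pot (kn2 0 p j) x (p + 1) (2 * p + 4 * p * (p + 1))).
  - by rewrite addr_ge0 ?mulr_ge0// addr_ge0.
  - lra.
  - lra.
  - exact: measurable_kn2.
  - by move=> v v0; apply: norm_kn2_le => //; rewrite addr0.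
have I1 : mu.-integrable setT (fun y => (F (x - vec y) * kn 0 (p + 1) (vec y))%:E).
  apply: (@integrable_pot _ x (p + 1) 1) => //; try lra.
    exact: measurable_kn.
  by move=> v v0; rewrite mul1r ger0_norm ?kn_ge0.
rewrite -RintegralZl//; congr fine.
apply: ae_eq_integral => //.
- apply/measurable_EFinP; apply: measurable_sum => j; apply: measurable_funM => //; exact: measurable_kn2.
- apply/measurable_EFinP; apply: measurable_funM => //; apply: measurable_funM => //; exact: measurable_kn.
apply: filterS (@ae_tsq_gt0 R m) => y y0 _; congr EFin.
rewrite -mulr_sumr sum_kn2; last by rewrite addr0 qn_vec.
by rewrite natrD -natr1; ring.
Qed.

End potentials.

(** * Second derivatives of the Newtonian potential *)

Section newton_potential.
Context {R : realType}.
Local Notation Rb := (measurableTypeR R).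
Variables (m : nat) (F : 'rV[R]_(m + 1) -> R) (B al lam : R).
Hypotheses (B0 : 0 <= B) (al_gt : m%:R < 2 * al) (m2 : (2 <= m)%N).
Hypothesis lam0 : 0 < lam.
Hypothesis cF : continuous F.
Hypothesis Fb : forall x, `|F x| <= B * kn 1 al x.
Hypothesis holder : forall x j, exists2 A, 0 <= A & forall t v, `|t| < 1 -> qn v <= 1 ->
  `|F (x + t *: delta_mx 0 j - v) - F (x + t *: delta_mx 0 j)| <= A * qn v `^ (lam / 2).
Local Notation mu := (@lebm R m.+1).
Variable p : R.
Hypothesis pE : p = (m%:R - 1) / 2.

Let m2R : 2 <= m%:R :> R. Proof. by rewrite (ler_nat R 2 m). Qed.
Let p0 : 0 <= p. Proof. by rewrite pE; move: m2R; lra. Qed.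

Let al0 : 0 <= al. Proof. by move: m2R al_gt; lra. Qed.

Let mFx x : measurable_fun [set: m.+1.-tuple Rb] (fun y => F (x - vec y)).
Proof. by apply: measurable_vec_reflect; exact: measurable_continuous_vec. Qed.

Let mF : measurable_fun [set: m.+1.-tuple Rb] (fun y => F (vec y)).
Proof. exact: measurable_continuous_vec. Qed.

Let FB x : `|F x| <= B.
Proof.
apply: le_trans (Fb x) _; rewrite ler_piMr// /kn.
by rewrite -[leRHS](powRr0 (qn x + 1)) ler_powR ?oppr_le0// lerDr qn_ge0.
Qed.

Let eN_gt0 (N : nat) : 0 < N.+1%:R^-1 :> R. Proof. by rewrite invr_gt0. Qed.
Let eN_le1 (N : nat) : N.+1%:R^-1 <= 1 :> R. Proof. by rewrite invf_le1// ler1n. Qed.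

(** As [2 p + 2 = m + 1], a second derivative [kn2 e p j] is of borderline size [|v|^(-m-1)] at
    infinity too. The difference [D2] gains two powers there, so that for [e > 0] its integral
    converges absolutely. *)
Let D1 e j (v : 'rV[R]_(m + 1)) := kn1 e p j v - kn1 1 p j v.
Let D2 e j (v : 'rV[R]_(m + 1)) := kn2 e p j v - kn2 1 p j v.

Let mD1 e j : measurable_fun [set: m.+1.-tuple Rb] (fun y => D1 e j (vec y)).
Proof. by apply: measurable_funB; exact: measurable_kn1. Qed.

Let mD2 e j : measurable_fun [set: m.+1.-tuple Rb] (fun y => D2 e j (vec y)).
Proof. by apply: measurable_funB; exact: measurable_kn2. Qed.

Let c1 := 2 * p * (p + 1).
Let c2 := 2 * p * (p + 1) + 4 * p * (p + 1) * (p + 2).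
Let c2' := 2 * (2 * p + 4 * p * (p + 1)).

Let c1_ge0 : 0 <= c1. Proof. by rewrite !mulr_ge0 ?addr_ge0. Qed.
Let c2_ge0 : 0 <= c2. Proof. by rewrite addr_ge0 ?mulr_ge0 ?addr_ge0. Qed.
Let c2'_ge0 : 0 <= c2'. Proof. by rewrite mulr_ge0// addr_ge0 ?mulr_ge0// addr_ge0. Qed.

Let dD1 e j v : 0 < e -> dirder (D1 e j) j v (D2 e j v).
Proof.
by move=> e0; exact: (is_deriveB (dirder_kn1 p j v e0) (dirder_kn1 p j v ltr01)).
Qed.

Let D1_le e j v : 0 < e -> e <= 1 ->
  `|D1 e j v| <= c1 * e `^ (- (p + 1 + 2^-1)) * kn 1 (p + 1 + 2^-1) v.
Proof.
move=> e0 e1; apply: le_trans (norm_kn1B_le _ (ltW e0) e1 (qnD_gt0 _ e0) p0) _.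
by rewrite -[leRHS]mulrA ler_wpM2l// kn_bracket_le// !addr_ge0.
Qed.

Let D2_le e j v : 0 < e -> e <= 1 ->
  `|D2 e j v| <= c2 * e `^ (- (p + 2)) * kn 1 (p + 2) v.
Proof.
move=> e0 e1; apply: le_trans (norm_kn2B_le _ (ltW e0) e1 (qnD_gt0 _ e0) p0) _.
by rewrite -[leRHS]mulrA ler_wpM2l// kn_bracket_le// !addr_ge0.
Qed.

Let integrable_D2 e j : 0 < e -> e <= 1 -> mu.-integrable setT (fun y => (D2 e j (vec y))%:E).
Proof.
move=> e0 e1; apply: (@integrable_kn_bound R m _ (p + 2) (c2 * e `^ (- (p + 2)))) => //.
- by rewrite addr_ge0.
- by rewrite -[m.+1%:R]natr1 pE; lra.
- by move=> y; exact: D2_le.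
Qed.

(* By translation invariance [x |-> \int D1 (x - y) dy] is constant, and its
   derivative is the integral of [D2]. *)
Let integral_D2 e j : 0 < e -> e <= 1 -> \int[mu]_y D2 e j (vec y) = 0.
Proof.
move=> e0 e1.
have H := @dirder_conv R m (fun=> 1) (D1 e j) (D2 e j) j 0 (p + 1 + 2^-1) (p + 2) 1
  (c1 * e `^ (- (p + 1 + 2^-1))) (c2 * e `^ (- (p + 2))).
have {}H : dirder (fun x => \int[mu]_y (1 * D1 e j (vec y))) j 0 (\int[mu]_y (1 * D2 e j (vec y))).
  apply: H; try assumption.
  - exact: lexx.
  - by rewrite !addr_ge0.
  - by rewrite addr_ge0.
  - exact: ler01.
  - by rewrite mulr_ge0 ?powR_ge0.
  - by rewrite mulr_ge0 ?powR_ge0.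
  - by rewrite -[m.+1%:R]natr1 pE; lra.
  - by rewrite -[m.+1%:R]natr1 pE; lra.
  - exact: measurable_cst.
  - exact: mD1.
  - exact: mD2.
  - by move=> x; rewrite mul1r /kn oppr0 powRr0 normr1.
  - by move=> x; exact: D1_le.
  - by move=> x; exact: D2_le.
  - by move=> x; exact: dD1.
have {}H : is_derive (0 : R) (1 : R) (cst (\int[mu]_y (1 * D1 e j (vec y)))) (\int[mu]_y (1 * D2 e j (vec y))) by exact: H.
have [_] := H; rewrite derive_cst => E; rewrite E.
by apply: eq_Rintegral => y _; rewrite mul1r.
Qed.

Let line_cont x j v t : {for t, continuous (fun t : R => F (x + t *: delta_mx 0 j - v))}.
Proof.
apply: (@continuous_comp _ _ _ (fun t : R => x + t *: delta_mx 0 j - v) F); last exact: cF.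
apply: cvgB; last exact: cvg_cst.
by apply: cvgD; [exact: cvg_cst|apply: cvgZr_tmp; exact: cvg_id].
Qed.

Let line_cont0 x j t : {for t, continuous (fun t : R => F (x + t *: delta_mx 0 j))}.
Proof.
rewrite (_ : (fun t : R => _) = fun t : R => F (x + t *: delta_mx 0 j - 0)).
  exact: line_cont.
by apply/funext => s; rewrite subr0.
Qed.

Let integrable_FD2 e j x : 0 < e -> e <= 1 ->
  mu.-integrable setT (fun y => (F (x - vec y) * D2 e j (vec y))%:E).
Proof.
move=> e0 e1; apply: (@integrable_kn_bound R m _ (p + 2) (B * (c2 * e `^ (- (p + 2))))) => //.
- by rewrite addr_ge0.
- by rewrite -[m.+1%:R]natr1 pE; lra.
- exact: measurable_funM.
- move=> y; rewrite normrM -mulrA; apply: ler_pM => //; exact: D2_le.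
Qed.

(** [W] bounds the increment of [F], by the Hoelder condition near the origin and by boundedness far
    from it; [kb] bounds [D2] uniformly in [e], by [|y|^(-m-1)] near the origin and [|y|^(-m-3)] far
    away. The product is of size [|y|^(lam-m-1)] at the origin, integrable because [lam > 0]. *)
Let W (A : R) (y : m.+1.-tuple Rb) := (A + 2 * B) * Num.min 1 (tsq y `^ (lam / 2)).
Let kb (y : m.+1.-tuple Rb) := (c2 + c2') * Num.min (kn 0 (p + 1) (vec y)) (kn 0 (p + 2) (vec y)).

Let D2_le_kb : {ae mu, forall y, forall e j, 0 <= e -> e <= 1 -> `|D2 e j (vec y)| <= kb y}.
Proof.
apply: filterS (@ae_tsq_gt0 R m) => y y0 e j e0 e1.
have q0 : 0 < qn (vec y) by rewrite qn_vec.
have qe : 0 < qn (vec y) + e by rewrite ltr_pwDl.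
have p1 : 0 <= p + 1 by rewrite addr_ge0.
have p2 : 0 <= p + 2 by rewrite addr_ge0.
have h1 : `|D2 e j (vec y)| <= c2 * kn 0 (p + 2) (vec y).
  apply: le_trans (norm_kn2B_le _ e0 e1 qe p0) _; apply: ler_wpM2l => //; exact: kn_le0.
have h2 : `|D2 e j (vec y)| <= c2' * kn 0 (p + 1) (vec y).
  have c0 : 0 <= 2 * p + 4 * p * (p + 1) by rewrite addr_ge0 ?mulr_ge0.
  apply: le_trans (ler_normB _ _) _; rewrite /c2' mulr_natl mulr2n mulrDl.
  apply: lerD.
    apply: le_trans (norm_kn2_le _ e0 qe p0) _; apply: ler_wpM2l => //; exact: kn_le0.
  apply: le_trans (norm_kn2_le _ ler01 (qnD_gt0 _ ltr01) p0) _; apply: ler_wpM2l => //; exact: kn_le0.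
have cc : 0 <= c2 + c2' by rewrite addr_ge0.
rewrite /kb (minr_pMr _ _ cc) le_min; apply/andP; split.
  by apply: le_trans h2 _; rewrite ler_wpM2r ?kn_ge0// lerDr.
by apply: le_trans h1 _; rewrite ler_wpM2r ?kn_ge0// lerDl.
Qed.

Let mW A : measurable_fun [set: m.+1.-tuple Rb] (W A).
Proof.
apply: measurable_funM => //; apply: measurable_minr => //.
by apply: (measurableT_comp (measurable_powR _)); exact: measurable_tsq.
Qed.

Let integrable_Wkb A : 0 <= A -> mu.-integrable setT (fun y => (W A y * kb y)%:E).
Proof.
move=> A0; have C0 : 0 <= A + 2 * B by rewrite addr_ge0// mulr_ge0.
have cc0 : 0 <= c2 + c2' by rewrite addr_ge0.
have mn0 (a b : R) : 0 <= a -> 0 <= b -> 0 <= Num.min a b by move=> *; rewrite le_min; apply/andP.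
apply: (@integrable_powR_bound R m _ (p + 1 - lam / 2) (p + 2) ((A + 2 * B) * (c2 + c2'))).
- by rewrite mulr_ge0.
- by rewrite -[m.+1%:R]natr1 pE; move: lam0; lra.
- by rewrite -[m.+1%:R]natr1 pE; lra.
- apply: measurable_funM => //; apply: measurable_funM => //.
  by apply: measurable_minr; exact: measurable_kn.
- move=> y y0 y1.
  rewrite ger0_norm; last by rewrite /W /kb !mulr_ge0 ?mn0 ?powR_ge0 ?kn_ge0.
  rewrite /W /kb mulrACA ler_wpM2l ?mulr_ge0//.
  apply: (@le_trans _ _ (tsq y `^ (lam / 2) * kn 0 (p + 1) (vec y))).
    by apply: ler_pM; rewrite ?mn0 ?powR_ge0 ?kn_ge0// ge_min lexx ?orbT.
  rewrite /kn qn_vec addr0 -powRD ?(gt_eqF y0) ?implybT//.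
  by rewrite (_ : lam / 2 + - (p + 1) = - (p + 1 - lam / 2))//; ring.
- move=> y y1; have y0 : 0 < tsq y by exact: lt_le_trans y1.
  rewrite ger0_norm; last by rewrite /W /kb !mulr_ge0 ?mn0 ?powR_ge0 ?kn_ge0.
  rewrite /W /kb mulrACA ler_wpM2l ?mulr_ge0//.
  apply: (@le_trans _ _ (1 * kn 0 (p + 2) (vec y))).
    by apply: ler_pM; rewrite ?mn0 ?powR_ge0 ?kn_ge0// ge_min lexx ?orbT.
  by rewrite mul1r /kn qn_vec addr0.
Qed.

Let Phi_le x j A : (forall t v, `|t| < 1 -> qn v <= 1 ->
  `|F (x + t *: delta_mx 0 j - v) - F (x + t *: delta_mx 0 j)| <= A * qn v `^ (lam / 2)) ->
  0 <= A -> forall t y, `|t| < 1 ->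
  `|F (x + t *: delta_mx 0 j - vec y) - F (x + t *: delta_mx 0 j)| <= W A y.
Proof.
move=> hA A0 t y t1; have B2 : 0 <= 2 * B by rewrite mulr_ge0.
rewrite /W minr_pMr ?addr_ge0// le_min mulr1.
have hB : `|F (x + t *: delta_mx 0 j - vec y) - F (x + t *: delta_mx 0 j)| <= 2 * B.
  by rewrite mulr_natl mulr2n (le_trans (ler_normB _ _))// lerD.
apply/andP; split; first by apply: le_trans hB _; rewrite lerDr.
have [y1|/ltW y1] := leP (tsq y) 1.
  apply: (le_trans (hA t (vec y) t1 _)); first by rewrite qn_vec.
  by rewrite qn_vec ler_wpM2r ?powR_ge0// lerDl.
apply: le_trans hB _; rewrite -[leLHS]mulr1; apply: ler_pM => //.
  by rewrite lerDr.
by rewrite -[leLHS](powRr0 (tsq y)) ler_powR// ltW// divr_gt0.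
Qed.

(** Splits [kn1 0 = kn1 1 + D1 0]. The first part has no singularity and falls under [dirder_conv];
    the second is the limit of [D1 (1/(N+1))], whose derivatives are written with the increment of
    [F] and dominated by [W A] times [kb]. *)
Lemma dirder_pot_newton j x : dirder (pot F (kn1 0 p j)) j x
  (pot F (kn2 1 p j) x +
    \int[mu]_y ((F (x - vec y) - F x) * (kn2 0 p j (vec y) - kn2 1 p j (vec y)))).
Proof.
rewrite -[X in dirder _ _ _ X]/(pot F (kn2 1 p j) x +
  \int[mu]_y ((F (x - vec y) - F x) * D2 0 j (vec y))).
have p1 : 0 <= p + 1 by rewrite addr_ge0.
have H1 : dirder (pot F (kn1 1 p j)) j x (pot F (kn2 1 p j) x).
  apply: (@dirder_conv R m F _ _ j al (p + 2^-1) (p + 1) B (2 * p) (2 * p + 4 * p * (p + 1))); try assumption.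
  - by rewrite addr_ge0.
  - by rewrite mulr_ge0.
  - by rewrite addr_ge0 ?mulr_ge0.
  - by rewrite -[m.+1%:R]natr1 ?pE; move: al_gt m2R; lra.
  - by rewrite -[m.+1%:R]natr1 ?pE; move: al_gt m2R; lra.
  - exact: measurable_kn1.
  - exact: measurable_kn2.
  - by move=> v; exact: (norm_kn1_le j ler01 (qnD_gt0 v ltr01) p0).
  - by move=> v; exact: (norm_kn2_le j ler01 (qnD_gt0 v ltr01) p0).
  - by move=> v; exact: dirder_kn1.
have [A A0 hA] := holder x j.
have H2 : dirder (pot F (D1 0 j)) j x (\int[mu]_y ((F (x - vec y) - F x) * D2 0 j (vec y))).
  rewrite /dirder.
  have -> : \int[mu]_y ((F (x - vec y) - F x) * D2 0 j (vec y)) =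
     \int[mu]_y ((F (x + 0 *: delta_mx 0 j - vec y) - F (x + 0 *: delta_mx 0 j)) * D2 0 j (vec y)).
    by rewrite scale0r addr0.
  apply: (@is_derive_integral_limit _ _ _ mu
    (fun t y => F (x + t *: delta_mx 0 j - vec y) - F (x + t *: delta_mx 0 j))
    (fun N y => D2 N.+1%:R^-1 j (vec y)) (fun y => D2 0 j (vec y)) (W A) kb
    (fun N t => pot F (D1 N.+1%:R^-1 j) (x + t *: delta_mx 0 j))).
  - by move=> t _; apply: measurable_funB.
  - by move=> N.
  - by [].
  - exact: mW.
  - by move=> t y t1; exact: Phi_le.
  - by apply: filterS D2_le_kb => y H N; apply: H; rewrite ?(ltW (eN_gt0 N)) ?eN_le1.
  - apply: filterS (@ae_tsq_gt0 R m) => y y0; apply: cvgB; last exact: cvg_cst.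
    by apply: kn2_cvg; rewrite qn_vec.
  - exact: integrable_Wkb.
  - by move=> t y t1; apply: cvgB; [exact: line_cont|exact: line_cont0].
  - move=> N t t1; have e0 := eN_gt0 N; have e1 := eN_le1 N.
    set xt := x + t *: _.
    (* The subtracted value [F xt] moves with [t] but is constant in [y], so [integral_D2] removes
       it. *)
    have -> : \int[mu]_y ((F (xt - vec y) - F xt) * D2 N.+1%:R^-1 j (vec y)) = pot F (D2 N.+1%:R^-1 j) xt.
      under eq_Rintegral do rewrite mulrBl.
      rewrite RintegralB//; last 2 first.
      + exact: integrable_FD2.
      + exact: (integrableZl measurableT (F xt) (integrable_D2 j e0 e1)).
      by rewrite RintegralZl//; [rewrite integral_D2// mulr0 subr0|exact: integrable_D2].
    apply: (@dirder_line R _ (pot F (D1 N.+1%:R^-1 j)) (pot F (D2 N.+1%:R^-1 j)) j x t).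
    apply: (@dirder_conv R m F _ _ j al (p + 1 + 2^-1) (p + 2) B
      (c1 * N.+1%:R^-1 `^ (- (p + 1 + 2^-1))) (c2 * N.+1%:R^-1 `^ (- (p + 2)))); try assumption.
    + by rewrite !addr_ge0.
    + by rewrite addr_ge0.
    + by rewrite mulr_ge0 ?powR_ge0.
    + by rewrite mulr_ge0 ?powR_ge0.
    + by rewrite -[m.+1%:R]natr1 ?pE; move: al_gt m2R; lra.
    + by rewrite -[m.+1%:R]natr1 ?pE; move: al_gt m2R; lra.
    + exact: mD1.
    + exact: mD2.
    + by move=> v; exact: D1_le.
    + by move=> v; exact: D2_le.
    + by move=> v; exact: dD1.
  - move=> t t1.
    have Ik (e : R) : 0 <= e -> mu.-integrable setT (fun y => (F (x + t *: delta_mx 0 j - vec y) * kn1 e p j (vec y))%:E).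
      move=> e0; apply: (@integrable_pot R m F B al B0 al_gt cF Fb (kn1 e p j) _ (p + 2^-1) (2 * p)).
      + by rewrite mulr_ge0.
      + by rewrite pE; move: m2R; lra.
      + by rewrite -[m.+1%:R]natr1 pE; lra.
      + exact: measurable_kn1.
      + move=> v v0; apply: le_trans (norm_kn1_le _ e0 _ p0) _; first by rewrite ltr_pwDl.
        by rewrite ler_wpM2l ?mulr_ge0// kn_le0// addr_ge0.
    have E e : 0 <= e -> pot F (D1 e j) (x + t *: delta_mx 0 j) =
       pot F (kn1 e p j) (x + t *: delta_mx 0 j) - pot F (kn1 1 p j) (x + t *: delta_mx 0 j).
      by move=> e0; rewrite /pot -RintegralB ?Ik//; apply: eq_Rintegral => y _; rewrite mulrBr.
    rewrite E//.
    under eq_fun => N do rewrite E ?(ltW (eN_gt0 N))//.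
    apply: cvgB; last exact: cvg_cst.
    apply: (cvg_Rintegral (g := fun y => `|F (x + t *: delta_mx 0 j - vec y) * (2 * p * kn 0 (p + 2^-1) (vec y))|)).
    + by move=> N; apply: measurable_funM => //; exact: measurable_kn1.
    + by apply: measurable_funM => //; exact: measurable_kn1.
    + apply: filterS (@ae_tsq_gt0 R m) => y y0; apply: cvgM; first exact: cvg_cst.
      by apply: kn1_cvg; rewrite qn_vec.
    + apply: filterS (@ae_tsq_gt0 R m) => y y0 N.
      rewrite normrM [leRHS]normrM ler_wpM2l//.
      rewrite [leRHS]ger0_norm ?mulr_ge0 ?kn_ge0//.
      apply: le_trans (norm_kn1_le _ (ltW (eN_gt0 N)) (qnD_gt0 _ (eN_gt0 N)) p0) _.
      by rewrite ler_wpM2l ?mulr_ge0// kn_le0 ?qn_vec ?addr_ge0// ltW.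
    + suff I : mu.-integrable setT
        (fun y => (F (x + t *: delta_mx 0 j - vec y) * (2 * p * kn 0 (p + 2^-1) (vec y)))%:E).
        exact: (integrable_abse I).
      apply: (@integrable_pot R m F B al B0 al_gt cF Fb (fun v => 2 * p * kn 0 (p + 2^-1) v) _ (p + 2^-1) (2 * p)).
      * by rewrite mulr_ge0.
      * by rewrite pE; move: m2R; lra.
      * by rewrite -[m.+1%:R]natr1 pE; lra.
      * by apply: measurable_funM => //; exact: measurable_kn.
      * by move=> v v0; rewrite ger0_norm ?mulr_ge0 ?kn_ge0.
have Ik (e : R) z : 0 <= e -> mu.-integrable setT (fun y => (F (z - vec y) * kn1 e p j (vec y))%:E).
  move=> e0; apply: (@integrable_pot R m F B al B0 al_gt cF Fb (kn1 e p j) _ (p + 2^-1) (2 * p)).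
  + by rewrite mulr_ge0.
  + by rewrite pE; move: m2R; lra.
  + by rewrite -[m.+1%:R]natr1 pE; lra.
  + exact: measurable_kn1.
  + move=> v v0; apply: le_trans (norm_kn1_le _ e0 _ p0) _; first by rewrite ltr_pwDl.
    by rewrite ler_wpM2l ?mulr_ge0// kn_le0// addr_ge0.
have := is_deriveD H1 H2; rewrite /dirder; congr (is_derive _ _ _ _).
apply/funext => t.
transitivity (pot F (kn1 1 p j) (x + t *: delta_mx 0 j) + pot F (D1 0 j) (x + t *: delta_mx 0 j)) => //.
rewrite /pot -RintegralD//.
- by apply: eq_Rintegral => y _; rewrite -mulrDr /D1 addrCA subrr addr0.
- exact: Ik.
- have := integrableB measurableT (Ik 0 (x + t *: delta_mx 0 j) (lexx _)) (Ik 1 (x + t *: delta_mx 0 j) ler01).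
  by congr (mu.-integrable _ _); apply/funext => y /=; rewrite -EFinB -mulrBr.
Qed.

(* [kn2 0 - kn2 1] sums to minus the Laplacian of the mollified kernel, so the
   two integrals differ by [F x] times the total mass of the latter. *)
Lemma sum_pot_newton x :
  \sum_j (pot F (kn2 1 p j) x +
    \int[mu]_y ((F (x - vec y) - F x) * (kn2 0 p j (vec y) - kn2 1 p j (vec y)))) =
  - (4 * p * (p + 1) * \int[mu]_y kn 1 (p + 2) (vec y)) * F x.
Proof.
have p1 : 0 <= p + 1 by rewrite addr_ge0.
have p2 : 0 <= p + 2 by rewrite addr_ge0.
(* Harmonicity of [|x|^(-2p)] away from the origin in dimension [m + 1]. *)
have cE : 4 * p * (p + 1) - 2 * p * (m + 1)%N%:R = 0 by rewrite natrD pE; field.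
have I1 j : mu.-integrable setT (fun y => (F (x - vec y) * kn2 1 p j (vec y))%:E).
  (* The natural exponent [p + 1] violates [2 r < m.+1]. It is weakened to [p + 2^-1], which costs
     nothing at the origin because [kn2 1] is bounded there. *)
  apply: (@integrable_pot R m F B al B0 al_gt cF Fb (kn2 1 p j) x (p + 2^-1) (2 * p + 4 * p * (p + 1))).
  - by rewrite addr_ge0 ?mulr_ge0.
  - by rewrite pE; move: m2R; lra.
  - by rewrite -[m.+1%:R]natr1 pE; lra.
  - exact: measurable_kn2.
  - move=> v v0; apply: le_trans (norm_kn2_le _ ler01 (qnD_gt0 _ ltr01) p0) _.
    rewrite ler_wpM2l ?addr_ge0 ?mulr_ge0//.
    apply: (@le_trans _ _ (kn 1 (p + 2^-1) v)); last by rewrite kn_le0 ?addr_ge0.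
    by rewrite /kn ler_powR ?lerDr ?qn_ge0// lerN2 lerD2l; lra.
have I2 j : mu.-integrable setT (fun y => ((F (x - vec y) - F x) * (kn2 0 p j (vec y) - kn2 1 p j (vec y)))%:E).
  have [A A0 hA] := holder x j.
  have := integrable_Wkb A0 => /integrableP[mWk iWk]; apply/integrableP; split.
    by apply/measurable_EFinP; apply: measurable_funM; [exact: measurable_funB|exact: mD2].
  apply: le_lt_trans iWk; apply: ae_ge0_le_integral => //.
  - apply: measurableT_comp => //; apply/measurable_EFinP.
    by apply: measurable_funM; [exact: measurable_funB|exact: mD2].
  - exact: measurableT_comp.
  apply: filterS D2_le_kb => y H _; rewrite lee_fin normrM [leRHS]normrM.
  apply: ler_pM => //; apply: le_trans (ler_norm _).
    by have := Phi_le hA A0 y; move=> /(_ 0); rewrite scale0r addr0 normr0 => /(_ ltr01).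
  exact: H.
have I3 : mu.-integrable setT (fun y => (kn 1 (p + 2) (vec y))%:E).
  by apply: integrable_kn => //; rewrite -natr1 pE; lra.
rewrite big_split /= -Rintegral_sum// -Rintegral_sum// -RintegralD//; last 2 first.
- exact: integrable_sum_fin.
- exact: integrable_sum_fin.
rewrite -mulNr mulrAC -RintegralZl//; congr fine.
apply: ae_eq_integral => //.
- apply/measurable_EFinP; apply: measurable_funD; apply: measurable_sum => j.
    by apply: measurable_funM => //; exact: measurable_kn2.
  by apply: measurable_funM; [exact: measurable_funB|exact: mD2].
- by apply/measurable_EFinP; apply: measurable_funM => //; exact: measurable_kn.
apply: filterS (@ae_tsq_gt0 R m) => y y0 _; congr EFin.
have q0 : 0 < qn (vec y) + 0 by rewrite addr0 qn_vec.
rewrite -!mulr_sumr sumrB (sum_kn2 p q0) (sum_kn2 p (qnD_gt0 _ ltr01)).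
by rewrite cE; ring.
Qed.

End newton_potential.

(** * The composition of the two Radon transforms *)

Section radon_representation.
Context {R : realType}.
Local Notation Rb := (measurableTypeR R).
Variables (k : nat).
Local Notation m := k.+1.
Local Notation mu := (@lebm R m).
Variable (p : R).
Hypothesis pE : p = m%:R / 2.
Variables (l : m.-tuple Rb -> 'I_m -> R) (x0 : m.-tuple Rb) (t0 : R).
Hypothesis ml : forall i, measurable_fun [set: m.-tuple Rb] (fun x => l x i).
Hypothesis lsqE : forall x, 4 * lsq (l x) = \sum_(i < m) (tnth x i - tnth x0 i) ^+ 2.

Let v0 : 'rV[R]_(m + 1) := vec (tcons (x0, t0)).

Let mlw : measurable_fun [set: m.-tuple Rb * m.-tuple Rb]
  (fun z => tdot (l z.2) z.1).
Proof.
apply: measurable_sum => i; apply: measurable_funM.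
  by apply: (measurableT_comp (ml i)).
apply: (measurableT_comp (f := fun x : m.-tuple Rb => tnth x i)) => //.
exact: measurable_tnth.
Qed.

Lemma qn_sub_tcons x s :
  qn (v0 - vec (tcons (x, s))) = 4 * lsq (l x) + (t0 - s) ^+ 2.
Proof.
have E j : (v0 - vec (tcons (x, s))) 0 j = vec (tcons (x0, t0)) 0 j - vec (tcons (x, s)) 0 j.
  by rewrite mxE [X in _ + X]mxE.
rewrite lsqE /qn big_split_ord /= big_ord1 E !vec_rshift !tnth0; congr (_ + _).
by apply: eq_bigr => i _; rewrite E !vec_lshift !tnthS -sqrrN opprB.
Qed.

Lemma measurable_vec_comp d (T : measurableType d) (F : 'rV[R]_(m + 1) -> R)
   (f : T -> m.-tuple Rb) (g : T -> R) : continuous F ->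
  measurable_fun setT f -> measurable_fun setT g ->
  measurable_fun setT (fun x => F (vec (tcons (f x, g x)))).
Proof.
move=> cF mf mg.
apply: (measurableT_comp (f := fun y : m.+1.-tuple Rb => F (vec y))).
  exact: measurable_continuous_vec.
apply: (measurableT_comp (f := @tcons R m)); first exact: measurable_tcons.
exact: measurable_fun_pair.
Qed.

Let ae_lsq_gt0 : {ae mu, forall x, 0 < lsq (l x)}.
Proof.
have := @negligible_coord R k (tnth x0 ord0); apply: negligibleS => x /=.
apply: contra_notP => /eqP xx; rewrite -(pmulr_rgt0 _ (ltr0n R 4)) lsqE.
rewrite (bigD1 ord0)//= ltr_pwDl//; last by apply: sumr_ge0 => i _; exact: sqr_ge0.
by rewrite lt_neqAle sqr_ge0 eq_sym sqrf_eq0 subr_eq0 xx.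
Qed.

Section nonnegative.
Variable G : 'rV[R]_(m + 1) -> R.
Hypotheses (G0 : forall v, 0 <= G v) (cG : continuous G).

Let slice (x : m.-tuple Rb) (s : R) : R := G (vec (tcons (x, s))).

Let mPsi : measurable_fun [set: m.-tuple Rb * m.-tuple Rb]
  (fun z => (slice z.2 (t0 - tdot (l z.2) z.1) * (4 + tsq z.1) `^ (- p))%:E).
Proof.
apply/measurable_EFinP; apply: measurable_funM.
  by apply: measurable_vec_comp; [exact: cG|exact: measurable_snd|exact: measurable_funB].
apply: (measurableT_comp (f := fun x : m.-tuple Rb => (4 + tsq x) `^ (- p))) => //.
exact: measurable_tsq_powR.
Qed.

Let mK : measurable_fun [set: m.+1.-tuple Rb] (fun y => (G (vec y) * kn 0 2^-1 (v0 - vec y))%:E).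
Proof.
apply/measurable_EFinP; apply: measurable_funM; first exact: measurable_continuous_vec.
by apply: measurable_vec_reflect; exact: measurable_kn.
Qed.

(** For almost every [x] the slope [l x] is nonzero and [integral_ridge] evaluates the integral in
    [w]. With [p = m / 2] the remaining exponent is [k / 2 - p = - 1/2], and the powers combine into
    [(4 |l x|^2 + s^2)^(-1/2)]. By [lsqE], the only fact used about the length of [l x], this is the
    inverse distance from [(x, t0 - s)] to [(x0, t0)]. *)
Lemma ge0_radon_rep :
  (\int[mu]_w \int[mu]_x (slice x (t0 - tdot (l x) w) * (4 + tsq w) `^ (- p))%:E =
   (cauchy_prod k p)%:E *
     \int[@lebm R m.+1]_y (G (vec y) * kn 0 2^-1 (v0 - vec y))%:E)%E.
Proof.
pose Psi (z : m.-tuple Rb * m.-tuple Rb) : \bar R :=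
  (slice z.2 (t0 - tdot (l z.2) z.1) * (4 + tsq z.1) `^ (- p))%:E.
have Psi0 z : (0 <= Psi z)%E by rewrite lee_fin; apply: mulr_ge0; [exact: G0|exact: powR_ge0].
transitivity (\int[mu]_w \int[mu]_x Psi (w, x))%E; first by [].
rewrite (fubini_tonelli Psi)//.
pose K (z : m.-tuple Rb * Rb) : \bar R :=
  (G (vec (tcons z)) * kn 0 2^-1 (v0 - vec (tcons z)))%:E.
have mKt : measurable_fun setT K.
  apply: (measurableT_comp (f := fun y : m.+1.-tuple Rb => (G (vec y) * kn 0 2^-1 (v0 - vec y))%:E)) => //.
  exact: measurable_tcons.
have K0 z : (0 <= K z)%E by rewrite lee_fin mulr_ge0 ?kn_ge0.
rewrite integral_lebS//; last by move=> y; rewrite lee_fin mulr_ge0 ?kn_ge0.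
rewrite -[X in _ = (_ * X)%E](fubini_tonelli K)//.
rewrite -ge0_integralZl_EFin//; last 3 first.
- by move=> x _; apply: integral_ge0.
- exact: (measurable_fun_fubini_tonelli_F K).
- exact: cauchy_prod_ge0.
apply: ge0_ae_eq_integral => //.
- exact: (measurable_fun_fubini_tonelli_G Psi).
- by apply: measurable_funeM; exact: (measurable_fun_fubini_tonelli_F K).
- by move=> x _; apply: integral_ge0.
- by move=> x _; rewrite mule_ge0 ?lee_fin ?cauchy_prod_ge0//; apply: integral_ge0.
apply: filterS ae_lsq_gt0 => x lx _.
have mH : measurable_fun setT (fun s : R => slice x (t0 - s)).
  by apply: measurable_vec_comp => //; exact: measurable_funB.
have pk : k%:R + 1 <= 2 * p by rewrite pE -[k.+1%:R]natr1; lra.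
rewrite /Psi /= (@integral_ridge R k (l x) p 4 (fun s : R => slice x (t0 - s)) _ lx pk mH)//.
rewrite EFinM -muleA; congr (_ * _)%E.
rewrite -ge0_integralZl_EFin//; last 3 first.
- by move=> s _; rewrite lee_fin; apply: mulr_ge0; [exact: G0|exact: powR_ge0].
- exact: measurable_ridge0.
- exact: powR_ge0.
have mKx : measurable_fun setT (fun s => K (x, s)).
  by apply: measurableT_comp => //; exact: measurable_fun_pair.
have := @integral_affine R (fun s => K (x, s)) (- 1) t0.
rewrite normrN normr1 invr1 mul1e => <-//.
apply: eq_integral => s _; rewrite -EFinM /K mulN1r (addrC (- s)); congr EFin.
rewrite mulrCA; congr (_ * _).
rewrite /kn addr0 qn_sub_tcons opprB addrCA subrr addr0.
have -> : k%:R / 2 - p = - 2^-1 by rewrite pE -[k.+1%:R]natr1; field.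
rewrite -powRM ?(ltW lx)//; last by rewrite addr_ge0// divr_ge0 ?sqr_ge0 ?(ltW lx).
by congr (_ `^ _); field; rewrite gt_eqF.
by move=> s; exact: G0.
Qed.
End nonnegative.

Section signed.
Variables (F : 'rV[R]_(m + 1) -> R) (B al : R).
Hypotheses (B0 : 0 <= B) (al_gt : m%:R < 2 * al).
Hypothesis cF : continuous F.
Hypothesis Fb : forall v, `|F v| <= B * kn 1 al v.

Let al0 : 0 <= al.
Proof. by have : 0 <= m%:R :> R by []; move: al_gt; lra. Qed.

(** The bound discards the last coordinate, so it holds on any measurable graph over R^m, where
    [m < 2 al] is enough decay. *)
Lemma integrable_slice (h : m.-tuple Rb -> R) : measurable_fun setT h ->
  mu.-integrable setT (fun x => (F (vec (tcons (x, h x))))%:E).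
Proof.
move=> mh; apply: (@integrable_decay R k _ al 0 B) => //; rewrite ?mulr0 ?addr0//.
  exact: measurable_vec_comp.
move=> y y0; rewrite oppr0 powRr0 mulr1; apply: le_trans (Fb _) _.
rewrite ler_wpM2l// /kn qn_vec tsq_cons; apply: powR_antitone; rewrite ?oppr_le0//.
  by rewrite addr_gt0.
by rewrite lerD2r lerDr sqr_ge0.
Qed.
End signed.

Section signed_rep.
Variables (F : 'rV[R]_(m + 1) -> R) (B al : R).
Hypotheses (B0 : 0 <= B) (al_gt : m%:R < 2 * al).
Hypothesis cF : continuous F.
Hypothesis Fb : forall v, `|F v| <= B * kn 1 al v.

Let I (H : 'rV[R]_(m + 1) -> R) w := \int[mu]_x H (vec (tcons (x, t0 - tdot (l x) w))).

Let mh w : measurable_fun [set: m.-tuple Rb] (fun x => t0 - tdot (l x) w).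
Proof.
apply: measurable_funB => //; apply: measurable_sum => i.
by apply: measurable_funM.
Qed.

(** Integrability in [w] is read off from the finiteness of the potential on the right of
    [ge0_radon_rep], without any bound on the decay of [I G]. *)
Let ge0_rep (G : 'rV[R]_(m + 1) -> R) : (forall v, 0 <= G v) -> continuous G ->
  (forall v, `|G v| <= B * kn 1 al v) ->
  mu.-integrable setT (fun w => (I G w * (4 + tsq w) `^ (- p))%:E) /\
  \int[mu]_w (I G w * (4 + tsq w) `^ (- p)) = cauchy_prod k p * pot G (kn 0 2^-1) v0.
Proof.
move=> G0 cG Gb.
have IE w : (\int[mu]_x (G (vec (tcons (x, t0 - tdot (l x) w))) * (4 + tsq w) `^ (- p))%:E =
   (I G w * (4 + tsq w) `^ (- p))%:E)%E.
  under eq_integral do rewrite EFinM.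
  have iG := integrable_slice B0 al_gt cG Gb (mh w).
  rewrite ge0_integralZr//.
  - by rewrite EFinM /I /Rintegral fineK//; exact: (integrable_fin_num measurableT iG).
  - by have /integrableP[] := iG.
  - by move=> x _; rewrite lee_fin.
  - by rewrite lee_fin powR_ge0.
have H : (\int[mu]_w (I G w * (4 + tsq w) `^ (- p))%:E =
   (cauchy_prod k p)%:E * \int[@lebm R m.+1]_y (G (vec y) * kn 0 2^-1 (v0 - vec y))%:E)%E.
  by rewrite -(ge0_radon_rep G0 cG); apply: eq_integral => w _; rewrite IE.
have potI : (@lebm R m.+1).-integrable setT (fun y => (G (vec y) * kn 0 2^-1 (v0 - vec y))%:E).
  have i1 : (@lebm R m.+1).-integrable setT (fun y => (G (v0 - vec y) * kn 0 2^-1 (vec y))%:E).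
    apply: (@integrable_pot R m G B al B0 al_gt cG Gb (kn 0 2^-1) v0 2^-1 1) => //.
    - by rewrite mulfV// ltr1n.
    - exact: measurable_kn.
    - by move=> v _; rewrite mul1r ger0_norm ?kn_ge0.
  have := @integrable_vec_reflect R m (fun v => (G (v0 - v) * kn 0 2^-1 v)%:E) v0 i1.
  congr (_.-integrable _ _).
  by apply/funext => y; rewrite opprB addrCA subrr addr0.
have potE : (\int[@lebm R m.+1]_y (G (vec y) * kn 0 2^-1 (v0 - vec y))%:E =
   (pot G (kn 0 2^-1) v0)%:E)%E.
  rewrite /pot Rintegral_reflectM//.
  - by rewrite /Rintegral fineK//; exact: (integrable_fin_num measurableT potI).
  - exact: measurable_continuous_vec.
  - exact: measurable_kn.
rewrite potE -EFinM in H.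
have I0 w : 0 <= I G w * (4 + tsq w) `^ (- p).
  by rewrite mulr_ge0 ?powR_ge0//; apply: Rintegral_ge0.
split; last by rewrite /Rintegral H.
apply/integrableP; split; last first.
  under eq_integral => w _ do rewrite gee0_abs ?lee_fin//.
  by rewrite H ltry.
rewrite (_ : (fun w => _) = (fun w => \int[mu]_x (G (vec (tcons (x, t0 - tdot (l x) w))) * (4 + tsq w) `^ (- p))%:E)%E).
  apply: (measurable_fun_fubini_tonelli_F (fun z : m.-tuple Rb * m.-tuple Rb =>
    (G (vec (tcons (z.2, t0 - tdot (l z.2) z.1))) * (4 + tsq z.1) `^ (- p))%:E)).
    apply/measurable_EFinP; apply: measurable_funM.
      by apply: measurable_vec_comp; [exact: cG|exact: measurable_snd|exact: measurable_funB].
    apply: (measurableT_comp (f := fun x : m.-tuple Rb => (4 + tsq x) `^ (- p))) => //.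
    exact: measurable_tsq_powR.
  by move=> z; rewrite lee_fin mulr_ge0 ?powR_ge0.
by apply/funext => w; rewrite IE.
Qed.

Let continuous_max (G : 'rV[R]_(m + 1) -> R) : continuous G -> continuous (fun v => Num.max (G v) 0).
Proof.
move=> cG v.
apply: (@continuous_comp _ _ _ G (fun y : R => Num.max y 0)); first exact: cG.
rewrite (_ : (fun y => _) = (fun y : R => (y + 0 + `|y - 0|) / 2)).
  apply: cvgM; last exact: cvg_cst.
  apply: cvgD; first by apply: cvgD; [exact: cvg_id|exact: cvg_cst].
  by apply: cvg_norm; apply: cvgB; [exact: cvg_id|exact: cvg_cst].
by apply/funext => y; rewrite maxr_absE.
Qed.

Let max_bound (G : 'rV[R]_(m + 1) -> R) v : `|G v| <= B * kn 1 al v ->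
  `|Num.max (G v) 0| <= B * kn 1 al v.
Proof.
apply: le_trans; have [h|h] := leP (G v) 0; last by [].
by rewrite normr0.
Qed.

Lemma radon_rep :
  mu.-integrable setT (fun w => (I F w * (4 + tsq w) `^ (- p))%:E) /\
  \int[mu]_w (I F w * (4 + tsq w) `^ (- p)) = cauchy_prod k p * pot F (kn 0 2^-1) v0.
Proof.
pose Fp v := Num.max (F v) 0; pose Fn v := Num.max (- F v) 0.
have cNF : continuous (fun v => - F v) by move=> v; apply: (@continuous_comp _ _ _ F -%R); [exact: cF|exact: opp_continuous].
have NFb v : `|- F v| <= B * kn 1 al v by rewrite normrN.
have FE v : F v = Fp v - Fn v.
  rewrite /Fp /Fn; have [h|h] := leP (F v) 0.
    by rewrite sub0r max_l ?opprK// oppr_ge0.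
  by rewrite max_r ?subr0// oppr_le0 ltW.
have Fp0 v : 0 <= Fp v by rewrite le_max lexx orbT.
have Fn0 v : 0 <= Fn v by rewrite le_max lexx orbT.
have cFp : continuous Fp by exact: continuous_max.
have cFn : continuous Fn by exact: (continuous_max cNF).
have Fpb v : `|Fp v| <= B * kn 1 al v by exact: max_bound.
have Fnb v : `|Fn v| <= B * kn 1 al v by exact: (@max_bound (fun v => - F v)).
have [ip Ep] := ge0_rep Fp0 cFp Fpb.
have [in_ En] := ge0_rep Fn0 cFn Fnb.
have IE w : I F w * (4 + tsq w) `^ (- p) =
    I Fp w * (4 + tsq w) `^ (- p) - I Fn w * (4 + tsq w) `^ (- p).
  rewrite -mulrBl; congr (_ * _); rewrite /I -RintegralB//.
  - by apply: eq_Rintegral => x _.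
  - exact: (integrable_slice B0 al_gt cFp Fpb (mh w)).
  - exact: (integrable_slice B0 al_gt cFn Fnb (mh w)).
split.
  have := integrableB measurableT ip in_; congr (mu.-integrable _ _).
  by apply/funext => w /=; rewrite IE EFinB.
transitivity (\int[mu]_w (I Fp w * (4 + tsq w) `^ (- p) - I Fn w * (4 + tsq w) `^ (- p))).
  by apply: eq_Rintegral => w _.
rewrite RintegralB// Ep En -mulrBr; congr (_ * _); rewrite /pot.
have Ik (H : 'rV[R]_(m + 1) -> R) : continuous H -> (forall v, `|H v| <= B * kn 1 al v) ->
   (@lebm R m.+1).-integrable setT (fun y => (H (v0 - vec y) * kn 0 2^-1 (vec y))%:E).
  move=> cH Hb; apply: (@integrable_pot R m H B al B0 al_gt cH Hb (kn 0 2^-1) v0 2^-1 1) => //.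
  - by rewrite mulfV// ltr1n.
  - exact: measurable_kn.
  - by move=> v _; rewrite mul1r ger0_norm ?kn_ge0.
rewrite -RintegralB//; [|exact: Ik|exact: Ik].
by apply: eq_Rintegral => y _; rewrite -mulrBl -FE.
Qed.

End signed_rep.
End radon_representation.

(** * Iterated Laplacians *)

Section constants.
Context {R : realType}.

Lemma pair_const (q : R) : 1 <= q ->
  cauchy_const (q + 2^-1) * cauchy_const q = 2 * pi / (2 * q - 1).
Proof. by move=> q1; rewrite mulrC cauchy_const_pair. Qed.

Lemma cauchy_prod_recl2 m (p : R) :
  cauchy_prod m.+2 p = cauchy_const p * cauchy_const (p - 2^-1) * cauchy_prod m (p - 1).
Proof.
rewrite /cauchy_prod 2!big_ord_recl mulrA /= mul0r subr0 /bump /= addn0 div1r.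
congr (_ * _); apply: eq_bigr => i _; congr cauchy_const.
by rewrite /bump /= !add1n -addn2 natrD; field.
Qed.

(* [(-Delta)^k |x|^-1 = lap_coef n k * |x|^(-2k-1)] away from the origin of
   [R^(2n+1)]. *)
Definition lap_coef (n k : nat) : R := \prod_(i < k) ((2 * i%:R + 1) * (2 * n%:R - 2 * i%:R - 2)).

(** The odd factors gain a last term. The even factors depend on [n - i] only, so raising both
    shifts the product and adds a first term. *)
Lemma lap_coefS n : lap_coef n.+2 n.+1 = lap_coef n.+1 n * ((2 * n%:R + 1) * (2 * n%:R + 2)).
Proof.
rewrite /lap_coef !big_split /=.
have -> : \prod_(i < n.+1) (2 * i%:R + 1) = (\prod_(i < n) (2 * i%:R + 1)) * (2 * n%:R + 1) :> R.
  by rewrite big_ord_recr.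
have -> : \prod_(i < n.+1) (2 * n.+2%:R - 2 * i%:R - 2) =
    (2 * n%:R + 2) * \prod_(i < n) (2 * n.+1%:R - 2 * i%:R - 2) :> R.
  rewrite big_ord_recl; congr (_ * _).
    by rewrite -[n.+2%:R]natr1 -[n.+1%:R]natr1 /=; ring.
  apply: eq_bigr => i _; rewrite lift0 -[n.+2%:R]natr1 -[i.+1%:R]natr1; ring.
ring.
Qed.

(* The three factors are the constants of, respectively, the dual Radon
   composition, the [n] successive Laplacians, and the Newtonian kernel. *)
Lemma newton_constant n :
  (2 * pi) ^- (2 * n.+1) * cauchy_prod (n + n.+1) (n.+1%:R : R) * lap_coef n.+1 n *
  ((2 * n%:R + 1) * (2 * n%:R + 3)) * cauchy_prod (n.+1 + n.+1).+1 (n%:R + 5 / 2) = 1.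
Proof.
have pi0 : pi != 0 :> R by rewrite gt_eqF// pi_gt0.
have c32 : cauchy_const (3 / 2 : R) = 2.
  have := @pair_const 1 (lexx _); rewrite cauchy_const1 (_ : 1 + 2^-1 = 3 / 2); last by field.
  rewrite (_ : 2 * pi / (2 * 1 - 1) = 2 * pi); last by field.
  by move=> /(mulIf pi0).
(* Raising [n] adds two leading factors to each [cauchy_prod]. Each pair is half a step apart and is
   evaluated by [pair_const], so only [pi] and rationals remain to be matched. *)
elim: n => [|n IH].
  rewrite /lap_coef big_ord0 /= cauchy_prod_recl2 /cauchy_prod !big_ord1 mul0r !subr0 cauchy_const1.
  rewrite !mulr0 !add0r (_ : 5 / 2 - 1 = 3 / 2); last by field.
  rewrite c32 (_ : 5 / 2 - 2^-1 = 2); last by field.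
  have := @pair_const 2; rewrite (_ : 2 + 2^-1 = 5 / 2); last by field.
  rewrite ler1n => /(_ isT) ->; rewrite muln1.
  by move: (pi : R) pi0 => P P0; field.
rewrite addnS addSn cauchy_prod_recl2.
rewrite [X in cauchy_prod X (n.+1%:R + 5 / 2)](_ : _ = ((n.+1 + n.+1).+1).+2); last by rewrite !addSn !addnS.
rewrite (cauchy_prod_recl2 _ (n.+1%:R + 5 / 2)) lap_coefS.
have -> : n.+2%:R - 1 = n.+1%:R :> R by rewrite -[n.+2%:R]natr1 addrK.
have -> : n.+1%:R + 5 / 2 - 1 = n%:R + 5 / 2 :> R by rewrite -[n.+1%:R]natr1; ring.
have n0 : 0 <= n%:R :> R by [].
have P1 : cauchy_const n.+2%:R * cauchy_const (n.+2%:R - 2^-1) = pi / n.+1%:R :> R.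
  have h : 1 <= n.+2%:R - 2^-1 :> R by rewrite -[n.+2%:R]natr1 -[n.+1%:R]natr1; lra.
  have := @pair_const (n.+2%:R - 2^-1) h; rewrite subrK => ->.
  rewrite -[n.+2%:R]natr1 -[n.+1%:R]natr1; field.
  by rewrite !gt_eqF//; lra.
have P2 : cauchy_const (n.+1%:R + 5 / 2) * cauchy_const (n.+1%:R + 5 / 2 - 2^-1) =
    2 * pi / (2 * n%:R + 5) :> R.
  have h : 1 <= n.+1%:R + 2 :> R by rewrite -[n.+1%:R]natr1; lra.
  have := @pair_const (n.+1%:R + 2) h.
  rewrite (_ : n.+1%:R + 2 + 2^-1 = n.+1%:R + 5 / 2); last by field.
  rewrite (_ : n.+1%:R + 5 / 2 - 2^-1 = n.+1%:R + 2); last by field.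
  by move=> ->; congr (_ / _); rewrite -[n.+1%:R]natr1; ring.
rewrite P1 P2 (_ : (2 * n.+2)%N = (2 * n.+1 + 2)%N); last by rewrite (mulnS 2 n.+1) addnC.
rewrite exprD invfM.
rewrite -[RHS]mul1r -[X in _ = X * _]IH.
set X := cauchy_prod _ _; set Y := cauchy_prod _ _; set Z := lap_coef _ _.
set W := (_ ^- _).
rewrite -[n.+1%:R]natr1; move: (pi : R) pi0 => P P0; field.
by rewrite P0 !gt_eqF//; lra.
Qed.
End constants.

(** * The Laplacian of a complex-valued function by real and imaginary parts *)

Section complex_laplacian.
Context {R : realType}.
Local Open Scope complex_scope.

Lemma partial_cplx d (a b a1 b1 : 'rV[R]_d -> R) j :
  (forall v, is_derive v (delta_mx 0 j : 'rV[R]_d) a (a1 v)) ->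
  (forall v, is_derive v (delta_mx 0 j : 'rV[R]_d) b (b1 v)) ->
  (forall v, pderivable (fun v => a v +i* b v) j v) /\
  partial j (fun v => a v +i* b v) = (fun v => a1 v +i* b1 v).
Proof.
move=> da db; split.
  by move=> v; split; [have [] := da v|have [] := db v].
by apply/funext => v; rewrite /partial /=; have [_ ->] := da v; have [_ ->] := db v.
Qed.

Lemma laplacian_cplx n (a b : 'rV[R]_(n + n + 1) -> R)
    (a1 b1 a2 b2 : 'I_(n + n + 1) -> 'rV[R]_(n + n + 1) -> R) :
  (forall j v, is_derive v (delta_mx 0 j : 'rV[R]__) a (a1 j v)) ->
  (forall j v, is_derive v (delta_mx 0 j : 'rV[R]__) b (b1 j v)) ->
  (forall j v, is_derive v (delta_mx 0 j : 'rV[R]__) (a1 j) (a2 j v)) ->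
  (forall j v, is_derive v (delta_mx 0 j : 'rV[R]__) (b1 j) (b2 j v)) ->
  has_laplacian (fun v => a v +i* b v) /\
  neg_laplacian (fun v => a v +i* b v) =
    (fun v => (- \sum_j a2 j v) +i* (- \sum_j b2 j v)).
Proof.
move=> da db da1 db1.
have P j := partial_cplx (da j) (db j).
have P1 j := partial_cplx (da1 j) (db1 j).
split.
  by move=> j v; split; [exact: (P j).1|rewrite (P j).2; exact: (P1 j).1].
apply/funext => v.
have E j : partial2 j (fun v => a v +i* b v) v = a2 j v +i* b2 j v.
  by rewrite /partial2 (P j).2 (P1 j).2.
have S k (x y : 'I_k -> R) : \sum_i (x i +i* y i) = (\sum_i x i) +i* (\sum_i y i) :> R[i].
  elim: k x y => [|k IH] x y; first by rewrite !big_ord0.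
  by rewrite !big_ord_recl IH.
rewrite /neg_laplacian /laplacian.
transitivity (- (\sum_(k < n) (a2 (lshift 1 (lshift n k)) v +i* b2 (lshift 1 (lshift n k)) v) +
  \sum_(k < n) (a2 (lshift 1 (rshift n k)) v +i* b2 (lshift 1 (rshift n k)) v) +
  (a2 (rshift (n + n) ord0) v +i* b2 (rshift (n + n) ord0) v)) : R[i]).
  by congr (- (_ + _ + _)); [apply: eq_bigr => k _; exact: E|apply: eq_bigr => k _; exact: E|exact: E].
rewrite !S !big_split_ord /= !big_ord1.
by apply/eqP; rewrite eq_complex /= !eqxx.
Qed.
End complex_laplacian.

(** * Laplacians of the potential, one at a time *)

Section iterated_laplacian.
Context {R : realType}.
Local Open Scope complex_scope.
Variables (n : nat).
Local Notation m := (n.+1 + n.+1)%N.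
Variables (Fr Fi : 'rV[R]_(m + 1) -> R) (B al lam c0 : R).
Hypotheses (B0 : 0 <= B) (al_gt : m%:R < 2 * al) (lam0 : 0 < lam).
Hypotheses (cFr : continuous Fr) (cFi : continuous Fi).
Hypothesis Frb : forall x, `|Fr x| <= B * kn 1 al x.
Hypothesis Fib : forall x, `|Fi x| <= B * kn 1 al x.
Hypothesis holder_r : forall x j, exists2 A, 0 <= A & forall t v, `|t| < 1 -> qn v <= 1 ->
  `|Fr (x + t *: delta_mx 0 j - v) - Fr (x + t *: delta_mx 0 j)| <= A * qn v `^ (lam / 2).
Hypothesis holder_i : forall x j, exists2 A, 0 <= A & forall t v, `|t| < 1 -> qn v <= 1 ->
  `|Fi (x + t *: delta_mx 0 j - v) - Fi (x + t *: delta_mx 0 j)| <= A * qn v `^ (lam / 2).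

Let pk (k : nat) : R := k%:R + 2^-1.

Let uk k v : R[i] :=
  (c0 * lap_coef n.+1 k * pot Fr (kn 0 (pk k)) v) +i* (c0 * lap_coef n.+1 k * pot Fi (kn 0 (pk k)) v).

Let mE : m%:R = 2 * n%:R + 2 :> R.
Proof. by rewrite natrD -[n.+1%:R]natr1; ring. Qed.

Let mSE : m.+1%:R = 2 * n%:R + 3 :> R.
Proof. by rewrite -[m.+1%:R]natr1 mE; ring. Qed.

Let pk_ge k : 2^-1 <= pk k.
Proof. by rewrite /pk lerDr. Qed.

Lemma lap_step (k : nat) : (k < n)%N ->
  has_laplacian (uk k) /\ neg_laplacian (uk k) = uk k.+1.
Proof.
move=> ltkn.
have lekn : k%:R + 1 <= n%:R :> R by rewrite natr1 ler_nat.
have h1 : 2 * pk k + 1 < m.+1%:R by rewrite mSE /pk; lra.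
have h2 : 2 * pk k + 2 < m.+1%:R by rewrite mSE /pk; lra.
set c := c0 * lap_coef n.+1 k.
have D1 (F : 'rV[R]_(m + 1) -> R) (cF : continuous F) (Fb : forall x, `|F x| <= B * kn 1 al x) j v :
    is_derive v (delta_mx 0 j : 'rV[R]__) (fun v => c * pot F (kn 0 (pk k)) v) (c * pot F (kn1 0 (pk k) j) v).
  apply: is_deriveZ; apply: dirder_derive.
  exact: (dirder_pot_kn B0 al_gt cF Fb j v (pk_ge k) h1).
have D2 (F : 'rV[R]_(m + 1) -> R) (cF : continuous F) (Fb : forall x, `|F x| <= B * kn 1 al x) j v :
    is_derive v (delta_mx 0 j : 'rV[R]__) (fun v => c * pot F (kn1 0 (pk k) j) v) (c * pot F (kn2 0 (pk k) j) v).
  apply: is_deriveZ; apply: dirder_derive.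
  exact: (dirder_pot_kn1 B0 al_gt cF Fb j v (pk_ge k) h2).
have SE (F : 'rV[R]_(m + 1) -> R) (cF : continuous F) (Fb : forall x, `|F x| <= B * kn 1 al x) v :
    - (\sum_j c * pot F (kn2 0 (pk k) j) v) = c0 * lap_coef n.+1 k.+1 * pot F (kn 0 (pk k.+1)) v.
  rewrite -mulr_sumr (sum_pot_kn2 B0 al_gt cF Fb v (pk_ge k) h2).
  have -> : pk k.+1 = pk k + 1 by rewrite /pk -[k.+1%:R]natr1; ring.
  (* The new factor is [- (4 p (p + 1) - 2 p (m + 1)) = 2 p (m - 1 - 2 p)] at [p = k + 1/2]. *)
  rewrite /c /lap_coef big_ord_recr /= mSE /pk -[n.+1%:R]natr1; by field.
have [H1 H2] := laplacian_cplx (D1 Fr cFr Frb) (D1 Fi cFi Fib) (D2 Fr cFr Frb) (D2 Fi cFi Fib).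
split; first exact: H1.
by rewrite /uk H2; apply/funext => v; rewrite !SE.
Qed.

Lemma lap_last :
  c0 * lap_coef n.+1 n * ((2 * n%:R + 1) * (2 * n%:R + 3)) * cauchy_prod m.+1 (n%:R + 5 / 2) = 1 ->
  has_laplacian (uk n) /\ neg_laplacian (uk n) = fun v => Fr v +i* Fi v.
Proof.
move=> C1.
have pE : pk n = (m%:R - 1) / 2 by rewrite mE /pk; field.
have h1 : 2 * pk n + 1 < m.+1%:R by rewrite mSE /pk; lra.
have m2 : (2 <= m)%N by rewrite addSn addnS.
set c := c0 * lap_coef n.+1 n.
have D1 (F : 'rV[R]_(m + 1) -> R) (cF : continuous F) (Fb : forall x, `|F x| <= B * kn 1 al x) j v :
    is_derive v (delta_mx 0 j : 'rV[R]__) (fun v => c * pot F (kn 0 (pk n)) v) (c * pot F (kn1 0 (pk n) j) v).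
  apply: is_deriveZ; apply: dirder_derive.
  exact: (dirder_pot_kn B0 al_gt cF Fb j v (pk_ge n) h1).
pose s2 F j v := pot F (kn2 1 (pk n) j) v + \int[@lebm R m.+1]_y
   ((F (v - vec y) - F v) * (kn2 0 (pk n) j (vec y) - kn2 1 (pk n) j (vec y))).
have D2 (F : 'rV[R]_(m + 1) -> R) (cF : continuous F) (Fb : forall x, `|F x| <= B * kn 1 al x)
   (hF : forall x j, exists2 A, 0 <= A & forall t v, `|t| < 1 -> qn v <= 1 ->
  `|F (x + t *: delta_mx 0 j - v) - F (x + t *: delta_mx 0 j)| <= A * qn v `^ (lam / 2)) j v :
    is_derive v (delta_mx 0 j : 'rV[R]__) (fun v => c * pot F (kn1 0 (pk n) j) v) (c * s2 F j v).
  apply: is_deriveZ; apply: dirder_derive.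
  exact: (dirder_pot_newton B0 al_gt m2 lam0 cF Fb hF pE j v).
have SE (F : 'rV[R]_(m + 1) -> R) (cF : continuous F) (Fb : forall x, `|F x| <= B * kn 1 al x)
   (hF : forall x j, exists2 A, 0 <= A & forall t v, `|t| < 1 -> qn v <= 1 ->
  `|F (x + t *: delta_mx 0 j - v) - F (x + t *: delta_mx 0 j)| <= A * qn v `^ (lam / 2)) v :
    - (\sum_j c * s2 F j v) = F v.
  rewrite -mulr_sumr (sum_pot_newton B0 al_gt m2 lam0 cF Fb hF pE).
  (* The mass of the mollified kernel at exponent [p + 2 = n + 5/2]; the remaining factor
     [4 p (p + 1)] is [(2n + 1)(2n + 3)]. *)
  have -> : \int[@lebm R m.+1]_y kn 1 (pk n + 2) (vec y) = cauchy_prod m.+1 (n%:R + 5 / 2).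
    have -> : n%:R + 5 / 2 = pk n + 2 by rewrite /pk; field.
    have pm : m.+1%:R + 1 <= 2 * (pk n + 2) by rewrite mSE /pk; lra.
    have := @integral_tsq_powR R m.+1 (pk n + 2) 1 ltr01 pm.
    rewrite powR1 mul1r => E; rewrite /Rintegral.
    under eq_integral do rewrite /kn qn_vec addrC.
    by rewrite E.
  rewrite -[RHS]mul1r -[X in _ = X * _]C1 -/c /pk; by field.
have [H1 H2] := laplacian_cplx (D1 Fr cFr Frb) (D1 Fi cFi Fib) (D2 Fr cFr Frb holder_r) (D2 Fi cFi Fib holder_i).
split; first exact: H1.
by rewrite /uk H2; apply/funext => v; rewrite !SE.
Qed.

Lemma iter_neg_laplacian_uk k : (k <= n)%N -> iter k (@neg_laplacian R n.+1) (uk 0) = uk k.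
Proof.
elim: k => // k IH ltkn; rewrite iterS IH; last exact: ltnW.
by have [] := lap_step ltkn.
Qed.

Lemma iterated_laplacian (u : 'rV[R]_(m + 1) -> R[i]) :
  c0 * lap_coef n.+1 n * ((2 * n%:R + 1) * (2 * n%:R + 3)) * cauchy_prod m.+1 (n%:R + 5 / 2) = 1 ->
  u = (fun v => (c0 * pot Fr (kn 0 2^-1) v) +i* (c0 * pot Fi (kn 0 2^-1) v)) ->
  (forall k, (k < n.+1)%N -> has_laplacian (iter k (@neg_laplacian R n.+1) u)) /\
  iter n.+1 (@neg_laplacian R n.+1) u = fun v => Fr v +i* Fi v.
Proof.
move=> C1 ->.
have -> : (fun v => (c0 * pot Fr (kn 0 2^-1) v) +i* (c0 * pot Fi (kn 0 2^-1) v)) = uk 0.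
  by apply/funext => v; rewrite /uk /lap_coef big_ord0 mulr1 /pk add0r.
have [H1 H2] := lap_last C1.
split; last by rewrite iterS iter_neg_laplacian_uk.
move=> k; rewrite ltnS leq_eqVlt => /orP[/eqP ->|ltkn].
  by rewrite iter_neg_laplacian_uk.
by rewrite iter_neg_laplacian_uk; [have [] := lap_step ltkn|exact: ltnW].
Qed.

End iterated_laplacian.

(** * Consequences of membership in the class [Cstar] *)

Section class_Cstar.
Context {R : realType}.
Local Open Scope complex_scope.

Lemma norm_Re_le (z : R[i]) : `|complex.Re z| <= Normc.normc z.
Proof.
by case: z => a b /=; rewrite -sqrtr_sqr ler_wsqrtr// lerDl sqr_ge0.
Qed.

Lemma norm_Im_le (z : R[i]) : `|complex.Im z| <= Normc.normc z.
Proof.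
by case: z => a b /=; rewrite -sqrtr_sqr ler_wsqrtr// lerDr sqr_ge0.
Qed.

Lemma ReB (z w : R[i]) : complex.Re (z - w) = complex.Re z - complex.Re w.
Proof. by case: z w => [a b] [c d]. Qed.

Lemma ImB (z w : R[i]) : complex.Im (z - w) = complex.Im z - complex.Im w.
Proof. by case: z w => [a b] [c d]. Qed.

Lemma continuous_lipschitz_comp d (F : 'rV[R]_d -> R[i]) (h : R[i] -> R) :
  (forall z w, `|h z - h w| <= Normc.normc (z - w)) ->
  continuous (F : 'rV[R]_d -> R[i]^o) -> continuous (fun x => h (F x)).
Proof.
move=> hL cF x A /nbhs_ballP[e /= e0 eA].
have e0' : 0 < e%:C :> R[i] by rewrite ltcE /= eqxx.
have /(@cvgrPdist_lt _ R[i]^o) /(_ _ e0') H := cF x.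
apply: filterS H => y zw; apply: eA; rewrite /ball /=.
apply: (le_lt_trans (hL _ _)).
move: zw.
by case: (F x - F y) => a b; rewrite normc_def ltcE /= eqxx.
Qed.

Lemma continuous_Re_comp d (F : 'rV[R]_d -> R[i]) :
  continuous (F : 'rV[R]_d -> R[i]^o) -> continuous (fun x => complex.Re (F x)).
Proof. by apply: continuous_lipschitz_comp => z w; rewrite -ReB norm_Re_le. Qed.

Lemma continuous_Im_comp d (F : 'rV[R]_d -> R[i]) :
  continuous (F : 'rV[R]_d -> R[i]^o) -> continuous (fun x => complex.Im (F x)).
Proof. by apply: continuous_lipschitz_comp => z w; rewrite -ImB norm_Im_le. Qed.

Lemma enormE d (x : 'rV[R]_d) : enorm x = qn x `^ (2^-1).
Proof. by rewrite powR12_sqrt ?qn_ge0. Qed.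

Lemma enorm_powR d (x : 'rV[R]_d) (r : R) : enorm x `^ r = qn x `^ (r / 2).
Proof. by rewrite enormE -powRrM mulrC. Qed.

Lemma qn_le_compact_bound d (G : 'rV[R]_d -> R) (r : R) : continuous G ->
  exists2 S, 0 <= S & forall x, qn x <= r -> `|G x| <= S.
Proof.
move=> cG.
pose K : set 'rV[R]_d := [set x | qn x <= r].
have cK : compact K.
  apply: bounded_closed_compact; last first.
    rewrite (_ : K = @qn R d @^-1` [set y | y <= r])//.
    by apply: closed_comp; [move=> x _; exact: qn_continuous|exact: closed_le].
  exists (1 + `|r|); split; first exact: num_real.
  move=> M rM x Kx.
  have M0 : 0 < M by apply: le_lt_trans rM; rewrite addr_ge0.
  rewrite /= -[`|x|]/(mx_norm x) mx_normrE.
  apply/bigmax_leP; split; first exact: ltW.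
  move=> [i j] _ /=; rewrite (ord1 i).
  have h : x 0 j ^+ 2 <= `|r| by rewrite (le_trans (sqr_le_qn x j))// (le_trans Kx)// ler_norm.
  have h2 : `|x 0 j| ^+ 2 <= (1 + `|r|) ^+ 2.
    rewrite real_normK ?num_real// (le_trans h)//; have := normr_ge0 r; nra.
  apply: le_trans (ltW rM).
  by move: h2; rewrite ler_sqr ?nnegrE// addr_ge0.
have [K0|/set0P[x1 Kx1]] := eqVneq K set0.
  by exists 0 => // x Kx; have : K x by []; rewrite K0.
have cN : {within K, continuous (fun x => `|G x|)}.
  apply: continuous_subspaceT => x.
  by apply: (@continuous_comp _ _ _ G (fun y : R => `|y|)); [exact: cG|exact: norm_continuous].
have [c Kc cmax] := compact_EVT_max (ex_intro _ x1 Kx1) cK cN.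
exists `|G c| => // x Kx; apply: cmax; exact/mem_set.
Qed.

Lemma decay_bound d (G : 'rV[R]_d -> R) (delta : R) : 0 <= delta -> continuous G ->
  (exists A M, 0 < M /\ forall x, M < enorm x -> `|G x| <= A * enorm x `^ (- delta)) ->
  exists2 B, 0 <= B & forall x, `|G x| <= B * kn 1 (delta / 2) x.
Proof.
move=> d0 cG [A [M [M0 GA]]].
(* Taking [r >= 1] gives [|x|^2 >= (|x|^2 + 1) / 2] outside the compact ball, whence the factor
   [2^(delta/2)]. *)
pose r := Num.max 1 (M ^+ 2).
have [S S0 GS] := qn_le_compact_bound r cG.
have r1 : 1 <= r by rewrite le_max lexx.
exists (S * (r + 1) `^ (delta / 2) + `|A| * 2 `^ (delta / 2)).
  by rewrite addr_ge0 ?mulr_ge0 ?powR_ge0.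
move=> x; have d2 : 0 <= delta / 2 by rewrite divr_ge0.
have q1 := @qnD_gt0 R d 1 x ltr01.
rewrite mulrDl; have [xr|xr] := leP (qn x) r.
  rewrite ler_wpDr ?mulr_ge0 ?powR_ge0 ?kn_ge0//.
  apply: le_trans (GS x xr) _; rewrite -mulrA ler_peMr// /kn powRN.
  rewrite ler_pdivlMr ?powR_gt0// mul1r ge0_ler_powR ?nnegrE ?lerD2r ?(ltW q1)//.
  by rewrite addr_ge0// (le_trans ler01).
have x1 : 1 < qn x by exact: le_lt_trans xr.
have x0 : 0 < qn x by exact: lt_trans x1.
rewrite ler_wpDl ?mulr_ge0 ?powR_ge0 ?kn_ge0//.
have Mx : M < enorm x.
  rewrite enormE powR12_sqrt ?qn_ge0// -(ger0_norm (ltW M0)) -sqrtr_sqr ltr_sqrt//.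
  by apply: le_lt_trans xr; rewrite le_max lexx orbT.
apply: le_trans (GA x Mx) _.
rewrite (le_trans (ler_wpM2r (powR_ge0 _ _) (ler_norm A)))// -mulrA ler_wpM2l//.
rewrite enorm_powR mulNr /kn.
have -> : 2 `^ (delta / 2) = 2^-1 `^ (- (delta / 2)) :> R.
  by rewrite -[2^-1]powR_inv1// -powRrM mulN1r opprK.
rewrite -powRM ?invr_ge0 ?(ltW q1)//.
apply: powR_antitone; rewrite ?oppr_le0//.
  by rewrite mulr_gt0// invr_gt0.
by rewrite mulrC ler_pdivrMr//; lra.
Qed.

(** A union of segments through the centre. [Lip_loc] quantifies over connected domains. *)
Lemma ball_connected d (x : 'rV[R]_d) (e : R) : 0 < e -> connected (ball x e).
Proof.
move=> e0.
have -> : ball x e = \bigcup_(y in ball x e) ((fun s : R => x + s *: (y - x)) @` `[0, 1]%classic).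
  apply/seteqP; split=> [y xy|z [y xy [s /=]]].
    exists y => //; exists 1; first by rewrite /= in_itv /= lexx ler01.
    by rewrite scale1r addrC subrK.
  rewrite in_itv /= => /andP[s0 s1] <-.
  move: xy; rewrite -!ball_normE /= opprD addNKr normrN normrZ (ger0_norm s0) distrC.
  by apply: le_lt_trans; rewrite ler_piMl.
apply: bigcup_connected.
  exists x => y xy; exists 0; first by rewrite /= in_itv /= lexx ler01.
  by rewrite scale0r addr0.
move=> y xy; apply: connected_continuous_connected; first exact: segment_connected.
apply: continuous_subspaceT => s; apply: cvgD; first exact: cvg_cst.
by apply: cvgZr_tmp; exact: cvg_id.
Qed.

Lemma Lip_loc_line d (F : 'rV[R]_d -> R[i]) (lam : R) : Lip_loc lam F ->
  forall x j, exists2 A, 0 <= A & forall t v, `|t| < 1 -> qn v <= 1 ->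
    Normc.normc (F (x + t *: delta_mx 0 j - v) - F (x + t *: delta_mx 0 j)) <=
      A * qn v `^ (lam / 2).
Proof.
move=> LF x j.
(* A sup-norm ball: the points compared below are within [1 + |t| < 2] of [x], so radius [4] is
   ample. *)
have [] := LF (ball x 4).
- exact: ball_open.
- exact: ball_connected.
- exists (`|x| + 4); split; first exact: num_real.
  move=> M xM y; rewrite -ball_normE /= => xy.
  rewrite -(subKr x y) (le_trans (ler_normB _ _))// (le_trans _ (ltW xM))// lerD2l ltW//.
move=> A A0 LA; exists A; first exact: ltW.
move=> t v t1 v1.
have coord (w : 'rV[R]_d) r : 0 < r -> (forall i, `|w 0 i| < r) -> `|w| < r.
  move=> r0 H; rewrite -[`|w|]/(mx_norm w) mx_normrE.
  by apply/bigmax_ltP; split => // -[a b] _ /=; rewrite (ord1 a).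
have vi i : `|v 0 i| <= 1.
  have h := le_trans (sqr_le_qn v i) v1.
  by rewrite -(@ler_sqr R) ?nnegrE// real_normK ?num_real// expr1n.
have ti i : `|(t *: delta_mx 0 j : 'rV[R]_d) 0 i| <= 1.
  rewrite !mxE normrM (le_trans _ (ltW t1))// ler_piMr//.
  by case: (_ && _); rewrite ?normr1 ?normr0.
have E (w : 'rV[R]_d) : w - v - w = - v by rewrite addrAC subrr sub0r.
have := LA (x + t *: delta_mx 0 j - v) (x + t *: delta_mx 0 j).
rewrite E enorm_powR qnN; apply.
- apply: subset_closure; rewrite -ball_normE /=.
  have -> : x - (x + t *: delta_mx 0 j - v) = v - t *: delta_mx 0 j.
    by rewrite -addrA opprD addNKr opprB.
  apply: coord => // i; rewrite mxE [X in _ + X]mxE.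
  have := vi i; have := ti i => h1 h2; rewrite (le_lt_trans (ler_normB _ _))//.
  by rewrite (le_lt_trans (lerD h2 h1))//; lra.
- apply: subset_closure; rewrite -ball_normE /= opprD addNKr normrN.
  by apply: coord => // i; rewrite (le_lt_trans (ti i))//; lra.
Qed.

End class_Cstar.

(** * The Heisenberg group *)

Section heisenberg_coordinates.
Context {R : realType}.
Local Notation Rb := (measurableTypeR R).
Local Open Scope complex_scope.
Variable n : nat.

(** Multiplication by [i] in real coordinates; it turns the symplectic form of the group law into a
    Euclidean inner product. *)
Definition symp (x : (n + n).-tuple Rb) (i : 'I_(n + n)) : R :=
  match fintype.split i with
  | inl j => - tnth x (rshift n j)
  | inr j => tnth x (lshift n j)
  end.

Lemma symp_lshift x j : symp x (lshift n j) = - tnth x (rshift n j).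
Proof. by rewrite /symp (unsplitK (inl j)). Qed.

Lemma symp_rshift x j : symp x (rshift n j) = tnth x (lshift n j).
Proof. by rewrite /symp (unsplitK (inr j)). Qed.

Lemma measurable_symp i : measurable_fun [set: (n + n).-tuple Rb] (fun x => symp x i).
Proof.
rewrite /symp; case: fintype.split => j; last exact: measurable_tnth.
by apply: measurableT_comp => //; exact: measurable_tnth.
Qed.

Lemma Im_sum (I : Type) (r : seq I) (z : I -> R[i]) :
  complex.Im (\sum_(i <- r) z i) = \sum_(i <- r) complex.Im (z i).
Proof. by elim/big_rec2: _ => // i y1 y2 _ <-; case: (z i) y2 => [? ?] [? ?]. Qed.

Lemma Im_hdot x w :
  complex.Im (hdot (@cplx_of_tuple R n w) (cplx_of_tuple x)) = tdot (symp x) w.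
Proof.
rewrite /hdot Im_sum /tdot big_split_ord /= -big_split /=.
by apply: eq_bigr => j _; rewrite !mxE symp_lshift symp_rshift /=; ring.
Qed.

Lemma Im_hdotC (z w : 'rV[R[i]]_n) : complex.Im (hdot z w) = - complex.Im (hdot w z).
Proof.
rewrite /hdot !Im_sum -sumrN; apply: eq_bigr => j _.
by case: (z 0 j) (w 0 j) => [a b] [c d] /=; ring.
Qed.

Lemma cnorm_sqr w : cnorm (@cplx_of_tuple R n w) ^+ 2 = tsq w.
Proof.
rewrite /cnorm sqr_sqrtr; last by apply: sumr_ge0 => j _; exact: sqr_ge0.
rewrite /tsq big_split_ord /= -big_split /=; apply: eq_bigr => j _.
by rewrite mxE /= sqr_sqrtr// addr_ge0// sqr_ge0.
Qed.

Lemma cplx_of_tuple_surj (z : 'rV[R[i]]_n) : exists x, z = @cplx_of_tuple R n x.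
Proof.
exists [tuple match fintype.split i with
  inl j => complex.Re (z 0 j) | inr j => complex.Im (z 0 j) end | i < n + n].
apply/rowP => j; rewrite mxE !tnth_mktuple (unsplitK (inl j)) (unsplitK (inr j)).
by case: (z 0 j).
Qed.

Lemma heis_of_vec x s : heis_of (vec (tcons (x, s))) = (@cplx_of_tuple R n x, s).
Proof.
congr pair; last by rewrite mxE vec_rshift tnth0.
have E1 (v : 'rV[R]_(n + n + 1)) j : lsubmx (lsubmx v) 0 j = v 0 (lshift 1 (lshift n j)).
  by rewrite !mxE.
have E2 (v : 'rV[R]_(n + n + 1)) j : rsubmx (lsubmx v) 0 j = v 0 (lshift 1 (rshift n j)).
  by rewrite !mxE.
by apply/rowP => j; rewrite [LHS]mxE [RHS]mxE E1 E2 !vec_lshift !tnthS.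
Qed.

Lemma heis_of_row (xi eta : 'rV[R]_n) tau :
  heis_of (row_mx (row_mx xi eta) tau%:M) = (cplx xi eta, tau).
Proof. by rewrite /heis_of row_mxKl row_mxKr !row_mxKl !row_mxKr mxE eqxx. Qed.

Lemma vec_surj (v : 'rV[R]_(n + n + 1)) : exists x s, v = vec (tcons (x, s)).
Proof.
exists [tuple v 0 (lshift 1 i) | i < n + n], (v 0 (rshift (n + n) ord0)).
apply/rowP => j; case: (split_ordP j) => i ->.
  by rewrite vec_lshift tnthS tnth_mktuple.
by rewrite (ord1 i) vec_rshift tnth0.
Qed.

(** Half of [i (x - x0)], hence of length [|x - x0| / 2]. *)
Definition ell (x0 x : (n + n).-tuple Rb) (i : 'I_(n + n)) : R :=
  2^-1 * (symp x i - symp x0 i).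

Lemma measurable_ell x0 i : measurable_fun [set: (n + n).-tuple Rb] (fun x => ell x0 x i).
Proof.
apply: measurable_funM => //; apply: measurable_funB => //.
exact: measurable_symp.
Qed.

Lemma lsq_ell x0 x :
  4 * lsq (ell x0 x) = \sum_(i < n + n) (tnth x i - tnth x0 i) ^+ 2.
Proof.
rewrite /lsq mulr_sumr !big_split_ord /= addrC; congr (_ + _); apply: eq_bigr => j _;
  rewrite /ell ?symp_lshift ?symp_rshift; by field.
Qed.

Lemma tdot_ell x0 x w : tdot (ell x0 x) w = 2^-1 * (tdot (symp x) w - tdot (symp x0) w).
Proof.
by rewrite /tdot -sumrB mulr_sumr; apply: eq_bigr => i _; rewrite /ell; ring.
Qed.

(** The square root in [psi] lowers the exponent of the dual weight from [n + 1/2] to [n], half the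
    dimension of the space of [w], as [pE] demands. *)
Lemma radon_weight (q : R) : 0 <= q ->
  Num.sqrt (1 + q / 4) * (2 / (4 + q) `^ (n%:R + 2^-1)) = (4 + q) `^ (- n%:R).
Proof.
move=> q0; have q4 : 0 < 4 + q by rewrite ltr_pwDl.
have -> : 1 + q / 4 = (4 + q) * (2^-1 ^+ 2) by field.
rewrite sqrtrM ?(ltW q4)// sqrtr_sqr ger0_norm ?invr_ge0// -powR12_sqrt ?(ltW q4)//.
rewrite powRN powRD ?(gt_eqF q4) ?implybT//.
have h1 : (4 + q) `^ 2^-1 != 0 by rewrite gt_eqF ?powR_gt0.
have h2 : (4 + q) `^ n%:R != 0 by rewrite gt_eqF ?powR_gt0.
by field; rewrite h1 h2.
Qed.

Lemma Re_real_scale (c d : R) (z : R[i]) : complex.Re (c%:C * z * d%:C) = complex.Re z * (c * d).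
Proof. by case: z => a b /=; ring. Qed.

Lemma Im_real_scale (c d : R) (z : R[i]) : complex.Im (c%:C * z * d%:C) = complex.Im z * (c * d).
Proof. by case: z => a b /=; ring. Qed.

Lemma RH_integrandE (f : @heis R n -> R[i]) z t x :
  RH_integrand f (cplx_of_tuple z) t (cplx_of_tuple x) =
  f (heis_of (vec (tcons (x, t - 2^-1 * tdot (symp x) z)))).
Proof. by rewrite heis_of_vec /RH_integrand Im_hdot. Qed.

Lemma RH_integrand_shift (f : @heis R n -> R[i]) x0 tau w x :
  RH_integrand f (cplx_of_tuple w) (tau - 2^-1 * complex.Im (hdot (cplx_of_tuple x0) (cplx_of_tuple w)))
    (cplx_of_tuple x) =
  f (heis_of (vec (tcons (x, tau - tdot (ell x0 x) w)))).
Proof.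
rewrite RH_integrandE Im_hdotC Im_hdot tdot_ell; congr (f (heis_of (vec (tcons (_, _))))); ring.
Qed.

End heisenberg_coordinates.

(** * The dual transform of the weighted Radon transform as a potential *)

Section heisenberg_radon.
Context {R : realType}.
Local Notation Rb := (measurableTypeR R).
Local Open Scope complex_scope.
Variables (n : nat) (f : @heis R n.+1 -> R[i]).
Local Notation m := (n.+1 + n.+1)%N.

Let Fr (v : 'rV[R]_(m + 1)) := complex.Re (f (heis_of v)).
Let Fi (v : 'rV[R]_(m + 1)) := complex.Im (f (heis_of v)).

Variables (B al : R).
Hypotheses (B0 : 0 <= B) (al_gt : m%:R < 2 * al).
Hypotheses (cFr : continuous Fr) (cFi : continuous Fi).
Hypothesis Frb : forall x, `|Fr x| <= B * kn 1 al x.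
Hypothesis Fib : forall x, `|Fi x| <= B * kn 1 al x.

Lemma Cintegrable_RH_integrand z t : Cintegrable (RH_integrand f z t).
Proof.
have [w ->] := cplx_of_tuple_surj z.
have mh : measurable_fun [set: m.-tuple Rb] (fun x => t - 2^-1 * tdot (symp x) w).
  apply: measurable_funB => //; apply: measurable_funM => //.
  by apply: measurable_sum => i; apply: measurable_funM => //; exact: measurable_symp.
split.
  rewrite (_ : (fun x => _) = fun x => (Fr (vec (tcons (x, t - 2^-1 * tdot (symp x) w))))%:E).
    exact: (@integrable_slice R (n + n.+1) Fr B al B0 al_gt cFr Frb _ mh).
  by apply/funext => x; rewrite RH_integrandE.
rewrite (_ : (fun x => _) = fun x => (Fi (vec (tcons (x, t - 2^-1 * tdot (symp x) w))))%:E).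
  exact: (@integrable_slice R (n + n.+1) Fi B al B0 al_gt cFi Fib _ mh).
by apply/funext => x; rewrite RH_integrandE.
Qed.

Let psi (p : @heis R n.+1) : R[i] := (Num.sqrt (1 + cnorm p.1 ^+ 2 / 4))%:C * RH f p.

Let slice_int (F : 'rV[R]_(m + 1) -> R) x0 tau w :=
  \int[@lebm R m]_x F (vec (tcons (x, tau - tdot (ell x0 x) w))).

Let Re_RHdual_integrand x0 tau w :
  complex.Re (RHdual_integrand psi (cplx_of_tuple x0) tau (cplx_of_tuple w)) =
  slice_int Fr x0 tau w * (4 + tsq w) `^ (- n.+1%:R).
Proof.
rewrite /RHdual_integrand /psi Re_real_scale /= !cnorm_sqr radon_weight ?tsq_ge0//.
congr (_ * _); rewrite /slice_int /Rintegral /=; congr fine.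
by apply: eq_integral => x _; rewrite RH_integrand_shift.
Qed.

Let Im_RHdual_integrand x0 tau w :
  complex.Im (RHdual_integrand psi (cplx_of_tuple x0) tau (cplx_of_tuple w)) =
  slice_int Fi x0 tau w * (4 + tsq w) `^ (- n.+1%:R).
Proof.
rewrite /RHdual_integrand /psi Im_real_scale /= !cnorm_sqr radon_weight ?tsq_ge0//.
congr (_ * _); rewrite /slice_int /Rintegral /=; congr fine.
by apply: eq_integral => x _; rewrite RH_integrand_shift.
Qed.

Let pE : n.+1%:R = (n + n.+1).+1%:R / 2 :> R.
Proof. by rewrite -addSn natrD; field. Qed.

Let rep (F : 'rV[R]_(m + 1) -> R) (cF : continuous F) (Fb : forall x, `|F x| <= B * kn 1 al x) x0 tau :=
  @radon_rep R (n + n.+1) n.+1%:R pE (@ell R n.+1 x0) x0 tau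
    (@measurable_ell R n.+1 x0) (@lsq_ell R n.+1 x0) F B al B0 al_gt cF Fb.

Lemma Cintegrable_RHdual_integrand zeta tau : Cintegrable (RHdual_integrand psi zeta tau).
Proof.
have [x0 ->] := cplx_of_tuple_surj zeta; split.
  rewrite (_ : (fun x => _) = fun w => (slice_int Fr x0 tau w * (4 + tsq w) `^ (- n.+1%:R))%:E).
    exact: (rep cFr Frb x0 tau).1.
  by apply/funext => w; rewrite Re_RHdual_integrand.
rewrite (_ : (fun x => _) = fun w => (slice_int Fi x0 tau w * (4 + tsq w) `^ (- n.+1%:R))%:E).
  exact: (rep cFi Fib x0 tau).1.
by apply/funext => w; rewrite Im_RHdual_integrand.
Qed.

Lemma RHdual_potential v :
  RHdual psi (heis_of v) =
    (cauchy_prod (n + n.+1) n.+1%:R * pot Fr (kn 0 2^-1) v) +i*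
    (cauchy_prod (n + n.+1) n.+1%:R * pot Fi (kn 0 2^-1) v).
Proof.
have [x0 [tau ->]] := vec_surj v; rewrite heis_of_vec /RHdual /Cint /=.
congr (_ +i* _).
  apply: etrans (rep cFr Frb x0 tau).2.
  rewrite /Rintegral; congr fine.
  by apply: eq_integral => w _; congr EFin; exact: Re_RHdual_integrand.
apply: etrans (rep cFi Fib x0 tau).2.
rewrite /Rintegral; congr fine.
by apply: eq_integral => w _; congr EFin; exact: Im_RHdual_integrand.
Qed.
End heisenberg_radon.

(** * The inversion formula on the class [Cstar_heis] *)

Local Open Scope complex_scope.

Theorem theorem7p2 (R : realType) (n : nat) (hn : (1 <= n)%N)
    (delta : R) (hdelta : (2 * n)%:R < delta)
    (f : @heis R n -> R[i]) (hf : Cstar_heis delta f) :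
  let psi : @heis R n -> R[i] := fun p =>
    (Num.sqrt (1 + cnorm p.1 ^+ 2 / 4))%:C * RH f p in
  let g : @heis R n -> R[i] := fun p =>
    ((2 * pi) ^- (2 * n))%:C * RHdual psi p in
  let u : 'rV[R]_(n + n + 1) -> R[i] := g \o @heis_of R n in
  [/\ (* the integrals and derivatives in the formula exist *)
      forall z t, Cintegrable (RH_integrand f z t),
      forall zeta tau, Cintegrable (RHdual_integrand psi zeta tau),
      forall k : nat, (k < n)%N -> has_laplacian (iter k (@neg_laplacian R n) u)
    & forall (xi eta : 'rV[R]_n) (tau : R),
        f (cplx xi eta, tau) =
        iter n (@neg_laplacian R n) u (row_mx (row_mx xi eta) tau%:M)].
Proof.
case: n hn hdelta f hf => // n _ hdelta f [lam [lam0 _ [cf [A [M M0 fA]]] Lf]] psi g u.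
pose F v := f (heis_of v).
pose Fr v := complex.Re (F v); pose Fi v := complex.Im (F v).
have cFr : continuous Fr by exact: continuous_Re_comp.
have cFi : continuous Fi by exact: continuous_Im_comp.
have d0 : 0 <= delta by apply: le_trans (ltW hdelta).
have [Br Br0 hBr] : exists2 B, 0 <= B & forall x, `|Fr x| <= B * kn 1 (delta / 2) x.
  apply: decay_bound => //; exists A, M; split=> // x Mx.
  by apply: le_trans (norm_Re_le _) _; exact: fA.
have [Bi Bi0 hBi] : exists2 B, 0 <= B & forall x, `|Fi x| <= B * kn 1 (delta / 2) x.
  apply: decay_bound => //; exists A, M; split=> // x Mx.
  by apply: le_trans (norm_Im_le _) _; exact: fA.
pose B := Br + Bi.
have B0 : 0 <= B by exact: addr_ge0.
have Frb x : `|Fr x| <= B * kn 1 (delta / 2) x.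
  by apply: le_trans (hBr x) _; rewrite ler_wpM2r ?kn_ge0// lerDl.
have Fib x : `|Fi x| <= B * kn 1 (delta / 2) x.
  by apply: le_trans (hBi x) _; rewrite ler_wpM2r ?kn_ge0// lerDr.
have al_gt : (n.+1 + n.+1)%:R < 2 * (delta / 2).
  by rewrite mulrC divfK// addnn -mul2n.
have hr x j : exists2 A, 0 <= A & forall t v, `|t| < 1 -> qn v <= 1 ->
    `|Fr (x + t *: delta_mx 0 j - v) - Fr (x + t *: delta_mx 0 j)| <= A * qn v `^ (lam / 2).
  have [L L0 hL] := Lip_loc_line Lf x j; exists L => // t v t1 v1.
  by apply: le_trans (hL t v t1 v1); rewrite -ReB norm_Re_le.
have hi x j : exists2 A, 0 <= A & forall t v, `|t| < 1 -> qn v <= 1 ->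
    `|Fi (x + t *: delta_mx 0 j - v) - Fi (x + t *: delta_mx 0 j)| <= A * qn v `^ (lam / 2).
  have [L L0 hL] := Lip_loc_line Lf x j; exists L => // t v t1 v1.
  by apply: le_trans (hL t v t1 v1); rewrite -ImB norm_Im_le.
pose c := (2 * pi) ^- (2 * n.+1) * cauchy_prod (n + n.+1) n.+1%:R : R.
have uE : u = fun v => (c * pot Fr (kn 0 2^-1) v) +i* (c * pot Fi (kn 0 2^-1) v).
  apply/funext => v.
  have -> : u v = ((2 * pi) ^- (2 * n.+1))%:C * RHdual psi (heis_of v) by [].
  rewrite (RHdual_potential B0 al_gt cFr cFi Frb Fib) /c.
  by congr (_ +i* _); rewrite mul0r ?subr0 ?addr0 mulrA.
(* [c] contains the normalisation [(2 pi)^(-2n)] of [g], so [newton_constant] is the statement that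
   all constants multiply to [1]. *)
have [lap lapE] := iterated_laplacian B0 al_gt lam0 cFr cFi Frb Fib hr hi (newton_constant n) uE.
split.
- exact: (Cintegrable_RH_integrand B0 al_gt cFr cFi Frb Fib).
- exact: (Cintegrable_RHdual_integrand B0 al_gt cFr cFi Frb Fib).
- exact: lap.
move=> xi eta tau; rewrite lapE /Fr /Fi /F heis_of_row.
by case: (f _).
Qed.
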